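(* Let $A$ be a non-positive DG-ring and let $I \in \mathsf{D}(A)$. Then the following are equivalent: (1) Either $I \cong 0$, or both $\inf\{i \mid \mathrm{H}^i(I) \neq 0\} = 0$ and $$\inf \{ n \in \mathbb{Z} \mid \operatorname{Ext}^i_A(N,I) = 0 \text{ for any } N \in \mathsf{D}^{\mathrm{b}}(A) \text{ and any } i>n-\inf (N)\} = 0.$$ (2) Either $I \cong 0$, or both $\inf\{i \mid \mathrm{H}^i(I) \neq 0\} = 0$ and $$\inf \{ n \in \mathbb{Z} \mid \operatorname{Ext}^i_A(N,I) = 0 \text{ for any } N \in \mathsf{D}^{+}(A) \text{ and any } i>n-\inf (N)\} = 0.$$ (3) $I \in \mathsf{D}^{+}(A)$, and for any ring $B$ and any map of DG-rings $A \to B$, there is an injective left $B$-module $J$ and an isomorphism $\mathrm{R}\operatorname{Hom}_A(B,I) \cong J$ in $\mathsf{D}(B)$. (4) For any $n \in \mathbb{Z}$ and any $M \in \mathsf{D}(A)$ there is an isomorphism $$\mathrm{H}^n \left(\mathrm{R}\operatorname{Hom}_A(M,I)\right) \cong \operatorname{Hom}_{\mathrm{H}^0(A)}(\mathrm{H}^{-n}(M),\mathrm{H}^0(I))$$ in $\operatorname{Mod}(\mathrm{H}^0(Z(A)))$ which is functorial in $M$, where $Z(A)$ is the center of $A$. (5) For any morphism $f:M \to N$ in $\mathsf{D}(A)$ such that $\mathrm{H}^0(f):\mathrm{H}^0(M) \to \mathrm{H}^0(N)$ is an injective map, the map $$\operatorname{Hom}_{\mathsf{D}(A)}(f,I): \operatorname{Hom}_{\mathsf{D}(A)}(N,I)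 \to \operatorname{Hom}_{\mathsf{D}(A)}(M,I)$$ is surjective. (6) For any morphism $f:I \to M$ in $\mathsf{D}(A)$ such that $\mathrm{H}^0(f): \mathrm{H}^0(I) \to \mathrm{H}^0(M)$ is an injective map, the morphism $f$ is a split monomorphism in $\mathsf{D}(A)$ (i.e. there is $g: M\to I$ in $\mathsf{D}(A)$ with $g\circ f = 1_I$).
   Context: Rings are associative and unital; modules and DG-modules are left (DG-)modules. A DG-ring is a $\mathbb{Z}$-graded ring $A=\bigoplus_n A^n$ with a $\mathbb{Z}$-linear differential $d$ of degree $+1$, $d\circ d=0$, satisfying $d(ab)=d(a)b+(-1)^i a\,d(b)$ for $a\in A^i$. It is non-positive if $A^i=0$ for all $i>0$; then $\mathrm{H}^0(A)$ is a ring and there is a canonical DG-ring map $A\to \mathrm{H}^0(A)$. A ring is regarded as a DG-ring concentrated in degree $0$. $\mathsf{D}(A)$ is the derived category of left DG-modules over $A$; $\mathsf{D}^{+}(A)$ (resp. $\mathsf{D}^{\mathrm{b}}(A)$) is the full subcategory of DG-modules with bounded below (resp. bounded) cohomology. Cohomology gives functors $\mathrm{H}^n:\mathsf{D}(A)\to \operatorname{Mod}(\mathrm{H}^0(A))$. For $N\in\mathsf{D}(A)$, $\inf(N)=\inf\{n\mid \mathrm{H}^n(N)\neq 0\}$, and $\operatorname{Ext}^i_A(N,M)=\mathrm{H}^i(\mathrm{R}\operatorname{Hom}_A(N,M))$. The center $Z(A)$ is the DG subring of $A$ spanned by homogeneous elements $z\in A^i$ such that $zb=(-1)^{ij}bz$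 for all $b\in A^j$ and all $j$. In (3), $\mathrm{R}\operatorname{Hom}_A(B,I)$ is a left DG $B$-module via the right action of $B$ on itself. *)

(* Defs.v *)
From HB Require Import structures.
From mathcomp Require Import all_boot all_order all_algebra.
From mathcomp Require Import boolp classical_sets functions constructive_ereal.
From mathcomp Require Import generic_quotient ring_quotient ring zify.

Set Implicit Arguments.
Unset Strict Implicit.
Unset Printing Implicit Defensive.

Import Order.TTheory GRing.Theory Num.Theory.
Local Open Scope quotient_scope.
Local Open Scope ring_scope.

#[local] Obligation Tactic := idtac.

(* Graded objects are families indexed by [int].  An operation landing in     *)
(* degree [k] takes a proof that [k] is the expected degree, e.g.             *)
(* [dmul (e : i + j = k) : A i -> A j -> A k]; this avoids transports along   *)
(* equalities of degrees.  Equality on [int] being decidable, the choice of   *)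
(* the proof is irrelevant.                                                   *)

Definition ksign (i : int) : int := (-1) ^ i.

Lemma ksignD i j : ksign (i + j) = ksign i * ksign j.
Proof. by rewrite /ksign exprzDr ?unitrN1. Qed.

Lemma ksignM i : ksign i * ksign i = 1.
Proof. by rewrite /ksign -exprzMl ?unitrN1// mulrNN mulr1 exp1rz. Qed.

Lemma ksign0 : ksign 0 = 1. Proof. by []. Qed.

Lemma ksign1 : ksign 1 = -1. Proof. by []. Qed.

Lemma ksignN i : ksign (- i) = ksign i.
Proof.
by rewrite -[LHS]mulr1 -(ksignM i) mulrA -ksignD addNr ksign0 mul1r.
Qed.

Section AdditiveMaps.
Variables (U V : zmodType) (f : U -> V).
Hypothesis fB : zmod_morphism f.

Let g : {additive U -> V} := HB.pack f (GRing.isZmodMorphism.Build U V f fB).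

Lemma mor0 : f 0 = 0. Proof. exact: (raddf0 g). Qed.
Lemma morD x y : f (x + y) = f x + f y. Proof. exact: (raddfD g). Qed.
Lemma morN x : f (- x) = - f x. Proof. exact: (raddfN g). Qed.
Lemma morMz x n : f (x *~ n) = f x *~ n. Proof. exact: (raddfMz g). Qed.
End AdditiveMaps.

Record cpx := Cpx {
  cobj :> int -> zmodType;
  cd : forall i j : int, i + 1 = j -> cobj i -> cobj j;
  cdB : forall (i j : int) (e : i + 1 = j), zmod_morphism (cd e);
  cdd : forall (i j k : int) (e : i + 1 = j) (e' : j + 1 = k) x,
    cd e' (cd e x) = 0 }.
Arguments cd {c i j} e x.

Section Cohomology.
Variables (C : cpx) (n : int).

Definition is_cocycle (x : C n) : bool := cd (erefl (n + 1)) x == 0.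

Lemma is_cocycle_zmod_closed : zmod_closed is_cocycle.
Proof.
split=> [|x y]; rewrite !unfold_in /is_cocycle ?(mor0 (cdB _))//.
by move=> /eqP x0 /eqP y0; rewrite cdB x0 y0 subrr.
Qed.
HB.instance Definition _ :=
  GRing.isZmodClosed.Build (C n) is_cocycle is_cocycle_zmod_closed.

Record cocycle := Cocycle { cocv :> C n; cocP : is_cocycle cocv }.
HB.instance Definition _ := [isSub for cocv].
HB.instance Definition _ := [Choice of cocycle by <:].
HB.instance Definition _ := [SubChoice_isSubZmodule of cocycle by <:].

Definition is_coboundary (z : cocycle) : bool :=
  `[< exists y : C (n - 1), cd (subrK 1 n) y = z >].

Lemma is_coboundary_zmod_closed : zmod_closed is_coboundary.
Proof.
split=> [|x y]; rewrite !unfold_in /is_coboundary.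
  by apply/asboolP; exists 0; rewrite (mor0 (cdB _)).
move=> /asboolP[u ux] /asboolP[v vy]; apply/asboolP; exists (u - v).
by rewrite cdB ux vy.
Qed.
HB.instance Definition _ :=
  GRing.isZmodClosed.Build cocycle is_coboundary is_coboundary_zmod_closed.

Definition coboundaries : zmodClosed cocycle :=
  GRing.ZmodClosed.clone cocycle is_coboundary _.

Definition coh : Type := {ideal_quot coboundaries}.
HB.instance Definition _ := GRing.Zmodule.on coh.

Definition cohcl (z : cocycle) : coh := \pi_({ideal_quot coboundaries}) z.

Lemma cohclB : zmod_morphism cohcl.
Proof. by move=> x y; exact: (raddfB (\pi_({ideal_quot coboundaries}))). Qed.

Lemma cohclP (x y : cocycle) :
  cohcl x = cohcl y <->
  exists i (e : i + 1 = n) (u : C i), cd e u = cocv x - cocv y.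
Proof.
have -> : cohcl x = cohcl y <-> is_coboundary (x - y).
  split=> [/eqP|xy]; first by rewrite -Quotient.idealrBE.
  by apply/eqP; rewrite -Quotient.idealrBE.
split=> [/asboolP[u ux]|[i [e [u ux]]]].
  by exists (n - 1), (subrK 1 n), u.
have ei : i = n - 1 by lia.
subst i; apply/asboolP; exists u.
by rewrite (eq_irrelevance (subrK 1 n) e).
Qed.

Definition cohrep (x : coh) : cocycle := repr (x : {ideal_quot coboundaries}).

Lemma cohrepK x : cohcl (cohrep x) = x.
Proof. exact: reprK. Qed.

End Cohomology.

Lemma cocycleP (C : cpx) n (x : cocycle C n) k (e : n + 1 = k) :
  cd e (cocv x) = 0.
Proof. by subst k; apply/eqP; exact: cocP. Qed.

Lemma is_cocycleP (C : cpx) n (x : C n) k (e : n + 1 = k) :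
  cd e x = 0 -> is_cocycle x.
Proof. by subst k => x0; exact/eqP. Qed.

Definition acyclic (C : cpx) := forall n (x : coh C n), x = 0.

Record cmap (C D : cpx) := CMap {
  cmapf :> forall n, C n -> D n;
  cmapB : forall n, zmod_morphism (@cmapf n);
  cmapd : forall (i j : int) (e : i + 1 = j) x,
    cmapf (cd e x) = cd e (cmapf x) }.
Arguments cmapf {C D} c {n} x.

Section CohomologyMap.
Variables (C D : cpx) (f : cmap C D) (n : int).

Lemma coc_map_subproof (z : cocycle C n) : is_cocycle (cmapf f (cocv z)).
Proof.
apply: (is_cocycleP (e := erefl)).
by rewrite -cmapd cocycleP (mor0 (@cmapB _ _ f _)).
Qed.

Definition coc_map (z : cocycle C n) : cocycle D n :=
  Cocycle (coc_map_subproof z).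

Definition cohmap (x : coh C n) : coh D n := cohcl (coc_map (cohrep x)).

Lemma cohmap_cl z : cohmap (cohcl z) = cohcl (coc_map z).
Proof.
have /cohclP[i [e [u ux]]] := cohrepK (cohcl z).
apply/cohclP; exists i, e, (cmapf f u).
by rewrite -cmapd ux cmapB.
Qed.
End CohomologyMap.

Definition quasi_iso (C D : cpx) (f : cmap C D) :=
  forall n, bijective (@cohmap _ _ f n).

Record dgring := DGRing {
  dgr_cpx :> cpx;
  dmul : forall i j k : int, i + j = k -> dgr_cpx i -> dgr_cpx j -> dgr_cpx k;
  dgone : dgr_cpx 0;
  dmulBl : forall (i j k : int) (e : i + j = k) b,
    zmod_morphism (fun a => dmul e a b);
  dmulBr : forall (i j k : int) (e : i + j = k) a, zmod_morphism (dmul e a);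
  dmulA : forall (i j k ij jk ijk : int) (e1 : j + k = jk) (e2 : i + jk = ijk)
      (e3 : i + j = ij) (e4 : ij + k = ijk) a b c,
    dmul e2 a (dmul e1 b c) = dmul e4 (dmul e3 a b) c;
  dmul1l : forall (i : int) (e : 0 + i = i) a, dmul e dgone a = a;
  dmul1r : forall (i : int) (e : i + 0 = i) a, dmul e a dgone = a;
  dmuld : forall (i j k i' j' k' : int) (e : i + j = k) (ei : i + 1 = i')
      (ej : j + 1 = j') (ek : k + 1 = k') (el : i' + j = k') (er : i + j' = k')
      a b,
    cd ek (dmul e a b)
    = dmul el (cd ei a) b + dmul er a (cd ej b) *~ ksign i }.
Arguments dmul {d i j k} e a b.
Arguments dgone {d}.

Definition nonpositive (A : dgring) :=
  forall i : int, 0 < i -> forall a : A i, a = 0.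

Record dgring_map (A B : dgring) := DGRingMap {
  drm_cmap :> cmap A B;
  drmM : forall (i j k : int) (e : i + j = k) (a : A i) (b : A j),
    cmapf drm_cmap (dmul e a b) = dmul e (cmapf drm_cmap a) (cmapf drm_cmap b);
  drm1 : cmapf drm_cmap (dgone : A 0) = dgone }.

Record dgmod (A : dgring) := DGMod {
  dgm_cpx :> cpx;
  act : forall i j k : int, i + j = k -> A i -> dgm_cpx j -> dgm_cpx k;
  actBl : forall (i j k : int) (e : i + j = k) m,
    zmod_morphism (fun a => act e a m);
  actBr : forall (i j k : int) (e : i + j = k) a, zmod_morphism (act e a);
  actA : forall (i j k ij jk ijk : int) (e1 : j + k = jk) (e2 : i + jk = ijk)
      (e3 : i + j = ij) (e4 : ij + k = ijk) a b m,
    act e2 a (act e1 b m) = act e4 (dmul e3 a b) m;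
  act1 : forall (i : int) (e : 0 + i = i) m, act e dgone m = m;
  actd : forall (i j k i' j' k' : int) (e : i + j = k) (ei : i + 1 = i')
      (ej : j + 1 = j') (ek : k + 1 = k') (el : i' + j = k') (er : i + j' = k')
      a m,
    cd ek (act e a m) = act el (cd ei a) m + act er a (cd ej m) *~ ksign i }.
Arguments act {A d i j k} e a m.

Record dghom (A : dgring) (M N : dgmod A) := DGHom {
  dgh_cmap :> cmap M N;
  dghL : forall (i j k : int) (e : i + j = k) a m,
    cmapf dgh_cmap (act e a m) = act e a (cmapf dgh_cmap m) }.

Definition dgid (A : dgring) (M : dgmod A) : dghom M M :=
  @DGHom A M M
    (@CMap M M (fun _ x => x) (fun _ _ _ => erefl) (fun _ _ _ _ => erefl))
    (fun _ _ _ _ _ _ => erefl).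

Program Definition dgcomp (A : dgring) (M N P : dgmod A)
    (g : dghom N P) (f : dghom M N) : dghom M P :=
  @DGHom A M P (@CMap M P (fun _ x => cmapf g (cmapf f x)) _ _) _.
Next Obligation. by move=> * x y; rewrite /= !cmapB. Qed.
Next Obligation. by move=> *; rewrite /= !cmapd. Qed.
Next Obligation. by move=> *; rewrite /= !dghL. Qed.

Definition Hm (A : dgring) (M : dgmod A) (n : int) : Type := coh M n.
HB.instance Definition _ A (M : dgmod A) n := GRing.Zmodule.on (Hm M n).

Definition H0 (A : dgring) : Type := coh A 0.
HB.instance Definition _ A := GRing.Zmodule.on (H0 A).

Section H0act.
Variables (A : dgring) (M : dgmod A) (n : int).

Lemma coc_act_subproof (a : cocycle A 0) (z : cocycle M n) :
  is_cocycle (act (add0r n) (cocv a) (cocv z)).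
Proof.
have e1 : 1 + n = n + 1 by rewrite addrC.
have e2 : 0 + (n + 1) = n + 1 by rewrite add0r.
apply: (is_cocycleP (e := erefl)).
rewrite (actd _ (add0r 1) erefl _ e1 e2) !cocycleP.
by rewrite (mor0 (actBl _ _)) (mor0 (actBr _ _)) mul0rz addr0.
Qed.

Definition coc_act a z : cocycle M n := Cocycle (coc_act_subproof a z).

Lemma coc_act_cl a a' z z' : cohcl a = cohcl a' -> cohcl z = cohcl z' ->
  cohcl (coc_act a z) = cohcl (coc_act a' z').
Proof.
move=> /cohclP[i [e [u ua]]] /cohclP[j [e' [v vz]]].
have ei : i = -1 by lia.
have eji : i + n = j by lia.
have e0j : 0 + j = j by rewrite add0r.
have en : 0 + n = n by rewrite add0r.
have ej1 : i + (n + 1) = n by lia.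
apply/cohclP; exists j, e', (act eji u (cocv z) + act e0j (cocv a') v) => /=.
rewrite (morD (cdB _)) (actd _ e erefl _ (add0r n) ej1) cocycleP.
rewrite (mor0 (actBr _ _)) mul0rz addr0 ua.
have e1j : 1 + j = n by lia.
rewrite (actd _ (add0r 1) e' _ e1j (add0r n)) cocycleP (mor0 (actBl _ _)).
rewrite add0r ksign0 mulr1z vz actBl actBr.
by rewrite addrA subrK.
Qed.

Definition H0act (a : H0 A) (x : Hm M n) : Hm M n :=
  cohcl (coc_act (cohrep a) (cohrep x)).

Lemma H0act_cl a z : H0act (cohcl a) (cohcl z) = cohcl (coc_act a z).
Proof. by apply: coc_act_cl; rewrite cohrepK. Qed.
End H0act.

Definition dgreg (A : dgring) : dgmod A :=
  @DGMod A A (@dmul A) (@dmulBl A) (@dmulBr A) (@dmulA A) (@dmul1l A)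
    (@dmuld A).

Section H0ring.
Variable A : dgring.

Lemma coc_one_subproof : is_cocycle (dgone : A 0).
Proof.
apply: (is_cocycleP (e := add0r 1)).
have := dmuld (add0r 0) (add0r 1) (add0r 1) (add0r 1) (addr0 1) (add0r 1)
  (dgone : A 0) dgone.
rewrite dmul1l dmul1r ksign0 mulr1z dmul1l => /eqP.
by rewrite -subr_eq subrr eq_sym => /eqP.
Qed.

Definition H0one : H0 A := cohcl (Cocycle coc_one_subproof).
Definition H0mul (x y : H0 A) : H0 A :=
  H0act (M := dgreg A) x (y : Hm (dgreg A) 0).

Lemma cocycle_eq (C : cpx) n (x y : cocycle C n) : cocv x = cocv y -> x = y.
Proof. exact: val_inj. Qed.

Lemma H0act_one (M : dgmod A) n (x : Hm M n) : H0act H0one x = x.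
Proof.
rewrite -(cohrepK x) H0act_cl; congr cohcl; apply: cocycle_eq => /=.
exact: act1.
Qed.

Lemma H0act_mul (M : dgmod A) n (a b : H0 A) (x : Hm M n) :
  H0act a (H0act b x) = H0act (H0mul a b) x.
Proof.
rewrite -(cohrepK x) -(cohrepK a) -(cohrepK b).
have -> : H0mul (cohcl (cohrep a)) (cohcl (cohrep b))
    = cohcl (coc_act (M := dgreg A) (cohrep a) (cohrep b)).
  exact: (@H0act_cl A (dgreg A) 0 (cohrep a) (cohrep b)).
rewrite !H0act_cl; congr cohcl; apply: cocycle_eq; exact: actA.
Qed.

Lemma H0actDl (M : dgmod A) n (x : Hm M n) :
  {morph (@H0act A M n)^~ x : a b / a + b}.
Proof.
move=> a b; rewrite -(cohrepK x) -(cohrepK a) -(cohrepK b).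
rewrite -(morD (@cohclB _ _)) !H0act_cl -(morD (@cohclB _ _)).
congr cohcl; apply: cocycle_eq => /=; exact: (morD (actBl _ _)).
Qed.

Lemma H0actDr (M : dgmod A) n (a : H0 A) : {morph @H0act A M n a : x y / x + y}.
Proof.
move=> x y; rewrite -(cohrepK a) -(cohrepK x) -(cohrepK y).
rewrite -(morD (@cohclB _ _)) !H0act_cl -(morD (@cohclB _ _)).
congr cohcl; apply: cocycle_eq => /=; exact: (morD (actBr _ _)).
Qed.

Lemma H0mulA : associative H0mul.
Proof. by move=> a b c; exact: (@H0act_mul (dgreg A)). Qed.

Lemma H0mul1l : left_id H0one H0mul.
Proof. exact: (@H0act_one (dgreg A)). Qed.

Lemma H0mul1r : right_id H0one H0mul.
Proof.
move=> x; rewrite -(cohrepK x).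
rewrite [LHS](@H0act_cl A (dgreg A) 0 (cohrep x) (Cocycle coc_one_subproof)).
by congr cohcl; apply: cocycle_eq; exact: dmul1r.
Qed.

Lemma H0mulDl : left_distributive H0mul +%R.
Proof. by move=> a b c; exact: (@H0actDl (dgreg A)). Qed.

Lemma H0mulDr : right_distributive H0mul +%R.
Proof. by move=> a b c; exact: (@H0actDr (dgreg A)). Qed.

HB.instance Definition _ := GRing.Zmodule_isPzRing.Build (H0 A)
  H0mulA H0mul1l H0mul1r H0mulDl H0mulDr.
End H0ring.

HB.instance Definition _ (A : dgring) (M : dgmod A) n :=
  GRing.Zmodule_isLmodule.Build (H0 A) (Hm M n)
    (@H0act_mul A M n) (@H0act_one A M n) (@H0actDr A M n)
    (fun x => @H0actDl A M n x).

Section Center.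
Variable A : dgring.

Definition is_central i (z : A i) : bool :=
  `[< forall (j k : int) (e : i + j = k) (e' : j + i = k) (b : A j),
        dmul e z b = dmul e' b z *~ ksign (i * j) >].

Lemma is_central_zmod_closed i : zmod_closed (@is_central i).
Proof.
split=> [|x y]; rewrite !unfold_in.
  by apply/asboolP => *; rewrite (mor0 (dmulBl _ _)) (mor0 (dmulBr _ _)) mul0rz.
move=> /asboolP xc /asboolP yc; apply/asboolP => j k e e' b.
by rewrite dmulBl dmulBr (xc _ _ e e') (yc _ _ e e') mulrzBl.
Qed.
HB.instance Definition _ i :=
  GRing.isZmodClosed.Build (A i) (@is_central i) (is_central_zmod_closed i).

Record central i := Central { cenv :> A i; cenP : is_central cenv }.
HB.instance Definition _ i := [isSub for @cenv i].
HB.instance Definition _ i := [Choice of central i by <:].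
HB.instance Definition _ i := [SubChoice_isSubZmodule of central i by <:].

Lemma centralE i (z : central i) j k (e : i + j = k) (e' : j + i = k) b :
  dmul e (cenv z) b = dmul e' b (cenv z) *~ ksign (i * j).
Proof. by have /asboolP := cenP z; exact. Qed.

Lemma is_central_d i j (e : i + 1 = j) (z : central i) :
  is_central (cd e (cenv z)).
Proof.
apply/asboolP => p q e1 e2 b.
have e3 : i + p = q - 1 by lia.
have e4 : p + i = q - 1 by lia.
have e5 : i + (p + 1) = q by lia.
have e6 : (p + 1) + i = q by lia.
have := congr1 (cd (subrK 1 q)) (centralE z e3 e4 b).
rewrite (morMz (cdB _)) (dmuld _ e erefl _ e1 e5) (dmuld _ erefl e _ e6 e2).
rewrite (centralE z e5 e6).
rewrite mulrzDl -!mulrzA mulrDr mulr1 ksignD.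
have -> : ksign (i * p) * ksign i * ksign i = ksign (i * p).
  by rewrite -mulrA ksignM mulr1.
rewrite addrC => /addrI ->; congr (_ *~ _).
by rewrite -e mulrDl mul1r ksignD mulrC.
Qed.

Lemma is_central_mul i j k (e : i + j = k) (x : central i) (y : central j) :
  is_central (dmul e (cenv x) (cenv y)).
Proof.
apply/asboolP => p q e1 e2 b.
have e3 : j + p = q - i by lia.
have e4 : i + (q - i) = q by lia.
have e5 : p + j = q - i by lia.
have e6 : i + p = q - j by lia.
have e7 : (q - j) + j = q by lia.
have e8 : p + i = q - j by lia.
rewrite -(dmulA e3 e4) (centralE y e3 e5) (morMz (dmulBr _ _)).
rewrite (dmulA e5 e4 e6 e7) (centralE x e6 e8) (morMz (dmulBl _ _)).
rewrite -(dmulA e e2 e8 e7) -mulrzA; congr (_ *~ _).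
by rewrite -e mulrDl ksignD mulrC.
Qed.

Lemma is_central_one : is_central (dgone : A 0).
Proof.
apply/asboolP => j k e e' b; have ek : k = j by lia.
by move: e e'; rewrite ek => e e'; rewrite dmul1l dmul1r mul0r ksign0.
Qed.

Lemma central_eq i (x y : central i) : cenv x = cenv y -> x = y.
Proof. exact: val_inj. Qed.

Lemma cenvB i : zmod_morphism (@cenv i).
Proof. by []. Qed.

Definition center_cpx : cpx.
Proof.
refine (@Cpx (fun i => central i : zmodType)
  (fun i j e z => Central (is_central_d e z)) _ _).
- by move=> i j e x y; apply: central_eq => /=; rewrite cdB.
- by move=> *; apply: central_eq => /=; rewrite cdd.
Defined.

Definition center : dgring.
Proof.
refine (@DGRing center_cpx (fun i j k e x y => Central (is_central_mul e x y))
  (Central is_central_one) _ _ _ _ _ _).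
- by move=> i j k e b x y; apply: central_eq => /=; rewrite dmulBl.
- by move=> i j k e b x y; apply: central_eq => /=; rewrite dmulBr.
- by move=> *; apply: central_eq => /=; exact: dmulA.
- by move=> *; apply: central_eq => /=; exact: dmul1l.
- by move=> *; apply: central_eq => /=; exact: dmul1r.
- move=> i j k i' j' k' e ei ej ek el er a b; apply: central_eq => /=.
  rewrite (dmuld _ ei ej _ el er); congr (_ + _).
  by rewrite (morMz (@cenvB _)).
Defined.

Definition center_incl : dgring_map center A :=
  @DGRingMap center A
    (@CMap center A (fun i (z : central i) => cenv z) cenvB
       (fun _ _ _ _ => erefl))
    (fun _ _ _ _ _ _ => erefl) erefl.

Definition H0center (z : H0 center) : H0 A := cohmap center_incl z.
End Center.

Section HomComplex.
Variables (A : dgring) (M N : dgmod A).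

Record ghom (n : int) := GHom {
  ghf :> forall i j : int, i + n = j -> M i -> N j;
  ghfB : forall (i j : int) (e : i + n = j), zmod_morphism (ghf e);
  ghfL : forall (p i j k l : int) (e1 : p + i = k) (e2 : k + n = l)
      (e3 : i + n = j) (e4 : p + j = l) a m,
    ghf e2 (act e1 a m) = act e4 a (ghf e3 m) *~ ksign (n * p) }.
Arguments ghf {n} g {i j} e m.

Section GHom.
Variable n : int.

Lemma ghomP (f g : ghom n) :
  (forall (i j : int) (e : i + n = j) m, ghf f e m = ghf g e m) -> f = g.
Proof.
case: f => f fB fL; case: g => g gB gL /= fg.
have {}fg : f = g.
  by do 4! (apply: functional_extensionality_dep => ?).
by subst g; congr GHom; exact: Prop_irrelevance.
Qed.

HB.instance Definition _ := gen_eqMixin (ghom n).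
HB.instance Definition _ := gen_choiceMixin (ghom n).

Program Definition ghom0 := @GHom n (fun _ _ _ _ => 0) _ _.
Next Obligation. by move=> * x y; rewrite /= subrr. Qed.
Next Obligation. by move=> *; rewrite /= (mor0 (actBr _ _)) mul0rz. Qed.

Program Definition ghomN (f : ghom n) :=
  @GHom n (fun _ _ e m => - ghf f e m) _ _.
Next Obligation. by move=> f i j e x y; rewrite /= ghfB opprB opprK addrC. Qed.
Next Obligation.
move=> f p i j k l e1 e2 e3 e4 a m /=.
by rewrite (ghfL f _ _ e3 e4) (morN (actBr _ _)) mulNrz.
Qed.

Program Definition ghomD (f g : ghom n) :=
  @GHom n (fun _ _ e m => ghf f e m + ghf g e m) _ _.
Next Obligation. by move=> f g i j e x y; rewrite /= !ghfB opprD addrACA. Qed.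
Next Obligation.
move=> f g p i j k l e1 e2 e3 e4 a m /=.
by rewrite (ghfL f _ _ e3 e4) (ghfL g _ _ e3 e4) (morD (actBr _ _)) mulrzDl.
Qed.

Lemma ghomDA : associative ghomD.
Proof. by move=> f g h; apply: ghomP => *; exact: addrA. Qed.
Lemma ghomDC : commutative ghomD.
Proof. by move=> f g; apply: ghomP => *; exact: addrC. Qed.
Lemma ghom0D : left_id ghom0 ghomD.
Proof. by move=> f; apply: ghomP => *; exact: add0r. Qed.
Lemma ghomND : left_inverse ghom0 ghomN ghomD.
Proof. by move=> f; apply: ghomP => *; exact: addNr. Qed.

HB.instance Definition _ :=
  GRing.isZmodule.Build (ghom n) ghomDA ghomDC ghom0D ghomND.

Lemma ghomBE (f g : ghom n) i j (e : i + n = j) m :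
  ghf (f - g) e m = ghf f e m - ghf g e m.
Proof. by []. Qed.

Lemma ghomMzE (f : ghom n) z i j (e : i + n = j) m :
  ghf (f *~ z) e m = ghf f e m *~ z.
Proof. exact: (@morMz (ghom n) (N j) (fun f => ghf f e m)). Qed.
End GHom.

Lemma ghf_eq n (f : ghom n) i j (e e' : i + n = j) m : ghf f e m = ghf f e' m.
Proof. by rewrite (eq_irrelevance e e'). Qed.

Section Differential.
Variables (n n' : int) (en : n + 1 = n') (f : ghom n).

Lemma ghomd_e1 i j (e : i + n' = j) : i + n = j - 1.
Proof. by lia. Qed.
Lemma ghomd_e2 i j (e : i + n' = j) : i + 1 + n = j.
Proof. by lia. Qed.

(* [d f = d o f - (-1)^n f o d] *)
Definition ghomd_fun i j (e : i + n' = j) (m : M i) : N j :=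
  cd (subrK 1 j) (ghf f (ghomd_e1 e) m)
  - ghf f (ghomd_e2 e) (cd (erefl (i + 1)) m) *~ ksign n.

Lemma ghomd_funE i j (e : i + n' = j) i' j' (ei : i + 1 = i') (ej : j' + 1 = j)
    (e1 : i + n = j') (e2 : i' + n = j) m :
  ghomd_fun e m = cd ej (ghf f e1 m) - ghf f e2 (cd ei m) *~ ksign n.
Proof.
subst i'; have ej' : j' = j - 1 by lia.
move: ej e1; rewrite ej' => ej e1.
rewrite /ghomd_fun (eq_irrelevance ej (subrK 1 j)).
by rewrite (ghf_eq f e1 (ghomd_e1 e)) (ghf_eq f e2 (ghomd_e2 e)).
Qed.

Lemma ghomd_funB i j (e : i + n' = j) : zmod_morphism (ghomd_fun e).
Proof.
move=> x y; rewrite /ghomd_fun !ghfB !cdB ghfB mulrzBl.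
by rewrite !opprD !opprK addrACA.
Qed.

Lemma ghomd_funL p i j k l (e1 : p + i = k) (e2 : k + n' = l) (e3 : i + n' = j)
    (e4 : p + j = l) a m :
  ghomd_fun e2 (act e1 a m) = act e4 a (ghomd_fun e3 m) *~ ksign (n' * p).
Proof.
have f1 : k + n = l - 1 by lia.
have f2 : k + 1 + n = l by lia.
rewrite (ghomd_funE e2 erefl (subrK 1 l) f1 f2).
have f3 : i + n = j - 1 by lia.
have f4 : i + 1 + n = j by lia.
rewrite (ghomd_funE e3 erefl (subrK 1 j) f3 f4).
have g1 : p + (j - 1) = l - 1 by lia.
rewrite (ghfL f e1 f1 f3 g1) (morMz (cdB _)).
have g2 : (p + 1) + i = k + 1 by lia.
have g3 : p + (i + 1) = k + 1 by lia.
rewrite (actd _ erefl erefl _ g2 g3).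
have g4 : (p + 1) + (j - 1) = l by lia.
rewrite (actd _ erefl (subrK 1 j) _ g4 e4).
rewrite (morD (ghfB f _)) (morMz (ghfB f _)).
rewrite (ghfL f g2 f2 f3 g4) (ghfL f g3 f2 f4 e4).
rewrite actBr (morMz (actBr _ _)) mulrzBl !mulrzDl -!mulrzA.
rewrite -en mulrDl mulrDr mul1r mulr1 !ksignD.
have -> : ksign p * ksign (n * p) = ksign (n * p) * ksign p by rewrite mulrC.
have -> : ksign (n * p) * ksign n * ksign n = ksign (n * p).
  by rewrite -mulrA ksignM mulr1.
have -> : ksign (n * p) * (ksign p * ksign n)
        = ksign n * (ksign (n * p) * ksign p) by rewrite mulrA mulrC.
by rewrite opprD addrACA subrr add0r.
Qed.

Definition ghomd : ghom n' := GHom ghomd_funB ghomd_funL.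
End Differential.

Lemma ghomdB n n' (en : n + 1 = n') : zmod_morphism (ghomd en).
Proof.
move=> f g; apply: ghomP => i j e m.
rewrite ghomBE /= /ghomd_fun !ghomBE cdB mulrzBl.
by rewrite !opprD !opprK addrACA.
Qed.

Lemma ghomdd n n' n'' (e : n + 1 = n') (e' : n' + 1 = n'') f :
  ghomd e' (ghomd e f) = 0.
Proof.
apply: ghomP => i j ei m; rewrite [RHS]/=.
have f1 : i + n' = j - 1 by lia.
have f2 : i + 1 + n' = j by lia.
have f3 : i + n = j - 1 - 1 by lia.
have f4 : i + 1 + n = j - 1 by lia.
have f5 : i + 1 + 1 + n = j by lia.
rewrite /= (ghomd_funE e' _ _ erefl (subrK 1 j) f1 f2) /=.
rewrite (ghomd_funE e _ f1 erefl (subrK 1 _) f3 f4).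
rewrite (ghomd_funE e _ f2 erefl (subrK 1 _) f4 f5).
rewrite !cdd (mor0 (ghfB f _)) mul0rz subr0 cdB cdd sub0r (morMz (cdB _)).
by rewrite -e ksignD ksign1 mulrN1 mulrNz opprK addNr.
Qed.

Definition homC : cpx :=
  @Cpx (fun n => ghom n : zmodType) ghomd ghomdB ghomdd.
End HomComplex.
Arguments ghf {A M N n} g {i j} e m.

Section Precomposition.
Variables (A : dgring) (M N X : dgmod A) (u : dghom M N).

Program Definition precomp_fun n (f : ghom N X n) : ghom M X n :=
  @GHom A M X n (fun _ _ e m => ghf f e (cmapf u m)) _ _.
Next Obligation. by move=> n f *; move=> x y; rewrite cmapB ghfB. Qed.
Next Obligation.
by move=> n f p i j k l e1 e2 e3 e4 a m; rewrite /= dghL (ghfL f _ _ e3 e4).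
Qed.

Program Definition precomp : cmap (homC N X) (homC M X) :=
  @CMap (homC N X) (homC M X) precomp_fun _ _.
Next Obligation. by move=> n f g; apply: ghomP. Qed.
Next Obligation.
move=> i j e f; apply: ghomP => p q e' m.
by rewrite /= /ghomd_fun /= cmapd.
Qed.
End Precomposition.

Section HomCenter.
Variables (A : dgring) (M N : dgmod A).

Section Act.
Variables (p n k : int) (ek : p + n = k) (z : center A p) (f : homC M N n).

Lemma cact_e i j (e : i + k = j) : p + (i + n) = j.
Proof. by lia. Qed.

Definition cact_fun i j (e : i + k = j) (m : M i) : N j :=
  act (cact_e e) (cenv z) (ghf f (erefl (i + n)) m).

Lemma cact_funE i j (e : i + k = j) q (e1 : i + n = q) (e2 : p + q = j) m :
  cact_fun e m = act e2 (cenv z) (ghf f e1 m).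
Proof. by subst q; rewrite /cact_fun (eq_irrelevance (cact_e e) e2). Qed.

Lemma cact_funB i j (e : i + k = j) : zmod_morphism (cact_fun e).
Proof. by move=> x y; rewrite /cact_fun ghfB actBr. Qed.

Lemma cact_funL q i j l r (e1 : q + i = l) (e2 : l + k = r) (e3 : i + k = j)
    (e4 : q + j = r) a m :
  cact_fun e2 (act e1 a m) = act e4 a (cact_fun e3 m) *~ ksign (k * q).
Proof.
have f1 : l + n = r - p by lia.
have f2 : p + (r - p) = r by lia.
have f3 : i + n = j - p by lia.
have f4 : p + (j - p) = j by lia.
have f5 : q + (j - p) = r - p by lia.
have f6 : p + q = r - (j - p) by lia.
have f7 : r - (j - p) + (j - p) = r by lia.
have f8 : q + p = r - (j - p) by lia.
rewrite (cact_funE e2 f1 f2) (cact_funE e3 f3 f4).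
rewrite (ghfL f _ _ f3 f5) (morMz (actBr _ _)).
rewrite (actA f5 f2 f6 f7) (centralE z f6 f8) (morMz (actBl _ _)).
rewrite -(actA f4 e4) -mulrzA; congr (_ *~ _).
by rewrite -ek mulrDl ksignD.
Qed.

Definition cact : homC M N k := GHom cact_funB cact_funL.
End Act.

(* [(z f)(m) = z f(m)] *)
Definition homZ : dgmod (center A).
Proof.
refine (@DGMod (center A) (homC M N) cact _ _ _ _ _).
- move=> p n k e f x y; apply: ghomP => i j e1 m.
  by rewrite ghomBE /= /cact_fun actBl.
- move=> p n k e z f g; apply: ghomP => i j e1 m.
  by rewrite ghomBE /= /cact_fun actBr.
- move=> p q n pq qn pqn e1 e2 e3 e4 a b f; apply: ghomP => i j e m /=.
  have f1 : i + qn = j - p by lia.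
  have f2 : p + (j - p) = j by lia.
  have f3 : i + n = j - pq by lia.
  have f4 : pq + (j - pq) = j by lia.
  have f5 : q + (j - pq) = j - p by lia.
  rewrite (cact_funE e2 _ _ e f1 f2) (cact_funE e4 _ _ e f3 f4).
  by rewrite /= (cact_funE e1 _ _ f1 f3 f5); exact: actA.
- move=> n e f; apply: ghomP => i j e1 m /=.
  by rewrite (cact_funE e _ _ e1 e1 (add0r j)) act1.
- move=> p n k p' n' k' e ep en ek el er z f; apply: ghomP => i j e1 m.
  have -> : forall g h : ghom M N k',
      ghf (g + h) e1 m = ghf g e1 m + ghf h e1 m by [].
  rewrite ghomMzE /=.
  have f1 : i + k = j - 1 by lia.
  have f2 : i + 1 + k = j by lia.
  rewrite (ghomd_funE ek _ e1 erefl (subrK 1 j) f1 f2).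
  have f3 : i + n = j - p' by lia.
  have f4 : p' + (j - p') = j by lia.
  rewrite (cact_funE el _ _ e1 f3 f4).
  have f5 : i + n' = j - p by lia.
  have f6 : p + (j - p) = j by lia.
  rewrite (cact_funE er _ _ e1 f5 f6).
  have f7 : p + (j - p') = j - 1 by lia.
  have f8 : i + 1 + n = j - p by lia.
  rewrite /= (cact_funE e _ _ f1 f3 f7) (cact_funE e _ _ f2 f8 f6).
  have f9 : j - p' + 1 = j - p by lia.
  rewrite (ghomd_funE en _ f5 erefl f9 f3 f8).
  rewrite (actd _ ep f9 _ f4 f6) actBr (morMz (actBr _ _)) mulrzBl -addrA.
  congr (_ + (_ - _)); rewrite -mulrzA; congr (_ *~ _).
  by rewrite -e ksignD mulrC.
Defined.
End HomCenter.

Definition dgrestr (A B : dgring) (phi : dgring_map A B) : dgmod A.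
Proof.
refine (@DGMod A B (fun i j k e a b => dmul e (cmapf phi a) b) _ _ _ _ _).
- by move=> i j k e m x y; rewrite cmapB dmulBl.
- by move=> i j k e a; exact: dmulBr.
- by move=> i j k ij jk ijk e1 e2 e3 e4 a b c; rewrite drmM; exact: dmulA.
- by move=> i e m; rewrite drm1 dmul1l.
- by move=> i j k i' j' k' e ei ej ek el er a b; rewrite cmapd; exact: dmuld.
Defined.

Section HomB.
Variables (A B : dgring) (phi : dgring_map A B) (N : dgmod A).
Let BA := dgrestr phi.

Section Act.
Variables (p n k : int) (ek : p + n = k) (b : B p) (f : homC BA N n).

Lemma bact_e i j (e : i + k = j) : (i + p) + n = j.
Proof. by lia. Qed.

Definition bact_fun i j (e : i + k = j) (x : BA i) : N j :=
  ghf f (bact_e e) (dmul (erefl (i + p)) (x : B i) b : BA (i + p))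
  *~ ksign (p * (n + i)).

Lemma bact_funE i j (e : i + k = j) q (e1 : i + p = q) (e2 : q + n = j) x :
  bact_fun e x
  = ghf f e2 (dmul e1 (x : B i) b : BA q) *~ ksign (p * (n + i)).
Proof. by subst q; rewrite /bact_fun (ghf_eq f (bact_e e) e2). Qed.

Lemma bact_funB i j (e : i + k = j) : zmod_morphism (bact_fun e).
Proof. by move=> x y; rewrite /bact_fun dmulBl ghfB mulrzBl. Qed.

Lemma bact_funL q i j l r (e1 : q + i = l) (e2 : l + k = r) (e3 : i + k = j)
    (e4 : q + j = r) a x :
  bact_fun e2 (act e1 a x) = act e4 a (bact_fun e3 x) *~ ksign (k * q).
Proof.
have f1 : l + p = r - n by lia.
have f2 : r - n + n = r by lia.
have f3 : i + p = j - n by lia.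
have f4 : j - n + n = j by lia.
have f5 : q + (j - n) = r - n by lia.
rewrite (bact_funE e2 f1 f2) (bact_funE e3 f3 f4) /=.
rewrite -(dmulA f3 f5) (ghfL f (f5 : q + (j - n) = r - n) f2 f4 e4).
rewrite (morMz (actBr _ _)) -!mulrzA; congr (_ *~ _).
by rewrite -ek -e1 mulrDl !mulrDr !ksignD; ring.
Qed.

Definition bact : homC BA N k := GHom bact_funB bact_funL.
End Act.

(* The left [B]-action coming from the right action of [B] on itself:         *)
(* [(b f)(x) = (-1)^(|b| (|f| + |x|)) f(x b)].                                *)
Definition homB : dgmod B.
Proof.
refine (@DGMod B (homC BA N) bact _ _ _ _ _).
- move=> p n k e f x y; apply: ghomP => i j e1 m.
  by rewrite ghomBE /= /bact_fun dmulBr ghfB mulrzBl.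
- move=> p n k e b f g; apply: ghomP => i j e1 m.
  by rewrite ghomBE /= /bact_fun ghomBE mulrzBl.
- move=> p q n pq qn pqn e1 e2 e3 e4 a b f; apply: ghomP => i j e m /=.
  have f1 : i + p = j - qn by lia.
  have f2 : j - qn + qn = j by lia.
  have f3 : i + pq = j - n by lia.
  have f4 : j - n + n = j by lia.
  have f5 : j - qn + q = j - n by lia.
  rewrite (bact_funE e2 _ _ e f1 f2) (bact_funE e4 _ _ e f3 f4) /=.
  rewrite (bact_funE e1 _ _ f2 f5 f4) (dmulA e3 f3 f1 f5) -mulrzA.
  congr (_ *~ _).
  have -> : j - qn = i + p by lia.
  rewrite -e1 -e3 mulrDl !mulrDr !ksignD [q * p]mulrC.
  have -> : forall a b c d s : int,
      a * (b * s) * (s * c * d) = s * s * (c * d * (a * b)) by move=> *; ring.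
  by rewrite ksignM mul1r.
- move=> n e f; apply: ghomP => i j e1 m /=.
  by rewrite (bact_funE e _ _ e1 (addr0 i) e1) dmul1r mul0r ksign0.
- move=> p n k p' n' k' e ep en ek el er b f; apply: ghomP => i j e1 m.
  have -> : forall g h : ghom BA N k',
      ghf (g + h) e1 m = ghf g e1 m + ghf h e1 m by [].
  rewrite ghomMzE /=.
  have f1 : i + k = j - 1 by lia.
  have f2 : i + 1 + k = j by lia.
  rewrite (ghomd_funE ek _ e1 erefl (subrK 1 j) f1 f2) /=.
  have f3 : i + p' = j - n by lia.
  have f4 : j - n + n = j by lia.
  rewrite (bact_funE el _ _ e1 f3 f4).
  have f5 : i + p = j - n' by lia.
  have f6 : j - n' + n' = j by lia.
  rewrite (bact_funE er _ _ e1 f5 f6).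
  have f7 : j - n' + n = j - 1 by lia.
  have f8 : i + 1 + p = j - n by lia.
  rewrite (bact_funE e _ _ f1 f5 f7) (bact_funE e _ _ f2 f8 f4).
  have f9 : j - n' + 1 = j - n by lia.
  rewrite /= (ghomd_funE en _ f6 f9 (subrK 1 j) f7 f4) /=.
  rewrite (dmuld _ erefl ep _ f8 f3).
  rewrite (morMz (cdB _)) mulrzBl mulrzBl (morD (ghfB f _)) (morMz (ghfB f _)).
  rewrite mulrzDl -!mulrzA.
  have -> : ksign (p * (n' + i)) * ksign p = ksign (p * (n + i)).
    rewrite -en -ksignD.
    have -> : p * (n + 1 + i) + p = p * (n + i) + (p + p) by ring.
    by rewrite [LHS]ksignD [ksign (p + p)]ksignD ksignM mulr1.
  have -> : ksign (p * (n + (i + 1))) * ksign k = ksign n * ksign (p * (n + i)).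
    rewrite -e -!ksignD.
    have -> : p * (n + (i + 1)) + (p + n) = n + p * (n + i) + (p + p) by ring.
    by rewrite [LHS]ksignD [ksign (p + p)]ksignD ksignM mulr1.
  have -> : ksign (p' * (n + i)) = ksign i * ksign n * ksign (p * (n + i)).
    rewrite -ep -!ksignD; congr ksign; ring.
  rewrite [(_ + _) *~ (ksign (p * _))]mulrzDl -!mulrzA opprD.
  by rewrite addrCA [- _ - _]addrC [_ + (- _ - _)]addrA subrr add0r.
Defined.
End HomB.

Definition conc (V : zmodType) (i : int) : zmodType :=
  if i is Posz 0 then V else 'I_1 : zmodType.

Definition conc_map2 (U V W : zmodType) (f : U -> V -> W) (i j k : int) :
    conc U i -> conc V j -> conc W k :=
  match i, j, k return conc U i -> conc V j -> conc W k with
  | Posz 0, Posz 0, Posz 0 => f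
  | _, _, _ => fun _ _ => 0
  end.

Definition conc_cpx (V : zmodType) : cpx.
Proof.
refine (@Cpx (conc V) (fun _ _ _ _ => 0) _ _) => //.
by move=> i j e x y; rewrite subrr.
Defined.

Section ConcMap2.
Variables (U V W : zmodType) (f : U -> V -> W).

Lemma conc_map2Bl i j k v : (forall v, zmod_morphism (f^~ v)) ->
  zmod_morphism (fun u : conc U i => @conc_map2 U V W f i j k u v).
Proof.
move=> fB; case: i => [[|i]|i]; case: j v => [[|j]|j] v;
  case: k => [[|k]|k] x y; rewrite /= ?subrr //; exact: fB.
Qed.

Lemma conc_map2Br i j k u : (forall u, zmod_morphism (f u)) ->
  zmod_morphism (@conc_map2 U V W f i j k u).
Proof.
move=> fB; case: i u => [[|i]|i] u; case: j => [[|j]|j];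
  case: k => [[|k]|k] x y; rewrite /= ?subrr //; exact: fB.
Qed.

Lemma conc_map2_0 i j k u v : (i != 0) || (j != 0) ->
  @conc_map2 U V W f i j k u v = 0.
Proof.
by case: i u => [[|i]|i] u; case: j v => [[|j]|j] v; case: k => [[|k]|k].
Qed.
End ConcMap2.
Arguments conc_map2Bl {U V W f i j k} v fB.
Arguments conc_map2Br {U V W f i j k} u fB.
Arguments conc_map2_0 {U V W} f {i j k u v} h.

Lemma conc_map2A (U V W X Y Z : zmodType) (f : V -> W -> X) (g : U -> X -> Z)
    (h : U -> V -> Y) (l : Y -> W -> Z) (i j k ij jk ijk : int) a b c :
  (forall u, zmod_morphism (g u)) -> (forall w, zmod_morphism (l^~ w)) ->
  (forall u v w, g u (f v w) = l (h u v) w) ->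
  j + k = jk -> i + jk = ijk -> i + j = ij -> ij + k = ijk ->
  @conc_map2 _ _ _ g i jk ijk a (@conc_map2 _ _ _ f j k jk b c)
  = @conc_map2 _ _ _ l ij k ijk (@conc_map2 _ _ _ h i j ij a b) c.
Proof.
move=> gB lB E e1 e2 e3 e4.
have [jk0|] := boolP ((j != 0) || (k != 0)).
  rewrite (conc_map2_0 f) // (mor0 (conc_map2Br _ gB)).
  have [ij0|] := boolP ((i != 0) || (j != 0)).
    by rewrite (conc_map2_0 h) // (mor0 (conc_map2Bl c lB)).
  by rewrite negb_or !negbK => /andP[_ /eqP j0]; rewrite conc_map2_0 //; lia.
rewrite negb_or !negbK => /andP[/eqP j0 /eqP k0]; subst j k.
have [i0|] := boolP (i != 0).
  rewrite (conc_map2_0 g) ?i0 // (conc_map2_0 h) ?i0 //.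
  by rewrite (mor0 (conc_map2Bl c lB)).
by rewrite negbK => /eqP i0; subst i jk ij ijk; exact: E.
Qed.

Section Concentrated.
Variable B : pzRingType.

Definition dgring_of_ring : dgring.
Proof.
refine (@DGRing (conc_cpx B) (fun i j k _ => @conc_map2 B B B *%R i j k)
  (1 : B) _ _ _ _ _ _).
- by move=> i j k e b; apply: conc_map2Bl => v x y; exact: mulrBl.
- by move=> i j k e a; apply: conc_map2Br => u x y; exact: mulrBr.
- move=> *; apply: conc_map2A => //; [exact: mulrBr| |exact: mulrA].
  by move=> w x y; exact: mulrBl.
- by move=> i e a; case: i e a => [[|i]|i] e a //=; rewrite ?mul1r // [RHS]ord1.
- by move=> i e a; case: i e a => [[|i]|i] e a //=; rewrite ?mulr1 // [RHS]ord1.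
- move=> i j k i' j' k' e ei ej ek el er a b /=.
  rewrite (mor0 (conc_map2Bl (f := *%R) b _)); last first.
    by move=> v x y; exact: mulrBl.
  rewrite (mor0 (conc_map2Br (f := *%R) a _)) ?mul0rz ?addr0 //.
  by move=> u x y; exact: mulrBr.
Defined.

Definition dgmod_of_mod (J : lmodType B) : dgmod dgring_of_ring.
Proof.
refine (@DGMod dgring_of_ring (conc_cpx J)
  (fun i j k _ => @conc_map2 B J J *:%R i j k) _ _ _ _ _).
- by move=> i j k e b; apply: conc_map2Bl => v x y; exact: scalerBl.
- by move=> i j k e a; apply: conc_map2Br => u x y; exact: scalerBr.
- move=> *; apply: conc_map2A => //; [exact: scalerBr| |exact: scalerA].
  by move=> w x y; exact: scalerBl.
- by case=> [[|i]|i] e a //=; rewrite ?scale1r // [RHS]ord1.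
- move=> i j k i' j' k' e ei ej ek el er a b /=.
  rewrite (mor0 (conc_map2Bl (f := *:%R) b _)); last first.
    by move=> v x y; exact: scalerBl.
  rewrite (mor0 (conc_map2Br (f := *:%R) a _)) ?mul0rz ?addr0 //.
  by move=> u x y; exact: scalerBr.
Defined.
End Concentrated.

Definition injective_module (B : pzRingType) (J : lmodType B) :=
  forall (U V : lmodType B) (u : {linear U -> V}) (g : {linear U -> J}),
    injective u -> exists h : {linear V -> J}, forall x, h (u x) = g x.

Lemma zmod_morphism0 (U V : zmodType) : zmod_morphism (fun _ : U => 0 : V).
Proof. by move=> x y; rewrite subrr. Qed.

Definition zero_cpx : cpx :=
  @Cpx (fun _ => 'I_1 : zmodType) (fun _ _ _ _ => 0)
    (fun _ _ _ => @zmod_morphism0 _ _) (fun _ _ _ _ _ _ => erefl).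

Definition dgzero (A : dgring) : dgmod A.
Proof.
refine (@DGMod A zero_cpx (fun _ _ _ _ _ _ => 0) _ _ _ _ _).
- by move=> *; exact: zmod_morphism0.
- by move=> *; exact: zmod_morphism0.
- by [].
- by move=> i e m; exact: (esym (ord1 (m : 'I_1))).
- by move=> * /=; rewrite mul0rz addr0.
Defined.

(* [D(A)] is the localization of the category of DG-modules at the            *)
(* quasi-isomorphisms: morphisms are words in DG-module maps and formal       *)
(* inverses of quasi-isomorphisms, two words being identified when [Deq]      *)
(* relates them.                                                              *)
Inductive Dhom (A : dgring) : dgmod A -> dgmod A -> Type :=
| Dof M N : dghom M N -> Dhom M N
| Dinv M N (s : dghom M N) : quasi_iso s -> Dhom N M
| Dcomp M N P : Dhom N P -> Dhom M N -> Dhom M P.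

Definition Did (A : dgring) (M : dgmod A) : Dhom M M := Dof (dgid M).

Inductive Deq (A : dgring) :
    forall M N : dgmod A, Dhom M N -> Dhom M N -> Prop :=
| Deq_refl M N (f : Dhom M N) : Deq f f
| Deq_sym M N (f g : Dhom M N) : Deq f g -> Deq g f
| Deq_trans M N (f g h : Dhom M N) : Deq f g -> Deq g h -> Deq f h
| Deq_comp M N P (f f' : Dhom M N) (g g' : Dhom N P) :
    Deq g g' -> Deq f f' -> Deq (Dcomp g f) (Dcomp g' f')
| Deq_assoc M N P Q (f : Dhom M N) (g : Dhom N P) (h : Dhom P Q) :
    Deq (Dcomp h (Dcomp g f)) (Dcomp (Dcomp h g) f)
| Deq_idl M N (f : Dhom M N) : Deq (Dcomp (Did N) f) f
| Deq_idr M N (f : Dhom M N) : Deq (Dcomp f (Did M)) f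
| Deq_of M N P (f : dghom M N) (g : dghom N P) :
    Deq (Dcomp (Dof g) (Dof f)) (Dof (dgcomp g f))
| Deq_invl M N (s : dghom M N) (hs : quasi_iso s) :
    Deq (Dcomp (Dinv hs) (Dof s)) (Did M)
| Deq_invr M N (s : dghom M N) (hs : quasi_iso s) :
    Deq (Dcomp (Dof s) (Dinv hs)) (Did N).

Definition Diso (A : dgring) (M N : dgmod A) :=
  exists (f : Dhom M N) (g : Dhom N M),
    Deq (Dcomp g f) (Did M) /\ Deq (Dcomp f g) (Did N).

Definition split_mono (A : dgring) (M N : dgmod A) (f : Dhom M N) :=
  exists g : Dhom N M, Deq (Dcomp g f) (Did M).

(* Since [s] is a quasi-isomorphism, the [xget] below picks the unique        *)
(* preimage of [y] under [H^n(s)].                                            *)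
Fixpoint DH (A : dgring) (n : int) (M N : dgmod A) (f : Dhom M N) :
    Hm M n -> Hm N n :=
  match f in Dhom M N return Hm M n -> Hm N n with
  | Dof _ _ f => @cohmap _ _ f n
  | Dinv M N s _ => fun y => xget (0 : Hm M n) [set x | cohmap s x = y]
  | Dcomp _ _ _ g f => fun x => DH g (DH f x)
  end.

Definition bounded_below (A : dgring) (M : dgmod A) :=
  exists a : int, forall n : int, n < a -> forall x : Hm M n, x = 0.

Definition bounded (A : dgring) (M : dgmod A) :=
  exists a b : int, forall n : int, n < a \/ b < n -> forall x : Hm M n, x = 0.

Definition infZ (S : set int) : \bar int := infimum +oo%E (EFin @` S).

Definition infH (A : dgring) (M : dgmod A) : \bar int :=
  infZ [set n | exists x : Hm M n, x <> 0].

Definition K_injective (A : dgring) (I : dgmod A) :=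
  forall N : dgmod A, acyclic N -> acyclic (homC N I).

Definition Kinj_resolution (A : dgring) (M : dgmod A)
    (r : {I : dgmod A & dghom M I}) :=
  K_injective (projT1 r) /\ quasi_iso (projT2 r).

(* A chosen K-injective resolution; every DG-module over a DG-ring has one    *)
(* (Spaltenstein, Keller), so the default value is never used.                *)
Definition Kinj_res (A : dgring) (M : dgmod A) : {I : dgmod A & dghom M I} :=
  if pselect (exists r, @Kinj_resolution A M r) is left h
  then projT1 (cid h) else existT _ M (dgid M).

Definition Kinj (A : dgring) (M : dgmod A) : dgmod A := projT1 (Kinj_res M).

Definition RHom (A : dgring) (N M : dgmod A) : dgmod (center A) :=
  homZ N (Kinj M).

Definition Ext (A : dgring) (i : int) (N M : dgmod A) : Type := Hm (RHom N M) i.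
HB.instance Definition _ A i (N M : dgmod A) := GRing.Lmodule.on (Ext i N M).

(* [H^i(RHom_A(f, I))]; as in [DH], the [xget] is an inverse, this time of    *)
(* the map induced by a quasi-isomorphism into a K-injective DG-module.       *)
Fixpoint DExt (A : dgring) (I : dgmod A) (i : int) (M N : dgmod A)
    (f : Dhom M N) : Ext i N I -> Ext i M I :=
  match f in Dhom M N return Ext i N I -> Ext i M I with
  | Dof _ _ f => @cohmap _ _ (precomp (Kinj I) f) i
  | Dinv M N s _ => fun y =>
      xget (0 : Ext i N I) [set x | cohmap (precomp (Kinj I) s) x = y]
  | Dcomp _ _ _ g f => fun x => DExt f (DExt g x)
  end.

Definition RHom_ring (A B : dgring) (phi : dgring_map A B) (I : dgmod A) :
    dgmod B := homB phi (Kinj I).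

Definition inj_dim_bound (A : dgring) (P : dgmod A -> Prop) (I : dgmod A) :
    \bar int :=
  infZ [set n | forall N : dgmod A, P N -> forall i : int,
                  (n%:E - infH N < i%:E)%E -> forall x : Ext i N I, x = 0].

Lemma H0mul_cl (A : dgring) (a b : cocycle A 0) :
  (cohcl a : H0 A) * (cohcl b : H0 A) = cohcl (coc_act (M := dgreg A) a b).
Proof. exact: (@H0act_cl A (dgreg A) 0 a b). Qed.

Lemma H0centerC (A : dgring) (z : H0 (center A)) (a : H0 A) :
  H0center z * a = a * H0center z.
Proof.
rewrite -(cohrepK z) -(cohrepK a) /H0center cohmap_cl !H0mul_cl.
congr cohcl; apply: cocycle_eq => /=.
by rewrite (centralE _ _ (add0r 0)) mul0r ksign0.
Qed.

Lemma H0centerM (A : dgring) : {morph @H0center A : x y / x * y}.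
Proof.
move=> x y; rewrite -(cohrepK x) -(cohrepK y) H0mul_cl.
rewrite /H0center !cohmap_cl [RHS]H0mul_cl.
by congr cohcl; apply: cocycle_eq.
Qed.

Lemma H0centerD (A : dgring) : {morph @H0center A : x y / x + y}.
Proof.
move=> x y; rewrite -(cohrepK x) -(cohrepK y) -(morD (@cohclB _ _)).
rewrite /H0center !cohmap_cl -(morD (@cohclB _ _)).
by congr cohcl; apply: cocycle_eq.
Qed.

Lemma H0center1 (A : dgring) : H0center (1 : H0 (center A)) = 1.
Proof. by rewrite [LHS]cohmap_cl; congr cohcl; apply: cocycle_eq. Qed.

Section H0Hom.
Variables (A : dgring) (U V : lmodType (H0 A)).

Record H0Hom := MkH0Hom { h0f :> U -> V; h0fL : linear h0f }.

Lemma H0HomP (f g : H0Hom) : h0f f =1 h0f g -> f = g.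
Proof.
case: f => f fL; case: g => g gL /= /funext fg; subst g.
by congr MkH0Hom; exact: Prop_irrelevance.
Qed.

HB.instance Definition _ := gen_eqMixin H0Hom.
HB.instance Definition _ := gen_choiceMixin H0Hom.

Lemma h0f0_subproof : linear (fun _ : U => 0 : V).
Proof. by move=> a x y; rewrite scaler0 addr0. Qed.
Lemma h0fN_subproof (f : H0Hom) : linear (fun x => - f x).
Proof. by move=> a x y; rewrite h0fL opprD scalerN. Qed.
Lemma h0fD_subproof (f g : H0Hom) : linear (fun x => f x + g x).
Proof. by move=> a x y; rewrite !h0fL scalerDr addrACA. Qed.
Lemma h0fZ_subproof (z : H0 (center A)) (f : H0Hom) :
  linear (fun x => H0center z *: f x).
Proof.
by move=> a x y; rewrite h0fL scalerDr !scalerA H0centerC.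
Qed.

Definition h0f_zero := MkH0Hom h0f0_subproof.
Definition h0f_opp f := MkH0Hom (h0fN_subproof f).
Definition h0f_add f g := MkH0Hom (h0fD_subproof f g).
Definition h0f_scale z f := MkH0Hom (h0fZ_subproof z f).

Lemma h0f_addA : associative h0f_add.
Proof. by move=> f g h; apply: H0HomP => x; exact: addrA. Qed.
Lemma h0f_addC : commutative h0f_add.
Proof. by move=> f g; apply: H0HomP => x; exact: addrC. Qed.
Lemma h0f_add0 : left_id h0f_zero h0f_add.
Proof. by move=> f; apply: H0HomP => x; exact: add0r. Qed.
Lemma h0f_addN : left_inverse h0f_zero h0f_opp h0f_add.
Proof. by move=> f; apply: H0HomP => x; exact: addNr. Qed.

HB.instance Definition _ :=
  GRing.isZmodule.Build H0Hom h0f_addA h0f_addC h0f_add0 h0f_addN.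

Lemma h0f_scaleA a b f : h0f_scale a (h0f_scale b f) = h0f_scale (a * b) f.
Proof. by apply: H0HomP => x; rewrite /= scalerA H0centerM. Qed.
Lemma h0f_scale1 : left_id 1 h0f_scale.
Proof. by move=> f; apply: H0HomP => x; rewrite /= H0center1 scale1r. Qed.
Lemma h0f_scaleDr : right_distributive h0f_scale +%R.
Proof. by move=> z f g; apply: H0HomP => x; exact: scalerDr. Qed.
Lemma h0f_scaleDl f : {morph h0f_scale^~ f : a b / a + b}.
Proof. by move=> a b; apply: H0HomP => x; rewrite /= H0centerD scalerDl. Qed.

HB.instance Definition _ := GRing.Zmodule_isLmodule.Build (H0 (center A)) H0Hom
  h0f_scaleA h0f_scale1 h0f_scaleDr h0f_scaleDl.
End H0Hom.

(* Main.v *)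
From HB Require Import structures.
Require Import Defs.
From mathcomp Require Import all_boot all_order all_algebra.
From mathcomp Require Import boolp classical_sets functions constructive_ereal.
From mathcomp Require Import generic_quotient ring_quotient ring zify.

(** Let [K] be the K-injective resolution of [I]. For an injective abelian
    group [D], the cofree module [W = Hom_Z(A, D)] has by adjunction
    [H^n Hom_A(M, W) = Hom_Z(H^(-n) M, D)] for every [M], and [W] vanishes in
    negative degrees because [A] vanishes in positive ones. So the six
    conditions can be checked by hand for cofree modules, and they are
    inherited by retracts. The proof reduces every condition to one property,
    [cofree_retract]: [K] is a homotopy retract of a cofree module.

    From this property, [retract_null] and [retract_represent] say that the
    canonical map from [Ext^n(M, I)] to [Hom(H^(-n) M, H^0 I)] is bijective,
    which is (4); the vanishing of Ext in (1) and (2) is a special case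
    ([dim_of_retract]); and for (3), the dual of [B] inherits from
    [Hom_Z(B, D)] that it is concentrated in degree 0 and injective
    ([ring_dual_of_retract]).

    Conversely, there always is a map [f] from [K] to a cofree module [W] that
    is injective on [H^0] ([cofree_embedding]), and it has to be retracted.
    Under (6) this is immediate. Under (1), (2) or (3), Ext of degree [m] from
    a module with one cohomology group, in degree [j], to [I] vanishes for
    [m + j > 0]; under (3) this is seen over the ring [H^0 A], where [I]
    becomes an injective module ([retract_of_H0_dual]). The fiber [F] of [f]
    has cohomology in positive degrees only, possibly infinitely many, and the
    projection from [F] to [K] is null-homotopic by induction along the
    truncations of [F] ([null_on_positive]); this yields the retraction
    ([cofree_retract_of_vanishing]). Gluing the homotopies on all truncations
    requires a target that is injective as a graded module.

    That (4) implies (5) is the same argument about fibers: injectivity of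
    [H^0 f] means that the fiber of [f] maps to the source of [f] by zero on
    [H^0], and by naturality of the isomorphism in (4) this kills the
    obstruction ([extends_of_duality]).

    Two foundations are built on the way. K-injective and graded injective
    resolutions are limits of towers of modules coinduced from injective
    abelian groups, indexed by the natural numbers
    ([K_injective_resolution_exists]); and morphisms into a K-injective module
    in the derived category, a localization given by words, are homotopy
    classes of maps ([Deq_homotopic], [Dhom_Kinj], [Deq_homotopic_Kinj]). *)

Set Implicit Arguments.
Unset Strict Implicit.
Unset Printing Implicit Defensive.

Import Order.TTheory GRing.Theory Num.Theory.
Local Open Scope classical_set_scope.
Local Open Scope ring_scope.

#[local] Obligation Tactic := idtac.

(** * Transport between degrees *)

(** Transport between equal degrees. Every operation accepts any proof about
    its degrees, so the lemmas below absorb a transport into the neighbouring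
    operation. *)
Definition ctr (C : cpx) (i j : int) (e : i = j) (x : C i) : C j :=
  eq_rect i (fun k => C k) x j e.

Section Transport.
Variable C : cpx.

Lemma ctr_id i (e : i = i) (x : C i) : ctr e x = x.
Proof. by rewrite (eq_irrelevance e erefl). Qed.

Lemma ctrB i j (e : i = j) : zmod_morphism (@ctr C i j e).
Proof. by subst j. Qed.

Lemma ctr_ctr i j k (e : i = j) (e' : j = k) (e'' : i = k) (x : C i) :
  ctr e' (ctr e x) = ctr e'' x.
Proof. by subst j k; rewrite !ctr_id. Qed.

Lemma cd_irr i j (e e' : i + 1 = j) (x : C i) : cd e x = cd e' x.
Proof. by rewrite (eq_irrelevance e e'). Qed.

Lemma cd_ctr i j k (e : i = j) (e1 : j + 1 = k) (e2 : i + 1 = k) (x : C i) :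
  cd e1 (ctr e x) = cd e2 x.
Proof. by subst j; exact: cd_irr. Qed.

Lemma ctr_cd i j k (e : j = k) (e1 : i + 1 = j) (e2 : i + 1 = k) (x : C i) :
  ctr e (cd e1 x) = cd e2 x.
Proof. by subst k; exact: cd_irr. Qed.
End Transport.

Lemma cmapf_ctr (C D : cpx) (f : cmap C D) i j (e : i = j) x :
  cmapf f (ctr e x) = ctr e (cmapf f x).
Proof. by subst j. Qed.

Section TransportModule.
Variables (A : dgring) (M : dgmod A).

Lemma act_irr i j k (e e' : i + j = k) (a : A i) (m : M j) :
  act e a m = act e' a m.
Proof. by rewrite (eq_irrelevance e e'). Qed.

Lemma act_ctr i j j' k (e : j = j') (e1 : i + j' = k) (e2 : i + j = k)
  (a : A i) (m : M j) : act e1 a (ctr e m) = act e2 a m.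
Proof. by subst j'; exact: act_irr. Qed.

Lemma ctr_act i j k k' (e : k = k') (e1 : i + j = k) (e2 : i + j = k')
  (a : A i) (m : M j) : ctr e (act e1 a m) = act e2 a m.
Proof. by subst k'; exact: act_irr. Qed.
End TransportModule.

(** * The DG-category of graded maps *)

Section TransportGHom.
Variables (A : dgring) (M N : dgmod A).

Lemma ghf_ctr n (f : ghom M N n) i i' j (e : i = i') (e1 : i' + n = j)
  (e2 : i + n = j) m : ghf f e1 (ctr e m) = ghf f e2 m.
Proof. by subst i'; exact: ghf_eq. Qed.

Lemma ctr_ghf n (f : ghom M N n) i j j' (e : j = j') (e1 : i + n = j)
  (e2 : i + n = j') m : ctr e (ghf f e1 m) = ghf f e2 m.
Proof. by subst j'; exact: ghf_eq. Qed.

Lemma ghomDE n (f g : ghom M N n) i j (e : i + n = j) m :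
  ghf (f + g) e m = ghf f e m + ghf g e m.
Proof. by []. Qed.

Lemma ghomNE n (f : ghom M N n) i j (e : i + n = j) m :
  ghf (- f) e m = - ghf f e m.
Proof. by []. Qed.

Lemma ghomdE n n' (en : n + 1 = n') (f : ghom M N n) i j (e : i + n' = j) i' j'
    (ei : i + 1 = i') (ej : j' + 1 = j) (e1 : i + n = j') (e2 : i' + n = j) m :
  ghf (ghomd en f) e m = cd ej (ghf f e1 m) - ghf f e2 (cd ei m) *~ ksign n.
Proof. exact: ghomd_funE. Qed.
End TransportGHom.

Section Composition.
Variables (A : dgring) (M N P : dgmod A).

(** Graded maps of all degrees, with composition and the differential of
    [homC], form a DG-category, in which DG-module maps are the closed maps of
    degree 0. Homotopies, fibers and retracts are handled by computing in this
    category. *)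
Program Definition gof (u : dghom M N) : ghom M N 0 :=
  @GHom A M N 0
    (fun i j e m => ctr (etrans (esym (addr0 i)) e) (cmapf u m)) _ _.
Next Obligation. by move=> u i j e x y; rewrite cmapB ctrB. Qed.
Next Obligation.
move=> u p i j k l e1 e2 e3 e4 a m.
have e5 : p + i = l by rewrite e1 -e2 addr0.
by rewrite mul0r ksign0 mulr1z dghL (ctr_act _ _ e5) (act_ctr _ _ e5).
Qed.

Lemma gofE (u : dghom M N) i (e : i + 0 = i) m : ghf (gof u) e m = cmapf u m.
Proof. exact: ctr_id. Qed.

Lemma gof_closed (u : dghom M N) k (e : 0 + 1 = k) : ghomd e (gof u) = 0.
Proof.
apply: ghomP => i j e' m; have ei : i + 1 = j by lia.
rewrite (ghomdE e _ _ ei ei (addr0 i) (addr0 j)) !gofE cmapd.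
by rewrite ksign0 mulr1z subrr.
Qed.

Section DGHomOf.
Variables (f : ghom M N 0) (fd : ghomd (add0r 1) f = 0).

Program Definition dghom_of : dghom M N :=
  @DGHom A M N (@CMap M N (fun n x => ghf f (addr0 n) x) _ _) _.
Next Obligation. by move=> n; exact: ghfB. Qed.
Next Obligation.
move=> i j e x /=; have e1 : i + 1 = j by [].
have := congr1 (fun g => ghf g e x) fd; rewrite /=.
rewrite (ghomd_funE (add0r 1) f e e e (addr0 i) (addr0 j)).
by rewrite ksign0 mulr1z => /eqP; rewrite subr_eq0 => /eqP ->.
Qed.
Next Obligation.
move=> i j k e a m /=.
by rewrite (ghfL f e _ (addr0 j) e) mul0r ksign0.
Qed.

Lemma gof_dghom_of : gof dghom_of = f.
Proof.
by apply: ghomP => i j e m; rewrite /= (ctr_ghf f _ _ e).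
Qed.
End DGHomOf.

Section GComp.
Variables (p q r : int) (e : p + q = r) (g : ghom N P q) (f : ghom M N p).

Lemma gcomp_e i j : i + r = j -> i + p + q = j.
Proof. by lia. Qed.

Definition gcomp_fun i j (e' : i + r = j) (m : M i) : P j :=
  ghf g (gcomp_e e') (ghf f (erefl (i + p)) m).

Lemma gcomp_funE i j (e' : i + r = j) k (e1 : i + p = k) (e2 : k + q = j) m :
  gcomp_fun e' m = ghf g e2 (ghf f e1 m).
Proof. by subst k; exact: ghf_eq. Qed.

Lemma gcomp_funB i j (e' : i + r = j) : zmod_morphism (gcomp_fun e').
Proof. by move=> x y; rewrite /gcomp_fun !ghfB. Qed.

Lemma gcomp_funL s i j k l (e1 : s + i = k) (e2 : k + r = l) (e3 : i + r = j)
    (e4 : s + j = l) a m :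
  gcomp_fun e2 (act e1 a m) = act e4 a (gcomp_fun e3 m) *~ ksign (r * s).
Proof.
have f1 : k + p = l - q by lia.
have f2 : l - q + q = l by lia.
have f3 : i + p = j - q by lia.
have f4 : j - q + q = j by lia.
have f5 : s + (j - q) = l - q by lia.
rewrite (gcomp_funE e2 f1 f2) (gcomp_funE e3 f3 f4).
rewrite (ghfL f e1 f1 f3 f5) (morMz (ghfB g _)) (ghfL g f5 f2 f4 e4).
by rewrite -mulrzA -ksignD; congr (_ *~ ksign _); rewrite -e; ring.
Qed.

Definition gcomp : ghom M P r := GHom gcomp_funB gcomp_funL.

Lemma gcompE i j (e' : i + r = j) k (e1 : i + p = k) (e2 : k + q = j) m :
  ghf gcomp e' m = ghf g e2 (ghf f e1 m).
Proof. exact: gcomp_funE. Qed.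
End GComp.

Lemma gcompBl p q r (e : p + q = r) f : zmod_morphism (fun g => gcomp e g f).
Proof. by move=> g h; apply: ghomP. Qed.

Lemma gcompBr p q r (e : p + q = r) g : zmod_morphism (gcomp e g).
Proof. by move=> f h; apply: ghomP => *; rewrite /= /gcomp_fun ghomBE ghfB. Qed.

(** The Leibniz rule; the sign appears because the differential moves past
    [g]. *)
Lemma ghomd_comp p q r (e : p + q = r) p' q' r' (ep : p + 1 = p')
    (eq : q + 1 = q') (er : r + 1 = r') (e1 : p + q' = r') (e2 : p' + q = r')
    g f :
  ghomd er (gcomp e g f)
  = gcomp e1 (ghomd eq g) f + gcomp e2 g (ghomd ep f) *~ ksign q.
Proof.
apply: ghomP => i j e' m.
have f1 : i + r = j - 1 by lia.
have f2 : i + 1 + r = j by lia.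
rewrite ghomDE ghomMzE (ghomdE er _ e' erefl (subrK 1 j) f1 f2).
have g1 : i + p + q = j - 1 by lia.
have g3 : i + p + q' = j by lia.
have g4 : i + p' + q = j by lia.
have g5 : i + p + 1 = i + p' by lia.
have g6 : i + 1 + p = i + p' by lia.
rewrite (gcompE e g f f1 erefl g1) (gcompE e g f f2 g6 g4).
rewrite (gcompE e1 _ f e' erefl g3) (gcompE e2 g _ e' erefl g4).
rewrite (ghomdE eq g g3 g5 (subrK 1 j) g1 g4).
rewrite (ghomdE ep f erefl erefl g5 erefl g6).
rewrite ghfB (morMz (ghfB g _)) mulrzBl -!mulrzA addrA subrK.
by rewrite -e ksignD.
Qed.
End Composition.

Section CompositionLaws.
Variable A : dgring.

Lemma gcompA (M N P Q : dgmod A) p q r pq qr pqr (e1 : p + q = pq)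
    (e2 : pq + r = pqr) (e3 : q + r = qr) (e4 : p + qr = pqr)
    (h : ghom P Q r) (g : ghom N P q) (f : ghom M N p) :
  gcomp e2 h (gcomp e1 g f) = gcomp e4 (gcomp e3 h g) f.
Proof.
apply: ghomP => i j e m.
have f1 : i + pq = j - r by lia.
have f2 : j - r + r = j by lia.
have f3 : i + p + q = j - r by lia.
have f4 : i + p + qr = j by lia.
rewrite (gcompE e2 _ _ e f1 f2) (gcompE e1 g f f1 erefl f3).
by rewrite (gcompE e4 _ _ e erefl f4) (gcompE e3 _ _ f4 f3 f2).
Qed.

Lemma gcomp_idl (M N : dgmod A) p (e : p + 0 = p) (f : ghom M N p) :
  gcomp e (gof (dgid N)) f = f.
Proof.
by apply: ghomP => i j e' m; rewrite (gcompE e _ _ e' e' (addr0 j)) gofE.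
Qed.

Lemma gcomp_idr (M N : dgmod A) p (e : 0 + p = p) (f : ghom M N p) :
  gcomp e f (gof (dgid M)) = f.
Proof.
by apply: ghomP => i j e' m; rewrite (gcompE e _ _ e' (addr0 i) e') gofE.
Qed.

Lemma gof_comp (M N P : dgmod A) (e : 0 + 0 = 0) (g : dghom N P)
    (f : dghom M N) : gof (dgcomp g f) = gcomp e (gof g) (gof f).
Proof.
by apply: ghomP => i j e' m; rewrite (gcompE e _ _ e' (addr0 i) e') gofE.
Qed.

Lemma precompE (M N X : dgmod A) (u : dghom M N) n (e : 0 + n = n)
    (f : ghom N X n) : precomp X u n f = gcomp e f (gof u).
Proof.
by apply: ghomP => i j e' m; rewrite (gcompE e _ _ e' (addr0 i) e') gofE.
Qed.
End CompositionLaws.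

(** * Cocycles, coboundaries and quasi-isomorphisms *)

(** Most statements below only ask whether a cohomology class vanishes, so
    they speak of cochains that are [closed] or [bounding] and not of
    classes. *)
Definition closed (C : cpx) n (x : C n) := cd (erefl (n + 1)) x = 0.

Definition bounding (C : cpx) n (x : C n) :=
  exists k (e : k + 1 = n) (y : C k), cd e y = x.

Section ClosedBounding.
Variables (C : cpx) (n : int).
Implicit Types x y : C n.

Lemma closed_cd x : closed x -> forall k (e : n + 1 = k), cd e x = 0.
Proof. by move=> x0 k e; subst k. Qed.

Lemma closedI x k (e : n + 1 = k) : cd e x = 0 -> closed x.
Proof. by subst k. Qed.

Lemma closedB x y : closed x -> closed y -> closed (x - y).
Proof. by rewrite /closed cdB => -> ->; rewrite subrr. Qed.

Lemma closed0 : closed (0 : C n).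
Proof. exact: (mor0 (cdB _)). Qed.

Lemma closedMz x z : closed x -> closed (x *~ z).
Proof. by rewrite /closed (morMz (cdB _)) => ->; rewrite mul0rz. Qed.

Lemma bounding0 : bounding (0 : C n).
Proof. by exists (n - 1), (subrK 1 n), 0; rewrite (mor0 (cdB _)). Qed.

Lemma boundingP x k (e : k + 1 = n) : bounding x -> exists y : C k, cd e y = x.
Proof.
move=> [k' [e' [y dy]]]; have ek : k' = k by lia.
by subst k'; exists y; rewrite (cd_irr e e').
Qed.

Lemma boundingB x y : bounding x -> bounding y -> bounding (x - y).
Proof.
move=> /(boundingP (subrK 1 n))[u <-] /(boundingP (subrK 1 n))[v <-].
by exists (n - 1), (subrK 1 n), (u - v); rewrite cdB.
Qed.

Lemma boundingN x : bounding x -> bounding (- x).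
Proof. by rewrite -sub0r => bx; apply: boundingB => //; exact: bounding0. Qed.

Lemma boundingD x y : bounding x -> bounding y -> bounding (x + y).
Proof. by move=> bx /boundingN; rewrite -{2}(opprK y); exact: boundingB. Qed.

Lemma bounding_sym x y : bounding (x - y) -> bounding (y - x).
Proof. by move=> /boundingN; rewrite opprB. Qed.

Definition mkcoc x (xc : closed x) : cocycle C n :=
  Cocycle (is_cocycleP (e := erefl) xc).

Lemma cocycle_closed (z : cocycle C n) : closed (cocv z).
Proof. exact: cocycleP. Qed.

Lemma cohcl_eq (z w : cocycle C n) :
  cohcl z = cohcl w <-> bounding (cocv z - cocv w).
Proof. exact: cohclP. Qed.

Lemma cohcl_eq0 (z : cocycle C n) : cohcl z = 0 <-> bounding (cocv z).
Proof. by rewrite -(mor0 (@cohclB _ _)) cohcl_eq /= subr0. Qed.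

Lemma coh_ind (P : coh C n -> Prop) :
  (forall x (xc : closed x), P (cohcl (mkcoc xc))) -> forall c, P c.
Proof.
move=> H c; rewrite -(cohrepK c); have := H _ (cocycle_closed (cohrep c)).
by congr (P (cohcl _)); exact: val_inj.
Qed.
End ClosedBounding.

Lemma cmap_closed (C D : cpx) (f : cmap C D) n (x : C n) :
  closed x -> closed (cmapf f x).
Proof. by rewrite /closed -cmapd => ->; rewrite (mor0 (@cmapB _ _ f _)). Qed.

Lemma cmap_bounding (C D : cpx) (f : cmap C D) n (x : C n) :
  bounding x -> bounding (cmapf f x).
Proof. by move=> [k [e [y <-]]]; exists k, e, (cmapf f y); rewrite cmapd. Qed.

Lemma cohmapB (C D : cpx) (f : cmap C D) n : zmod_morphism (@cohmap C D f n).
Proof.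
move=> x y; rewrite -(cohrepK x) -(cohrepK y) -cohclB !cohmap_cl -cohclB.
by congr cohcl; apply: val_inj; exact: cmapB.
Qed.

Lemma coh_zeroP (C : cpx) n :
  (forall x : coh C n, x = 0) <-> (forall x : C n, closed x -> bounding x).
Proof.
split=> [H x xc|H]; last by apply: coh_ind => x xc; apply/cohcl_eq0/H.
exact/(cohcl_eq0 (mkcoc xc))/H.
Qed.

Lemma acyclicP (C : cpx) :
  acyclic C <-> forall n (x : C n), closed x -> bounding x.
Proof. by split=> H n; have /coh_zeroP := H n. Qed.

Section QuasiIso.
Variables (C D : cpx) (f : cmap C D).

Lemma cohmap_injP n : injective (@cohmap C D f n) <->
  (forall x : C n, closed x -> bounding (cmapf f x) -> bounding x).
Proof.
split=> [fi x xc bx|H x y].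
  apply/(cohcl_eq0 (mkcoc xc)); apply: fi.
  rewrite cohmap_cl (mor0 (@cohmapB _ _ f n)); exact/cohcl_eq0.
move=> /eqP; rewrite -subr_eq0 -(cohmapB f) => /eqP fz.
apply/eqP; rewrite -subr_eq0; apply/eqP; move: fz.
elim/coh_ind: (x - y) => z zc; rewrite cohmap_cl => /cohcl_eq0 fz.
exact/cohcl_eq0/H.
Qed.

Lemma cohmap_surjP n : (forall y, exists x, @cohmap C D f n x = y) <->
  (forall y : D n, closed y ->
     exists2 x : C n, closed x & bounding (cmapf f x - y)).
Proof.
split=> [H y yc|H].
  have [x] := H (cohcl (mkcoc yc)).
  elim/coh_ind: x => x xc; rewrite cohmap_cl => /cohcl_eq fx.
  by exists x.
apply: coh_ind => y yc; have [x xc bx] := H y yc.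
by exists (cohcl (mkcoc xc)); rewrite cohmap_cl; apply/cohcl_eq.
Qed.

Lemma bijectiveP (T U : Type) (g : T -> U) :
  injective g -> (forall y, exists x, g x = y) -> bijective g.
Proof.
move=> gi gs; exists (fun y => projT1 (cid (gs y))) => y; last first.
  exact: (projT2 (cid (gs y))).
exact/gi/(projT2 (cid (gs (g y)))).
Qed.

Lemma quasi_isoP : quasi_iso f <->
  (forall n (x : C n), closed x -> bounding (cmapf f x) -> bounding x) /\
  (forall n (y : D n), closed y ->
     exists2 x : C n, closed x & bounding (cmapf f x - y)).
Proof.
split=> [qf|[fi fs] n].
  split=> n; first exact/cohmap_injP/bij_inj.
  have [g gK gK'] := qf n.
  by apply/cohmap_surjP => y; exists (g y).
by apply: bijectiveP; [exact/cohmap_injP/fi|exact/cohmap_surjP/fs].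
Qed.
End QuasiIso.

(** * Fibers *)

Lemma pair_eq (U V : Type) (z w : U * V) : z.1 = w.1 -> z.2 = w.2 -> z = w.
Proof. by case: z w => [? ?] [? ?] /= -> ->. Qed.

Lemma fstMz (U V : zmodType) (z : U * V) s : (z *~ s).1 = z.1 *~ s.
Proof. exact: (@morMz (U * V)%type U fst). Qed.

Lemma sndMz (U V : zmodType) (z : U * V) s : (z *~ s).2 = z.2 *~ s.
Proof. exact: (@morMz (U * V)%type V snd). Qed.

Section Fiber.
Variables (A : dgring) (M N : dgmod A) (u : dghom M N).

Definition fib_obj (n : int) : zmodType := prod (N (n - 1)) (M n) : zmodType.

Lemma fib_cd_e1 (i j : int) (e : i + 1 = j) : i - 1 + 1 = j - 1.
Proof. by lia. Qed.
Lemma fib_cd_e2 (i j : int) (e : i + 1 = j) : i = j - 1.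
Proof. by lia. Qed.
Lemma fib_act_e (i j k : int) (e : i + j = k) : i + (j - 1) = k - 1.
Proof. by lia. Qed.

Definition fib_cd i j (e : i + 1 = j) (z : fib_obj i) : fib_obj j :=
  (ctr (fib_cd_e2 e) (cmapf u z.2) - cd (fib_cd_e1 e) z.1, cd e z.2).

Definition fib_act i j k (e : i + j = k) (a : A i) (z : fib_obj j) :
    fib_obj k := (act (fib_act_e e) a z.1 *~ ksign i, act e a z.2).

Definition fib_cpx : cpx.
Proof.
refine (@Cpx fib_obj fib_cd _ _).
- move=> i j e x y; apply: pair_eq; rewrite /= ?cdB // !cmapB ctrB.
  by rewrite !opprD !opprK addrACA.
- move=> i j k e e' x; apply: pair_eq; rewrite /= ?cdd //.
  have f : i + 1 = k - 1 by lia.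
  by rewrite cdB cdd subr0 cmapd (ctr_cd _ e f) (cd_ctr _ _ f) subrr.
Defined.

(** The homotopy fiber [N[-1] + M] of [u]. *)
Definition fib : dgmod A.
Proof.
refine (@DGMod A fib_cpx fib_act _ _ _ _ _).
- by move=> i j k e z a b; apply: pair_eq; rewrite /= actBl ?mulrzBl.
- by move=> i j k e z a b; apply: pair_eq; rewrite /= actBr ?mulrzBl.
- move=> i j k ij jk ijk e1 e2 e3 e4 a b z; apply: pair_eq; rewrite /=.
    rewrite (morMz (actBr _ _)) -mulrzA mulrC -ksignD e3; congr (_ *~ _).
    exact: actA.
  exact: actA.
- by move=> i e [y x]; apply: pair_eq; rewrite /= act1.
- move=> i j k i' j' k' e ei ej ek el er a z; apply: pair_eq;
  rewrite /= ?fstMz ?sndMz /=; last first.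
    exact: actd.
  rewrite (morMz (cdB _)) actBr !mulrzBl.
  have e1 : i' + (j - 1) = k' - 1 by lia.
  have e2 : i + (j' - 1) = k' - 1 by lia.
  rewrite (actd _ ei (fib_cd_e1 ej) _ e1 e2) (dghL u).
  have f : i + j = k' - 1 by lia.
  rewrite (ctr_act _ _ f) (act_ctr _ _ f) (act_irr _ e1) (act_irr _ e2).
  have -> : ksign i' = - ksign i by rewrite -ei ksignD mulrN1.
  rewrite mulrzDl mulrNz opprD -!mulrzA ksignM !mulr1z.
  by rewrite addrCA.
Defined.

Program Definition fib_proj : dghom fib M :=
  @DGHom A fib M (@CMap fib M (fun n z => z.2) _ _) _.
Next Obligation. by []. Qed.
Next Obligation. by []. Qed.
Next Obligation. by []. Qed.

Lemma fib_inN_e (i j : int) (e : i + 1 = j) : i = j - 1. Proof. by lia. Qed.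

Program Definition fib_inN : ghom N fib 1 :=
  @GHom A N fib 1 (fun i j e y => (ctr (fib_inN_e e) y, 0)) _ _.
Next Obligation.
by move=> i j e x y; apply: pair_eq; rewrite /= ?ctrB ?subrr.
Qed.
Next Obligation.
move=> p i j k l e1 e2 e3 e4 a m; have e5 : p + i = l - 1 by lia.
apply: pair_eq; rewrite ?fstMz ?sndMz /=.
  by rewrite (ctr_act _ _ e5) (act_ctr _ _ e5) -mulrzA mul1r ksignM mulr1z.
by rewrite (mor0 (actBr _ _)) mul0rz.
Qed.

Program Definition fib_inM : ghom M fib 0 :=
  @GHom A M fib 0 (fun i j e x => (0, ctr (etrans (esym (addr0 i)) e) x)) _ _.
Next Obligation.
by move=> i j e x y; apply: pair_eq; rewrite /= ?ctrB ?subrr.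
Qed.
Next Obligation.
move=> p i j k l e1 e2 e3 e4 a m; have e5 : p + i = l by lia.
rewrite mul0r ksign0 mulr1z; apply: pair_eq; rewrite /=.
  by rewrite (mor0 (actBr _ _)) mul0rz.
by rewrite (ctr_act _ _ e5) (act_ctr _ _ e5).
Qed.

Program Definition fib_prN : ghom fib N (-1) :=
  @GHom A fib N (-1) (fun i j e z => ctr e z.1) _ _.
Next Obligation. by move=> i j e x y; rewrite /= ctrB. Qed.
Next Obligation.
move=> p i j k l e1 e2 e3 e4 a m; have e5 : p + (i - 1) = l by lia.
rewrite /= (morMz (ctrB _)) (ctr_act _ _ e5) (act_ctr _ _ e5).
by rewrite mulN1r ksignN.
Qed.

Lemma fib_prN_inN (e : 1 - 1 = 0 :> int) :
  gcomp e fib_prN fib_inN = gof (dgid N).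
Proof.
apply: ghomP => i j e' m; have f1 : i + 1 = j + 1 by lia.
have f2 : j + 1 - 1 = j by lia.
by rewrite (gcompE e _ _ e' f1 f2) /=; apply: ctr_ctr.
Qed.

Lemma fib_proj_inN (e : 1 + 0 = 1 :> int) : gcomp e (gof fib_proj) fib_inN = 0.
Proof.
by apply: ghomP => i j e' m; rewrite (gcompE e _ _ e' e' (addr0 j)) gofE.
Qed.

Lemma fib_proj_inM (e : 0 + 0 = 0 :> int) :
  gcomp e (gof fib_proj) fib_inM = gof (dgid M).
Proof.
by apply: ghomP => i j e' m; rewrite (gcompE e _ _ e' e' (addr0 j)) gofE.
Qed.

Lemma fib_prN_inM (e : 0 - 1 = -1 :> int) : gcomp e fib_prN fib_inM = 0.
Proof.
apply: ghomP => i j e' m; have f1 : i + 0 = j + 1 by lia.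
have f2 : j + 1 - 1 = j by lia.
by rewrite (gcompE e _ _ e' f1 f2) /= (mor0 (ctrB _)).
Qed.

Lemma fib_decomp (e1 : -1 + 1 = 0 :> int) (e2 : 0 + 0 = 0 :> int) :
  gcomp e1 fib_inN fib_prN + gcomp e2 fib_inM (gof fib_proj) = gof (dgid fib).
Proof.
apply: ghomP => i j e m; have f1 : i - 1 = j - 1 by lia.
rewrite ghomDE (gcompE e1 _ _ e f1 (subrK 1 j)).
rewrite (gcompE e2 _ _ e e (addr0 j)) /=.
have ij : i = j by rewrite -e addr0.
move: ij e f1 m => <- e f1 [y x].
by apply: pair_eq; rewrite /= !ctr_id ?addr0 ?add0r.
Qed.

Lemma fib_d_inN k (e : 1 + 1 = k :> int) : ghomd e fib_inN = 0.
Proof.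
apply: ghomP => i j e' m.
have f1 : i + 1 = j - 1 by lia.
have f2 : i + 1 + 1 = j by lia.
rewrite (ghomdE e _ e' erefl (subrK 1 j) f1 f2) /=.
have f3 : i + 1 = j - 1 by lia.
apply: pair_eq; rewrite /= ?fstMz ?sndMz /=; last first.
  by rewrite (mor0 (cdB _)) sub0r oppr0 ?mul0rz ?oppr0.
rewrite (mor0 (@cmapB _ _ u _)) (mor0 (ctrB _)) sub0r.
by rewrite (cd_ctr _ _ f3) (ctr_cd _ _ f3) opprK addNr.
Qed.

(** Together with [fib_d_inN], [fib_d_prN] and [fib_decomp]: a graded map out
    of the fiber is a pair of graded maps out of [N] and [M], and the
    differential couples the two by [u]. Computations with fibers are formal
    consequences of these identities. *)
Lemma fib_d_inM (e e' : 0 + 1 = 1 :> int) :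
  ghomd e fib_inM = gcomp e' fib_inN (gof u).
Proof.
apply: ghomP => i j e1 m.
have f1 : i + 0 = j - 1 by lia.
have f2 : i + 1 + 0 = j by lia.
have f3 : i = j - 1 by lia.
rewrite (ghomdE e _ e1 erefl (subrK 1 j) f1 f2).
rewrite (gcompE e' _ _ e1 (addr0 i) e1) gofE /=.
rewrite ksign0 mulr1z; apply: pair_eq; rewrite /=.
  rewrite (mor0 (cdB _)) !subr0 cmapf_ctr; exact: ctr_ctr.
by rewrite (cd_ctr _ _ e1) (ctr_cd _ _ e1) subrr.
Qed.

Lemma fib_d_prN (e : -1 + 1 = 0 :> int) (e' : 0 + 0 = 0 :> int) :
  ghomd e fib_prN = gcomp e' (gof u) (gof fib_proj).
Proof.
apply: ghomP => i j e1 m.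
have f1 : i - 1 = j - 1 by lia.
have f2 : i + 1 - 1 = j by lia.
have f3 : i - 1 + 1 = j by lia.
have f4 : i = j by lia.
rewrite (ghomdE e _ e1 erefl (subrK 1 j) f1 f2).
rewrite (gcompE e' _ _ e1 (addr0 i) e1) gofE /=.
rewrite (mulrN1z) opprK (ctrB _) (ctr_cd _ _ f3) (cd_ctr _ _ f3).
by rewrite addrC subrK (ctr_ctr _ _ f4); congr ctr; exact: eq_irrelevance.
Qed.
End Fiber.

Lemma addrD_subD (V : zmodType) (a b c : V) : a + b + (c - a - b) = c.
Proof. by rewrite addrCA addrK subrK. Qed.

Section FiberCohomology.
Variables (A : dgring) (M N : dgmod A) (u : dghom M N).

Lemma fib_closedP n (z : fib u n) :
  closed z <-> closed z.2 /\ forall e : n - 1 + 1 = n,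
    cd e z.1 = cmapf u z.2.
Proof.
have e0 : n - 1 + 1 = n by lia.
have e1 : n = n + 1 - 1 by lia.
have e2 : n - 1 + 1 = n + 1 - 1 by lia.
have E : cd (erefl (n + 1)) z =
    (ctr e1 (cmapf u z.2) - cd e2 z.1, cd (erefl (n + 1)) z.2).
  by apply: pair_eq => //=; congr (_ - _);
    [congr ctr; exact: eq_irrelevance|exact: cd_irr].
rewrite /closed E; split=> [[/eqP + ->]|[-> /(_ e0) <-]].
  rewrite subr_eq0 => /eqP uz; split=> // e.
  have := congr1 (ctr (esym e1)) uz.
  by rewrite (ctr_ctr _ _ erefl) ctr_id (ctr_cd _ _ e).
by apply: pair_eq; rewrite //= (ctr_cd _ _ e2) subrr.
Qed.

Lemma fib_boundingP n (z : fib u n) : bounding z <->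
  exists (y : N (n - 1 - 1)) (x : M (n - 1)),
    cmapf u x - cd (subrK 1 (n - 1)) y = z.1 /\ cd (subrK 1 n) x = z.2.
Proof.
split=> [/(boundingP (subrK 1 n))[[y x] <-]|[y [x [E1 E2]]]].
  by exists y, x; split=> //=; rewrite ctr_id (cd_irr _ (subrK 1 (n - 1))).
exists (n - 1), (subrK 1 n), (y, x); apply: pair_eq => //=.
by rewrite ctr_id -E1 (cd_irr _ (subrK 1 (n - 1))).
Qed.

(** The part [H^(n-1) M -> H^(n-1) N -> H^n F -> H^n M -> H^n N] of the long
    exact sequence. *)
Lemma fib_coh0 n :
  (forall y : N (n - 1), closed y ->
     exists2 x : M (n - 1), closed x & bounding (cmapf u x - y)) ->
  (forall x : M n, closed x -> bounding (cmapf u x) -> bounding x) ->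
  forall z : fib u n, closed z -> bounding z.
Proof.
move=> us ui [y x] /fib_closedP[/= xc /(_ (subrK 1 n)) dy].
have [|x' dx'] := boundingP (subrK 1 n) (ui x xc _).
  by rewrite -dy; exists (n - 1), (subrK 1 n), y.
have yc : closed (y - cmapf u x').
  by apply: (closedI (e := subrK 1 n)); rewrite cdB -cmapd dx' dy subrr.
have [s sc /(boundingP (subrK 1 (n - 1)))[v dv]] := us _ yc.
apply/fib_boundingP; exists v, (x' + s); split=> /=.
  by rewrite dv (morD (@cmapB _ _ u _)) opprB addrD_subD.
by rewrite (morD (cdB _)) dx' (closed_cd sc) addr0.
Qed.

Lemma fib_acyclic : quasi_iso u -> acyclic (fib u).
Proof.
by move=> /quasi_isoP[ui us]; apply/acyclicP => n; apply: fib_coh0; auto.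
Qed.
End FiberCohomology.

Lemma ksignS n n' : n + 1 = n' -> ksign n' = - ksign n.
Proof. by move=> <-; rewrite ksignD mulrN1. Qed.

Section FiberMaps.
Variables (A : dgring) (M N X : dgmod A) (u : dghom M N).

(** The pair [(f, h')] is a closed map on the fiber. A primitive of it
    restricts on [N] to a primitive of [f], and on [M] to the correction [k];
    the signs [(-1)^n] come from moving a differential past a map of degree
    [n]. *)
Lemma fib_extend (n n' : int) (en : n + 1 = n') (e0 : 0 + n' = n')
    (e1 : 0 + n = n) (f : ghom N X n') (h' : ghom M X n) :
  (forall T : homC (fib u) X n, closed T -> bounding T) ->
  closed (f : homC N X n') -> ghomd en h' = gcomp e0 f (gof u) ->
  exists (h : ghom N X n) (k : ghom M X (n - 1)),
    ghomd en h = f /\ gcomp e1 h (gof u) = h' - ghomd (subrK 1 n) k.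
Proof.
move=> HX fc dh'.
have e2 : -1 + n' = n by lia.
have [S dS] : exists S : ghom (fib u) X (n - 1), ghomd (subrK 1 n) S =
    gcomp e1 h' (gof (fib_proj u)) + gcomp e2 f (fib_prN u) *~ ksign n.
  apply: (@boundingP (homC (fib u) X)); apply: HX.
  apply: (closedI (e := en)).
  rewrite [LHS](morD (ghomdB _)) (morMz (ghomdB _)).
  have e3 : 1 + n = n' by lia.
  rewrite (ghomd_comp _ (add0r 1) en _ e0 e3) gof_closed.
  rewrite (mor0 (gcompBr _ _)) mul0rz addr0 dh'.
  have e4 : -1 + (n' + 1) = n' by lia.
  rewrite (ghomd_comp _ (addNr 1) erefl en e4 e0).
  rewrite [ghomd erefl f]fc (mor0 (gcompBl _ _)) add0r -mulrzA.
  rewrite (fib_d_prN _ _ (addr0 0)) (gcompA _ _ e0 e0).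
  by rewrite (ksignS en) mulNr ksignM mulrN1z subrr.
have e5 : 1 + (n - 1) = n by lia.
have e6 : 0 + (n - 1) = n - 1 by lia.
exists (gcomp e5 S (fib_inN u) *~ ksign n), (gcomp e6 S (fib_inM u)).
have e7 : 1 + n = n' by lia.
have e8 : 1 + 1 + (n - 1) = n' by lia.
split.
  rewrite (morMz (ghomdB _)) (ghomd_comp e5 erefl (subrK 1 n) en e7 e8).
  rewrite fib_d_inN (mor0 (gcompBr _ _)) mul0rz addr0 dS.
  rewrite (morD (gcompBl _ _)) (morMz (gcompBl _ _)).
  rewrite -(gcompA (addr0 1) _ _ e7) fib_proj_inN (mor0 (gcompBr _ _)) add0r.
  rewrite -mulrzA ksignM mulr1z.
  rewrite -(gcompA (addrN 1) e0 _ _) fib_prN_inN; exact: gcomp_idr.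
rewrite (morMz (gcompBl _ _)).
rewrite (ghomd_comp e6 (add0r 1) (subrK 1 n) _ e1 e5) dS.
rewrite (morD (gcompBl _ _)) (morMz (gcompBl _ _)).
rewrite -(gcompA (addr0 0) e1 _ _) fib_proj_inM gcomp_idr.
rewrite -(gcompA (add0r (-1)) e2) fib_prN_inM (mor0 (gcompBr _ _)) mul0rz addr0.
rewrite (fib_d_inM _ _ (add0r 1)) (gcompA _ _ e5 e1).
by rewrite (ksignS (subrK 1 n)) mulrNz opprD addrA subrr add0r.
Qed.

(** A null-homotopy [S] of the map that [g] induces on the fiber restricts to
    a closed map on [N], and its restriction to [M] is a homotopy from [g] to
    that closed map composed with [u]. *)
Lemma fib_factor (n : int) (e0 : 0 + n = n) (g : ghom M X n) :
  bounding (gcomp e0 g (gof (fib_proj u)) : homC (fib u) X n) ->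
  exists2 h : ghom N X n, closed (h : homC N X n) &
    bounding (g - gcomp e0 h (gof u) : homC M X n).
Proof.
move=> /(boundingP (subrK 1 n))[S dS].
have e1 : 1 + (n - 1) = n by lia.
have e2 : 0 + (n - 1) = n - 1 by lia.
have e3 : 1 + n = n + 1 by lia.
exists (gcomp e1 S (fib_inN u) *~ ksign n).
  apply: closedMz; rewrite /closed.
  have e4 : 1 + 1 + (n - 1) = n + 1 by lia.
  rewrite [LHS](ghomd_comp e1 erefl (subrK 1 n) _ e3 e4).
  rewrite fib_d_inN (mor0 (gcompBr _ _)) mul0rz addr0.
  rewrite [ghomd _ S]dS -(gcompA (addr0 1) e3).
  by rewrite fib_proj_inN (mor0 (gcompBr _ _)).
exists (n - 1), (subrK 1 n), (gcomp e2 S (fib_inM u)).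
rewrite [LHS](ghomd_comp e2 (add0r 1) (subrK 1 n) _ e0 e1).
rewrite [ghomd _ S]dS -(gcompA (addr0 0) e0) fib_proj_inM gcomp_idr.
rewrite (fib_d_inM _ _ (add0r 1)) (gcompA _ _ e1 e0).
by rewrite (morMz (gcompBl _ _)) (ksignS (subrK 1 n)) mulrNz opprK.
Qed.

Section Pairing.
Variables (P : dgmod A) (g : dghom P M) (j : ghom P N (-1)).
Hypothesis dj : forall (e : -1 + 1 = 0 :> int) (e' : 0 + 0 = 0 :> int),
  ghomd e j = gcomp e' (gof u) (gof g).

(** A map into the fiber is a map [g] into [M] with a null-homotopy of
    [u g]. *)
Program Definition fib_pair : dghom P (fib u) :=
  @DGHom A P (fib u)
    (@CMap P (fib u) (fun n x => (ghf j (erefl (n - 1)) x, cmapf g x)) _ _) _.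
Next Obligation. by move=> n x y; apply: pair_eq; rewrite /= ?ghfB ?cmapB. Qed.
Next Obligation.
move=> i k e x; apply: pair_eq; rewrite /= ?cmapd //.
have e0 : i + 0 = k - 1 by lia.
have e1 : i - 1 + 1 = k - 1 by lia.
have := congr1 (fun g => ghf g e0 x) (dj (addNr 1) (addr0 0)).
rewrite (ghomdE _ j e0 e e1 erefl (erefl (k - 1))).
rewrite (gcompE _ _ _ e0 (addr0 i) e0) gofE /= => E.
rewrite mulrN1z opprK in E.
rewrite -[LHS](addKr (cd e1 (ghf j (erefl (i - 1)) x))) E.
rewrite [LHS]addrC; congr (_ - _); last exact: cd_irr.
by congr ctr; exact: eq_irrelevance.
Qed.
Next Obligation.
move=> i k l e a x; apply: pair_eq; rewrite /= ?dghL //.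
by rewrite (ghfL j e _ erefl (fib_act_e e)) mulN1r ksignN.
Qed.
End Pairing.
End FiberMaps.

(** * Maps into K-injective modules *)

Section KInjective.
Variables (A : dgring) (K : dgmod A) (hK : K_injective K).

Lemma Kinj_bounding (N : dgmod A) : acyclic N ->
  forall n (f : homC N K n), closed f -> bounding f.
Proof. by move=> aN; apply/acyclicP; exact: hK. Qed.

Variables (M N : dgmod A) (u : dghom M N) (hu : quasi_iso u).

Lemma Kinj_lift n (e : 0 + n = n) (g : ghom M K n) : closed (g : homC M K n) ->
  exists2 h : ghom N K n, closed (h : homC N K n) &
    bounding (g - gcomp e h (gof u) : homC M K n).
Proof.
move=> gc; apply: fib_factor; apply: Kinj_bounding; first exact: fib_acyclic.
have e1 : 0 + (n + 1) = n + 1 by lia.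
rewrite /closed [LHS](ghomd_comp e (add0r 1) erefl _ e1 (addrC 1 n)).
by rewrite [ghomd _ g]gc gof_closed (mor0 (gcompBl _ _))
  (mor0 (gcompBr _ _)) mul0rz addr0.
Qed.

Lemma Kinj_lift_bounding n (e : 0 + n = n) (f : ghom N K n) :
  closed (f : homC N K n) -> bounding (gcomp e f (gof u) : homC M K n) ->
  bounding (f : homC N K n).
Proof.
move=> fc /(boundingP (subrK 1 n))[h dh].
have e1 : 0 + (n - 1) = n - 1 by lia.
have [|h' [k [dh' _]]] := fib_extend e1 _ fc dh.
  by apply: Kinj_bounding; exact: fib_acyclic.
by exists (n - 1), (subrK 1 n), h'.
Qed.

Lemma precomp_quasi_iso : quasi_iso (precomp K u).
Proof.
apply/quasi_isoP; split=> n f fc.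
  by rewrite (precompE _ (add0r n)); exact: Kinj_lift_bounding.
have [h hc hb] := Kinj_lift (add0r n) fc; exists h => //.
by apply: bounding_sym; rewrite (precompE _ (add0r n)).
Qed.
End KInjective.

(** * Injective abelian groups *)

(** Injectivity in the form in which it is used: [u] may have a kernel,
    provided that [g] kills it. This spares the construction of image
    subgroups. *)
Definition injective_group (D : zmodType) :=
  forall (U V : zmodType) (u : U -> V) (g : U -> D),
    zmod_morphism u -> zmod_morphism g -> (forall x, u x = 0 -> g x = 0) ->
    exists2 h : V -> D, zmod_morphism h & forall x, h (u x) = g x.

Lemma int_subgroup (S : int -> Prop) : S 0 ->
  (forall k l, S k -> S l -> S (k - l)) ->
  exists n : nat, forall k, S k <-> exists q : int, k = q * n%:Z.
Proof.
move=> S0 SB.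
have SN k : S k -> S (- k) by move=> Sk; rewrite -sub0r; exact: SB.
have SD k l : S k -> S l -> S (k + l).
  by move=> Sk Sl; rewrite -(opprK l); apply: SB => //; exact: SN.
have SM k (q : int) : S k -> S (q * k).
  move=> Sk; have Sn (n : nat) : S (n%:Z * k).
    elim: n => [|n IHn]; first by rewrite mul0r.
    by rewrite intS mulrDl mul1r; exact: SD.
  by case: q => n; rewrite ?NegzE ?mulNr; [|apply: SN]; exact: Sn.
have [[n0 Sn0]|noS] := pselect (exists n : nat, (0 < n)%N && `[< S n%:Z >]).
  case: (ex_minnP (ex_intro (fun n => (0 < n)%N && `[< S n%:Z >]) _ Sn0)).
  move=> n /andP[n_gt0 /asboolP Sn] nmin; exists n => k.
  split=> [Sk|[q ->]]; last exact: SM.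
  exists (k %/ n)%Z; have E := divz_eq k n; rewrite {1}E.
  suff -> : (k %% n)%Z = 0 by rewrite addr0.
  have r_ge0 : 0 <= (k %% n)%Z by apply: modz_ge0; lia.
  have r_lt : (k %% n)%Z < n by apply: ltz_pmod; lia.
  have Sr : S (k %% n)%Z.
    have -> : (k %% n)%Z = k - (k %/ n)%Z * n by rewrite {2}E addrC addKr.
    by apply: SB => //; exact: SM.
  move: r_ge0 r_lt Sr; case: (k %% n)%Z => // -[//|r] _ rn Sr.
  have := nmin r.+1; rewrite ltn0Sn /= => /(_ (asboolT Sr)); lia.
exists 0%N => k; split=> [Sk|[q ->]]; last by rewrite mulr0.
exists 0; rewrite mul0r; apply: contrapT => k0; apply: noS.
exists `|k|%N; apply/andP; split; first lia.
by apply/asboolP; case: (intP k) Sk k0 => // n Sk _;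
  rewrite ?abszN //= -[_%:Z]opprK; exact: SN.
Qed.

Section Extension.
Variables (V D : zmodType).
Hypothesis divD : forall (d : D) (n : nat), (0 < n)%N -> exists e, e *+ n = d.

Let graph (G : set (V * D)) := [/\ G (0, 0),
  forall p q, G p -> G q -> G (p - q) & forall d, G (0, d) -> d = 0].

(** Zorn's lemma is applied to the subgroups of [V * D] that meet [0 * D]
    trivially, that is, to graphs of partial homomorphisms. If [v] is not in
    the domain of such a graph, its multiples in the domain are those of some
    [n], and a division by [n] in [D] gives a possible value at [v]; so a
    maximal graph is total. *)
Lemma graph_extension (G0 : set (V * D)) : graph G0 ->
  exists2 h : V -> D, zmod_morphism h & forall v d, G0 (v, d) -> h v = d.
Proof.
move=> gG0; have [|G [gG Gmax]] := @Zorn_bigcup _ [set G | graph (G `|` G0)].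
  move=> F FP Ftot; split.
  - by right; case: gG0.
  - have FG X : F X -> graph (X `|` G0) by exact: FP.
    have [_ G0B _] := gG0.
    move=> p q [[X FX Xp]|Gp] [[Y FY Yq]|Gq].
    + have [XY|YX] := Ftot _ _ FX FY.
        have [_ YB _] := FG _ FY.
        have [] := YB p q (or_introl (XY _ Xp)) (or_introl Yq); last by right.
        by left; exists Y.
      have [_ XB _] := FG _ FX.
      have [] := XB p q (or_introl Xp) (or_introl (YX _ Yq)); last by right.
      by left; exists X.
    + have [_ XB _] := FG _ FX.
      have [] := XB p q (or_introl Xp) (or_intror Gq); last by right.
      by left; exists X.
    + have [_ YB _] := FG _ FY.
      have [] := YB p q (or_intror Gp) (or_introl Yq); last by right.
      by left; exists Y.
    + by right; exact: G0B.
  - move=> d [[X FX Xd]|Gd]; last by case: gG0 => _ _; exact.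
    by have [_ _] := FP _ FX; apply; left.
move: gG Gmax; rewrite /=; set H := G `|` G0 => gH Gmax.
have [H0 HB Hf] := gH.
have HN p : H p -> H (- p) by rewrite -sub0r; exact: HB.
have HD p q : H p -> H q -> H (p + q).
  by move=> Hp Hq; rewrite -(opprK q); apply: HB => //; exact: HN.
have HM p (k : int) : H p -> H (p *~ k).
  move=> Hp; have Hn (n : nat) : H (p *+ n).
    elim: n => [|n IHn]; first by rewrite mulr0n.
    by rewrite mulrS; exact: HD.
  by case: k => n; [exact: Hn|apply: HN; exact: Hn].
have Htot v : exists d, H (v, d).
  have [||n Sn] := @int_subgroup (fun k => exists e, H (v *~ k, e)).
  - by exists 0; rewrite mulr0z.
  - by move=> k l [e He] [e' He']; exists (e - e'); rewrite mulrzBr;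
    exact: HB He He'.
  have [e He] : exists e, H (v *~ n%:Z, e) by apply/Sn; exists 1; rewrite mul1r.
  have [d dn] : exists d, d *+ n = e.
    have [n0|n0] := posnP n; last exact: divD.
    by exists 0; rewrite mul0rn; apply/esym/Hf; move: He; rewrite n0 mulr0z.
  have dk k e' : H (v *~ k, e') -> e' = d *~ k.
    move=> He'; have [q kq] : exists q, k = q * n%:Z by apply/Sn; exists e'.
    apply/eqP; rewrite -subr_eq0; apply/eqP/Hf.
    have := HB _ _ He' (HM _ q He).
    have -> : (v *~ k, e') - (v *~ n, e) *~ q = (0, e' - d *~ k) => //.
    apply: pair_eq; rewrite /= ?fstMz ?sndMz /= kq mulrC mulrzA ?subrr //.
    by rewrite -dn.
  exists d; apply: contrapT => nH.
  pose H' : set (V * D) := [set p | exists2 q, H q & exists k : int,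
                             p = q + (v *~ k, d *~ k)].
  have HH' : H `<=` H'.
    by move=> p Hp; exists p => //; exists 0; rewrite !mulr0z addr0.
  apply: (Gmax H'); last first.
    have -> : H' `|` G0 = H'.
      by apply/setUidPl => p Gp; apply: HH'; right.
    split; first exact: HH'.
      move=> p q [p1 Hp [k ->]] [q1 Hq [l ->]].
      exists (p1 - q1); first exact: HB.
      by exists (k - l); rewrite !mulrzBr opprD addrACA.
    move=> x [q Hq [k E]].
    have Eq : q = (v *~ (- k), x - d *~ k).
      by rewrite -[q](addrK (v *~ k, d *~ k)) -E !mulrNz; apply: pair_eq;
        rewrite /= ?sub0r.
    move: Hq; rewrite Eq => /dk; rewrite mulrNz => /eqP.
    by rewrite subr_eq addNr => /eqP.
  split=> [p Gp|]; first by apply: HH'; left.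
  move=> /(_ (v, d)) GH'; apply: nH; left; apply: GH'.
  by exists 0 => //; exists 1; rewrite !mulr1z add0r.
have [h hP] := choice Htot; exists h => [x y|v d Gd].
  have := HB _ _ (hP (x - y)) (HB _ _ (hP x) (hP y)).
  have -> : (x - y, h (x - y)) - ((x, h x) - (y, h y))
            = (0, h (x - y) - (h x - h y)).
    by apply: pair_eq; rewrite /= ?subrr.
  by move=> /Hf/eqP; rewrite subr_eq0 => /eqP.
have := HB _ _ (hP v) (or_intror Gd : H _).
have -> : (v, h v) - (v, d) = (0, h v - d) by apply: pair_eq; rewrite /= ?subrr.
by move=> /Hf/eqP; rewrite subr_eq0 => /eqP.
Qed.
End Extension.

Lemma divisible_injective (D : zmodType) :
  (forall (d : D) (n : nat), (0 < n)%N -> exists e, e *+ n = d) ->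
  injective_group D.
Proof.
move=> divD U V u g uB gB ug.
have [|h hB hP] := @graph_extension V D divD [set p | exists x, p = (u x, g x)].
  split.
  - by exists 0; rewrite (mor0 uB) (mor0 gB).
  - by move=> _ _ [x ->] [y ->]; exists (x - y); rewrite uB gB.
  - by move=> d [x [/esym/ug -> ->]].
by exists h => // x; apply: hP; exists x.
Qed.

Section QmodZ.
Definition is_integer (x : rat) : bool := `[< exists n : int, x = n%:~R >].

Lemma is_integer_zmod_closed : zmod_closed is_integer.
Proof.
split=> [|x y]; rewrite !unfold_in; first by apply/asboolP; exists 0.
move=> /asboolP[m ->] /asboolP[n ->]; apply/asboolP; exists (m - n).
by rewrite intrB.
Qed.
HB.instance Definition _ :=
  GRing.isZmodClosed.Build rat is_integer is_integer_zmod_closed.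

Definition integers : zmodClosed rat :=
  GRing.ZmodClosed.clone rat is_integer _.

Definition QmodZ : Type := {ideal_quot integers}.
HB.instance Definition _ := GRing.Zmodule.on QmodZ.

Definition qcl (x : rat) : QmodZ := (\pi_({ideal_quot integers}) x)%qT.

Lemma qclB : zmod_morphism qcl.
Proof. by move=> x y; exact: (raddfB (\pi_({ideal_quot integers})%qT)). Qed.

Lemma qcl_eq0 x : qcl x = 0 <-> exists n : int, x = n%:~R.
Proof.
rewrite -(mor0 qclB); split=> [/eqP|xn].
  by rewrite -Quotient.idealrBE subr0 => /asboolP.
by apply/eqP; rewrite -Quotient.idealrBE subr0; exact/asboolP.
Qed.

Lemma qclMz x k : qcl x *~ k = qcl (x *~ k).
Proof. by rewrite (morMz qclB). Qed.

Lemma QmodZ_divisible (d : QmodZ) (n : nat) : (0 < n)%N -> exists e, e *+ n = d.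
Proof.
move=> n_gt0; pose x : rat := repr (d : {ideal_quot integers}).
exists (qcl (x / n%:R)); rewrite -[_ *+ n]/(_ *~ n%:Z) qclMz.
rewrite -[_ *~ _]mulr_natr divfK ?pnatr_eq0 -?lt0n //; exact: reprK.
Qed.

(** The multiples of [(v, c)] form a graph as soon as the order of [v] kills
    [c]. The choice is [c = 1/n] if [v] has finite order [n], and [c = 1/2]
    otherwise. *)
Lemma character_separates (V : zmodType) (v : V) : v <> 0 ->
  exists2 chi : V -> QmodZ, zmod_morphism chi & chi v <> 0.
Proof.
move=> v0; have [||n Sn] := @int_subgroup (fun k => v *~ k = 0).
- by rewrite mulr0z.
- by move=> k l vk vl; rewrite mulrzBr vk vl subrr.
have n1 : n != 1%N.
  apply/eqP => n1; apply: v0; rewrite -[v]mulr1z; apply/Sn.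
  by exists 1; rewrite n1.
pose m : nat := if n == 0%N then 2 else n.
have m_gt1 : (1 < m)%N by rewrite /m; case: (n) n1 => [|[|]].
pose c := qcl m%:R^-1.
have m0 : m%:R != 0 :> rat by rewrite pnatr_eq0; case: (m) m_gt1.
have cn : c *~ n%:Z = 0.
  rewrite qclMz; apply/qcl_eq0; rewrite /m; case: eqP => [->|/eqP nn0].
    by exists 0; rewrite mulr0z.
  by exists 1; rewrite -[_ *~ _]mulr_natr mulVf // pnatr_eq0.
have ck k : v *~ k = 0 -> c *~ k = 0.
  by move=> /Sn[q ->]; rewrite mulrC mulrzA cn mul0rz.
have c0 : c <> 0.
  move=> /qcl_eq0[q qE].
  have : (1 : rat) = (q * m)%:~R by rewrite intrM -qE mulVf.
  rewrite -[1]/(1%:~R) => /eqP; rewrite eqr_int => /eqP qm.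
  have := congr1 absz qm; rewrite abszM => /esym/eqP.
  by rewrite muln_eq1 => /andP[_ /eqP mE]; move: m_gt1; rewrite -[m]absz_nat mE.
have [|chi chiB chiP] := @graph_extension V QmodZ QmodZ_divisible
    [set p | exists k : int, p = (v *~ k, c *~ k)].
  split.
  - by exists 0; rewrite !mulr0z.
  - by move=> _ _ [k ->] [l ->]; exists (k - l); rewrite !mulrzBr.
  - by move=> d [k [/esym/ck + ->]].
exists chi => //; rewrite (chiP v c) //.
by exists 1; rewrite !mulr1z.
Qed.

Lemma QmodZ_fun_injective (X : Type) : injective_group (X -> QmodZ).
Proof.
move=> U V u g uB gB ug.
have QI := divisible_injective QmodZ_divisible.
have H x : exists h : V -> QmodZ, zmod_morphism h /\ forall y, h (u y) = g y x.
  have [||h hB hu] := QI U V u (fun y => g y x) uB.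
  - by move=> a b; rewrite gB.
  - by move=> y /ug ->.
  by exists h.
have [h hP] := choice H; exists (fun y x => h x y) => [a b|y].
  by apply/funext => x; rewrite (hP x).1.
by apply/funext => x; rewrite (hP x).2.
Qed.
End QmodZ.

Definition characters (V : zmodType) := {chi : V -> QmodZ | zmod_morphism chi}.

(** An injective group that contains [V]: a product of copies of Q/Z indexed
    by the characters of [V]. *)
Definition bidual (V : zmodType) : zmodType :=
  (characters V -> QmodZ) : zmodType.

Definition to_bidual (V : zmodType) (v : V) : bidual V := fun chi => sval chi v.

Lemma to_bidualB (V : zmodType) : zmod_morphism (@to_bidual V).
Proof. by move=> x y; apply/funext => -[chi chiB]; exact: chiB. Qed.

Lemma to_bidual_eq0 (V : zmodType) (v : V) : to_bidual v = 0 -> v = 0.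
Proof.
move=> v0; apply: contrapT => /character_separates[chi chiB]; apply.
exact: (congr1 (fun f : bidual V => f (exist _ chi chiB)) v0).
Qed.

Lemma bidual_injective (V : zmodType) : injective_group (bidual V).
Proof. exact: QmodZ_fun_injective. Qed.

(** * Change of rings *)

Definition restr (A B : dgring) (phi : dgring_map A B) (M : dgmod B) : dgmod A.
Proof.
refine (@DGMod A M (fun i j k e a m => act e (cmapf phi a) m) _ _ _ _ _).
- by move=> i j k e m x y; rewrite cmapB actBl.
- by move=> i j k e a; exact: actBr.
- by move=> i j k ij jk ijk e1 e2 e3 e4 a b c; rewrite drmM; exact: actA.
- by move=> i e m; rewrite drm1 act1.
- by move=> i j k i' j' k' e ei ej ek el er a b; rewrite cmapd; exact: actd.
Defined.

Program Definition restr_map (A B : dgring) (phi : dgring_map A B)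
    (M N : dgmod B) (u : dghom M N) : dghom (restr phi M) (restr phi N) :=
  @DGHom A (restr phi M) (restr phi N)
    (@CMap M N (fun n x => cmapf u x) _ _) _.
Next Obligation. by move=> *; exact: cmapB. Qed.
Next Obligation. by move=> *; exact: cmapd. Qed.
Next Obligation. by move=> *; rewrite /= dghL. Qed.

Section Adjunction.
Variables (A B : dgring) (phi : dgring_map A B).
Variables (N : dgmod B) (K : dgmod A).

(** The adjunction between restriction of scalars and [homB] is evaluation at
    1. *)
Program Definition adj_to n (f : ghom N (homB phi K) n) :
    ghom (restr phi N) K n :=
  @GHom A (restr phi N) K n
    (fun i j e x => ghf (ghf f e x : ghom _ K j) (add0r j) (dgone : B 0)) _ _.
Next Obligation. by move=> n f i j e x y; rewrite (ghfB f). Qed.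
Next Obligation.
move=> n f p i j k l e1 e2 e3 e4 a x.
have f2 : p + j = l by lia.
have f3 : p + 0 = p by rewrite addr0.
rewrite (ghfL f (e1 : p + i = k) e2 e3 f2) ghomMzE /=.
rewrite (bact_funE _ _ _ _ (add0r p) f2) dmul1l.
have -> : (cmapf phi a : dgrestr phi p) = act f3 a (dgone : dgrestr phi 0).
  by rewrite /= dmul1r.
rewrite (ghfL (ghf f e3 x : ghom _ K j) f3 f2 (add0r j) e4).
rewrite -!mulrzA; congr (_ *~ _).
by rewrite addr0 [p * j]mulrC mulrA ksignM mul1r.
Qed.

Section AdjFrom.
Variables (n : int) (g : ghom (restr phi N) K n).

Lemma adj_from_e i j q r : i + n = j -> q + j = r -> q + i + n = r.
Proof. by lia. Qed.

(** The sign makes up for the one in the action of [B] on [homB phi K]: the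
    value of [f x] at [b] is, up to that sign, the value of
    [b (f x) = +- f (b x)] at 1. *)
Program Definition adj_from_fun i j (e : i + n = j) (x : N i) :
    ghom (dgrestr phi) K j :=
  @GHom A (dgrestr phi) K j
    (fun q r e' b => ghf g (adj_from_e e e')
       (act (erefl (q + i)) (b : B q) x : restr phi N (q + i))
       *~ ksign (q * i)) _ _.
Next Obligation. by move=> i j e x q r e' b c; rewrite actBl ghfB mulrzBl. Qed.
Next Obligation.
move=> i j e x p q s t r e1 e2 e3 e4 a b /=.
have f1 : p + (q + i) = t + i by lia.
rewrite -(actA erefl f1) (ghfL g (f1 : _ + _ = _) _ (adj_from_e e e3) e4).
rewrite (morMz (actBr _ _)) -!mulrzA; congr (_ *~ _).
by rewrite -e -e1 !mulrDl !ksignD [p * i]mulrC; ring.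
Qed.

Lemma adj_from_funE i j (e : i + n = j) x q r (e' : q + j = r) s
    (e1 : q + i = s) (e2 : s + n = r) b :
  ghf (adj_from_fun e x) e' b
  = ghf g e2 (act e1 (b : B q) x : restr phi N s) *~ ksign (q * i).
Proof. by subst s; rewrite /=; congr (_ *~ _); exact: ghf_eq. Qed.

Program Definition adj_from : ghom N (homB phi K) n :=
  @GHom B N (homB phi K) n (fun i j e x => adj_from_fun e x) _ _.
Next Obligation.
move=> i j e x y; apply: ghomP => q r e' b.
by rewrite ghomBE /= actBr ghfB mulrzBl.
Qed.
Next Obligation.
move=> p i j k l e1 e2 e3 e4 b x; apply: ghomP => q r e c.
rewrite ghomMzE /=.
have f1 : q + p = r - j by lia.
have f2 : r - j + j = r by lia.
rewrite (bact_funE _ _ _ e f1 f2).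
have f3 : r - j + i = q + k by lia.
rewrite (adj_from_funE e3 x f2 f3 (adj_from_e e2 e)).
rewrite (actA e1 erefl f1 f3) -!mulrzA; congr (_ *~ _).
rewrite -f1 -e1 -e3 mulrDr !mulrDl !mulrDr !ksignD.
rewrite [p * q]mulrC [p * n]mulrC.
transitivity (ksign (q * p) * ksign (q * i) * (ksign (p * i) * ksign (p * i))
  * (ksign (n * p) * ksign (n * p))); last by ring.
by rewrite !ksignM !mulr1.
Qed.
End AdjFrom.

Lemma adj_toK n (f : ghom N (homB phi K) n) : adj_from (adj_to f) = f.
Proof.
apply: ghomP => i j e x; apply: ghomP => q r e' b.
have f1 : q + i + n = r by lia.
rewrite (adj_from_funE _ e x e' erefl f1) /=.
rewrite (ghfL f erefl f1 e e') ghomMzE /=.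
rewrite (bact_funE _ _ _ _ (add0r q) e') dmul1l -!mulrzA.
rewrite -[RHS]mulr1z; congr (_ *~ _).
rewrite -e addr0 mulrDr [n * q]mulrC ksignD.
transitivity (ksign (q * i) * ksign (q * i) * (ksign (q * n) * ksign (q * n))).
  by ring.
by rewrite !ksignM.
Qed.

Lemma adj_fromK n (g : ghom (restr phi N) K n) : adj_to (adj_from g) = g.
Proof.
apply: ghomP => i j e x.
transitivity (ghf (adj_from_fun g e x) (add0r j) (dgone : B 0)) => //.
rewrite (adj_from_funE _ e x (add0r j) (add0r i) e) act1.
by rewrite mul0r mulr1z.
Qed.

Lemma adj_toD n : zmod_morphism (@adj_to n).
Proof. by move=> f g; apply: ghomP. Qed.

Lemma cd_dgone k (e : 0 + 1 = k) : cd e (dgone : B 0) = 0.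
Proof. exact: closed_cd (closedI (eqP (coc_one_subproof B))) _ e. Qed.

Lemma ghomd_adj_to n n' (en : n + 1 = n') (f : ghom N (homB phi K) n) :
  ghomd en (adj_to f) = adj_to (ghomd en f).
Proof.
apply: ghomP => i j e x.
have f1 : i + n = j - 1 by lia.
have f2 : i + 1 + n = j by lia.
rewrite (ghomdE en _ e erefl (subrK 1 j) f1 f2).
transitivity (ghf (ghomd_fun en f e x : ghom _ K j) (add0r j) (dgone : B 0)).
  rewrite (ghomd_funE en f e erefl (subrK 1 j) f1 f2).
  rewrite ghomBE ghomMzE; congr (_ - _).
  have f3 : 0 + 1 + (j - 1) = j by lia.
  rewrite [RHS](ghomdE _ _ _ erefl (subrK 1 j) (add0r (j - 1)) f3).
  by rewrite cd_dgone (mor0 (ghfB _ _)) mul0rz subr0.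
by [].
Qed.

Lemma ghomd_adj_from n n' (en : n + 1 = n') (g : ghom (restr phi N) K n) :
  ghomd en (adj_from g) = adj_from (ghomd en g).
Proof. by rewrite -[LHS]adj_toK -ghomd_adj_to adj_fromK. Qed.

Lemma adj_coh0 n :
  (forall f : homC N (homB phi K) n, closed f -> bounding f) <->
  (forall g : homC (restr phi N) K n, closed g -> bounding g).
Proof.
split=> H f fc.
  have [|h dh] := boundingP (subrK 1 n) (H (adj_from f) _).
    rewrite /closed [LHS]ghomd_adj_from [ghomd _ f]fc -[RHS]adj_toK.
    by rewrite (mor0 (@adj_toD _)).
  exists (n - 1), (subrK 1 n), (adj_to h).
  by rewrite [LHS]ghomd_adj_to [ghomd _ h]dh adj_fromK.
have [|h dh] := boundingP (subrK 1 n) (H (adj_to f) _).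
  by rewrite /closed [LHS]ghomd_adj_to [ghomd _ f]fc (mor0 (@adj_toD _)).
exists (n - 1), (subrK 1 n), (adj_from h).
by rewrite [LHS]ghomd_adj_from [ghomd _ h]dh adj_toK.
Qed.
End Adjunction.

Lemma homB_K_injective (A B : dgring) (phi : dgring_map A B) (K : dgmod A) :
  K_injective K -> K_injective (homB phi K).
Proof.
move=> hK N aN; apply/acyclicP => n; apply/adj_coh0.
by apply: Kinj_bounding.
Qed.

(** * Graded abelian groups *)

(** Abelian groups are treated as modules over the integers, so that [homB]
    also provides the modules [Hom_Z(A, E)] and the adjunction for them. *)
Definition Zring : dgring := dgring_of_ring int.

Section UnitMap.
Variable A : dgring.

Definition zunit (i : int) : Zring i -> A i :=
  match i return conc int i -> A i with
  | Posz 0 => fun n => (dgone : A 0) *~ (n : int)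
  | _ => fun _ => 0
  end.

Lemma zunit_neq0 i a : i != 0 -> @zunit i a = 0.
Proof. by case: i a => [[|i]|i]. Qed.

Lemma zunitB i : zmod_morphism (@zunit i).
Proof. by case: i => [[|i]|i] x y; rewrite /= ?subrr // mulrzBr. Qed.

Program Definition zunit_map : dgring_map Zring A :=
  @DGRingMap Zring A (@CMap Zring A zunit zunitB _) _ _.
Next Obligation.
move=> i j e x; rewrite [LHS](mor0 (@zunitB j)).
have [i0|i0] := eqVneq i 0; last by rewrite zunit_neq0 // (mor0 (cdB _)).
subst i; rewrite /= (morMz (cdB _)) [cd _ _](_ : _ = 0) ?mul0rz //.
exact: closed_cd (closedI (eqP (coc_one_subproof A))) _ e.
Qed.
Next Obligation.
move=> i j k e a b /=; have [ij|] := boolP ((i != 0) || (j != 0)).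
  rewrite conc_map2_0 // (mor0 (@zunitB k)).
  case/orP: ij => ij; first by rewrite (zunit_neq0 a) // (mor0 (dmulBl _ _)).
  by rewrite (zunit_neq0 b) // (mor0 (dmulBr _ _)).
rewrite negb_or !negbK => /andP[/eqP i0 /eqP j0]; subst i j.
have k0 : k = 0 by rewrite -e.
subst k; rewrite /= (morMz (dmulBl _ _)) (morMz (dmulBr _ _)) dmul1l.
by rewrite -mulrzA mulrC.
Qed.
Next Obligation. exact: mulr1z. Qed.
End UnitMap.

Lemma Zring_act0 (M : dgmod Zring) i j k (e : i + j = k) (a : Zring i)
    (m : M j) : i != 0 -> act e a m = 0.
Proof.
move=> i0; suff -> : a = 0 by rewrite (mor0 (actBl _ _)).
by case: i a i0 e => [[|i]|i] a // _ _; exact: ord1 a.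
Qed.

Lemma Zring_act (M : dgmod Zring) j k (e : 0 + j = k) (a : Zring 0) (m : M j) :
  act e a m = ctr (etrans (esym (add0r j)) e) m *~ (a : int).
Proof.
have -> : a = (dgone : Zring 0) *~ (a : int).
  by rewrite -[RHS]/((1 : int) *~ _) -[RHS]mulrzr mul1r intz.
rewrite (morMz (actBl _ _)); congr (_ *~ _).
  have jk : j = k by rewrite -e add0r.
  by move: jk e => <- e; rewrite act1 ctr_id.
by rewrite -[RHS]/((1 : int) *~ _) -[RHS]mulrzr mul1r intz.
Qed.

Section GradedGroup.
Variable E : int -> zmodType.

Definition gr_cpx : cpx :=
  @Cpx E (fun _ _ _ _ => 0) (fun _ _ _ => @zmod_morphism0 _ _)
    (fun _ _ _ _ _ _ => erefl).

Definition gr_act i j k : i + j = k -> Zring i -> E j -> E k :=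
  match i return i + j = k -> conc int i -> E j -> E k with
  | Posz 0 => fun e a x =>
      @ctr gr_cpx _ _ (etrans (esym (add0r j)) e) x *~ (a : int)
  | _ => fun _ _ _ => 0
  end.

Lemma gr_act_neq0 i j k (e : i + j = k) a x : i != 0 -> gr_act e a x = 0.
Proof. by case: i a e => [[|i]|i]. Qed.

Lemma gr_act0 i j k (e : i + j = k) a : gr_act e a 0 = 0.
Proof.
case: i a e => [[|i]|i] a e //=.
by rewrite (mor0 (@ctrB gr_cpx _ _ _)) mul0rz.
Qed.

(** A graded abelian group with zero differential. *)
Definition grmod : dgmod Zring.
Proof.
refine (@DGMod Zring gr_cpx gr_act _ _ _ _ _).
- move=> i j k e m a b; case: i e a b => [[|i]|i] e a b; rewrite /= ?subrr //.
  exact: mulrzBr.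
- move=> i j k e a x y; case: i e a => [[|i]|i] e a; rewrite /= ?subrr //.
  by rewrite ctrB mulrzBl.
- move=> i j k ij jk ijk e1 e2 e3 e4 a b m.
  have [i0|i0] := eqVneq i 0; last first.
    rewrite gr_act_neq0 //; have [j0|j0] := eqVneq j 0.
      by rewrite gr_act_neq0 // -e3 j0 addr0.
    rewrite [dmul _ _ _]conc_map2_0 ?i0 //.
    by case: ij e3 e4 => [[|ij]|ij] _ e4 //=; rewrite mulr0z.
  subst i; have [j0|j0] := eqVneq j 0; last first.
    by rewrite (gr_act_neq0 e1) // gr_act0 gr_act_neq0 // -e3 add0r.
  subst j; have k0 : ij = 0 by rewrite -e3.
  subst ij; rewrite /= (morMz (ctrB _)) -mulrzA mulrC; congr (_ *~ _).
  exact: (@ctr_ctr gr_cpx).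
- by move=> i e m; rewrite /= mulr1z ctr_id.
- move=> i j k i' j' k' e ei ej ek el er a m /=.
  rewrite gr_act0 mul0rz addr0; by case: i' {ei} el => [[|i']|i'] el.
Defined.
End GradedGroup.

Section GradedGroupMaps.
Variables (E : int -> zmodType) (M : dgmod Zring).

Section GrHom.
Variables (n : int) (f : forall i, M i -> E (i + n)).
Hypothesis (fB : forall i, zmod_morphism (@f i)).

Program Definition grhom : ghom M (grmod E) n :=
  @GHom Zring M (grmod E) n (fun i j e m => @ctr (gr_cpx E) _ _ e (f m)) _ _.
Next Obligation. by move=> i j e x y; rewrite fB ctrB. Qed.
Next Obligation.
move=> p i j k l e1 e2 e3 e4 a m; have [p0|p0] := eqVneq p 0; last first.
  by rewrite !Zring_act0 // mul0rz (mor0 (@fB _)) (mor0 (ctrB _)).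
move: p0 e1 e4 a => -> e1 e4 a; rewrite mulr0 ksign0 mulr1z !Zring_act.
rewrite (morMz (@fB _)) (morMz (ctrB _)); congr (_ *~ _).
have ik : i = k by rewrite -e1 add0r.
move: ik e1 e2 => <- e1 e2; rewrite ctr_id (ctr_ctr _ _ e2) //.
Qed.
End GrHom.

Lemma grhomE n f fB i m : ghf (@grhom n f fB) (erefl (i + n)) m = f i m.
Proof. exact: ctr_id. Qed.

Hypothesis Einj : forall i, injective_group (E i).

(** A graded map that kills the cocycles factors through the differential of
    [M]; as [E] is injective, the factorization extends to all of [M], and up
    to a sign it is a null-homotopy. *)
Lemma gr_bounding n (f : ghom M (grmod E) n) :
  (forall i (z : M i), closed z -> ghf f (erefl (i + n)) z = 0) ->
  bounding (f : homC M (grmod E) n).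
Proof.
move=> fz.
have H i : exists h : M i -> E (i - 1 + n), zmod_morphism h /\
    forall x : M (i - 1), h (cd (subrK 1 i) x) = ghf f erefl x.
  have [|h hB hx] := Einj (cdB (subrK 1 i)) (ghfB f (erefl (i - 1 + n))).
    by move=> x dx; apply: fz; exact: closedI dx.
  by exists h.
pose h i := projT1 (cid (H i)).
have hB i : zmod_morphism (h i) := (projT2 (cid (H i))).1.
have hd i x : h i (cd (subrK 1 i) x) = ghf f erefl x :=
  (projT2 (cid (H i))).2 x.
have e0 i : i - 1 + n = i + (n - 1) by lia.
pose h' i (x : M i) : E (i + (n - 1)) := @ctr (gr_cpx E) _ _ (e0 i) (h i x).
have h'B i : zmod_morphism (@h' i).
  by move=> x y; rewrite /h' hB (@ctrB (gr_cpx E)).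
exists (n - 1), (subrK 1 n), (grhom h'B *~ ksign n).
rewrite [LHS](morMz (ghomdB _)); apply: ghomP => i j e m.
have f1 : i + (n - 1) = j - 1 by lia.
have f2 : i + 1 + (n - 1) = j by lia.
rewrite ghomMzE (ghomdE _ _ e erefl (subrK 1 j) f1 f2) /= sub0r.
rewrite (ksignS (subrK 1 n)) mulNrz mulrNz opprK -mulrzA ksignM mulr1z.
have f3 : i = i + 1 - 1 by lia.
have f4 : i + 1 - 1 + n = j by lia.
rewrite -(cd_ctr f3 (subrK 1 (i + 1))) /h' hd.
rewrite (@ctr_ctr (gr_cpx E) _ _ _ _ _ f4).
by rewrite (@ctr_ghf _ M (grmod E) _ f _ _ _ _ _ f4) (ghf_ctr f f3 f4 e).
Qed.

Lemma gr_extend (M' : dgmod Zring) (u : dghom M' M) n (e : 0 + n = n)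
    (f : ghom M' (grmod E) n) : (forall i, injective (cmapf u (n := i))) ->
  exists f' : ghom M (grmod E) n, gcomp e f' (gof u) = f.
Proof.
move=> ui; have H i : exists h : M i -> E (i + n), zmod_morphism h /\
    forall x : M' i, h (cmapf u x) = ghf f erefl x.
  have [|h hB hx] := Einj (@cmapB _ _ u i) (ghfB f (erefl (i + n))).
    move=> x ux; rewrite -(mor0 (ghfB f (erefl (i + n)))); congr (ghf f _ _).
    by apply: (ui i); rewrite ux (mor0 (@cmapB _ _ u i)).
  by exists h.
pose h i := projT1 (cid (H i)).
have hB i : zmod_morphism (h i) := (projT2 (cid (H i))).1.
have hu i x : h i (cmapf u x) = ghf f erefl x := (projT2 (cid (H i))).2 x.
exists (grhom hB); apply: ghomP => i j e' m.
rewrite (gcompE e _ _ e' (addr0 i) e') gofE /= hu.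
by rewrite (@ctr_ghf _ M' (grmod E) _ f _ _ _ _ _ e').
Qed.

Lemma gr_represent n (phi : forall i, cocycle M i -> E (i + n)) :
  (forall i, zmod_morphism (@phi i)) ->
  (forall i (z : cocycle M i), bounding (cocv z) -> phi i z = 0) ->
  exists2 f : ghom M (grmod E) n, closed (f : homC M (grmod E) n) &
    forall i (z : cocycle M i), ghf f (erefl (i + n)) (cocv z) = phi i z.
Proof.
move=> phiB phi0; have H i : exists h : M i -> E (i + n), zmod_morphism h /\
    forall z : cocycle M i, h (cocv z) = phi i z.
  have [||h hB hx] := Einj (_ : zmod_morphism (@cocv M i)) (phiB i).
  - by move=> x y; [].
  - by move=> z z0; apply: phi0; rewrite z0; exact: bounding0.
  by exists h.
pose h i := projT1 (cid (H i)).
have hB i : zmod_morphism (h i) := (projT2 (cid (H i))).1.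
have hz i z : h i (cocv z) = phi i z := (projT2 (cid (H i))).2 z.
exists (grhom hB) => [|i z]; last by rewrite grhomE.
apply: ghomP => i j e m.
have f1 : i + n = j - 1 by lia.
have f2 : i + 1 + n = j by lia.
rewrite [LHS](ghomdE _ _ e erefl (subrK 1 j) f1 f2) /= sub0r.
have dm : closed (cd (erefl (i + 1)) m) by exact: cdd.
rewrite (hz _ (mkcoc dm)) phi0 ?(mor0 (@ctrB (gr_cpx E) _ _ _)) ?mul0rz
  ?oppr0 //.
by exists i, erefl, m.
Qed.
End GradedGroupMaps.

(** * Coinduced modules *)

(** Injectivity of the underlying graded module. It is used to extend
    homotopies strictly, and not only up to a further homotopy. *)
Definition graded_injective (A : dgring) (X : dgmod A) :=
  forall (M N : dgmod A) (u : dghom M N),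
    (forall i, injective (cmapf u (n := i))) ->
  forall n (e : 0 + n = n) (f : ghom M X n),
    exists f' : ghom N X n, gcomp e f' (gof u) = f.

Section Coinduced.
Variables (A : dgring) (E : int -> zmodType).
Hypothesis Einj : forall i, injective_group (E i).

Definition coind : dgmod A := homB (zunit_map A) (grmod E).

Definition coind_ev n (v : coind n) : E n :=
  ghf (v : ghom _ (grmod E) n) (add0r n) (dgone : A 0).

Lemma coind_evB n : zmod_morphism (@coind_ev n).
Proof. by []. Qed.

Lemma coind_ev_cd n k (e : n + 1 = k) (v : coind n) : coind_ev (cd e v) = 0.
Proof.
have e1 : 0 + n = k - 1 by lia.
have e2 : 0 + 1 + n = k by lia.
rewrite /coind_ev [LHS](ghomdE _ _ (add0r k) erefl (subrK 1 k) e1 e2).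
by rewrite cd_dgone (mor0 (ghfB _ _)) mul0rz subr0.
Qed.

Lemma coind_ev_bounding n (v : coind n) : bounding v -> coind_ev v = 0.
Proof. by move=> [k [e [w <-]]]; exact: coind_ev_cd. Qed.

(** Together with [coind_represent]: since [E] is injective and has no
    differential, the classes of maps of degree [n] from [M] to [coind] are
    the families of homomorphisms from [H^i M] to [E^(i+n)]. *)
Lemma coind_bounding (M : dgmod A) n (f : ghom M coind n) :
  (forall i (z : M i), closed z -> coind_ev (ghf f (erefl (i + n)) z) = 0) ->
  bounding (f : homC M coind n).
Proof.
move=> fz; have [|k [e [h dh]]] := gr_bounding Einj (f := adj_to f).
  by move=> i z zc; rewrite -(fz i z zc); exact: ghf_eq.
exists k, e, (adj_from h).
by rewrite [LHS]ghomd_adj_from [ghomd _ h]dh adj_toK.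
Qed.

Lemma coind_represent (M : dgmod A) n
    (phi : forall i, cocycle M i -> E (i + n)) :
  (forall i, zmod_morphism (@phi i)) ->
  (forall i (z : cocycle M i), bounding (cocv z) -> phi i z = 0) ->
  exists2 f : ghom M coind n, closed (f : homC M coind n) &
    forall i (z : cocycle M i),
      coind_ev (ghf f (erefl (i + n)) (cocv z)) = phi i z.
Proof.
move=> phiB phi0.
have [f fc fz] := @gr_represent _ (restr (zunit_map A) M) Einj n phi phiB phi0.
exists (adj_from f) => [|i z].
  rewrite /closed [LHS]ghomd_adj_from [ghomd _ f]fc -[RHS]adj_toK.
  by rewrite (mor0 (@adj_toD _ _ _ _ _ _)).
rewrite -(fz i z) -[in RHS](adj_fromK f) //.
Qed.

Lemma coind_K_injective : K_injective coind.
Proof.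
move=> N aN; apply/acyclicP => n f fc; apply: coind_bounding => i z zc.
have /acyclicP/(_ i z zc)/(boundingP (subrK 1 i))[y <-] := aN.
have e1 : i - 1 + n = i + n - 1 by lia.
have e2 : i - 1 + (n + 1) = i + n by lia.
have := congr1 (fun g : ghom N coind _ => ghf g e2 y) fc.
rewrite /= (ghomd_funE erefl f e2 (subrK 1 i) (subrK 1 (i + n)) e1 erefl).
move=> /eqP; rewrite subr_eq0 => /eqP E1.
have := congr1 (fun v : coind (i + n) => coind_ev (v *~ ksign n)) E1.
rewrite -mulrzA ksignM mulr1z => <-.
by rewrite (morMz (@coind_evB _)) coind_ev_cd mul0rz.
Qed.

Lemma coind_graded_injective : graded_injective coind.
Proof.
move=> M N u ui n e f.
have [f' f'u] :=
  gr_extend Einj (u := restr_map (zunit_map A) u) e (adj_to f) ui.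
exists (adj_from f'); rewrite -[RHS]adj_toK -f'u -[LHS]adj_toK; congr adj_from.
apply: ghomP => i j e' m; rewrite (gcompE e _ _ e' (addr0 i) e') gofE.
rewrite -[in RHS](adj_fromK f').
transitivity (ghf (ghf (gcomp e (adj_from f') (gof u)) e' m : ghom _ _ j)
  (add0r j) (dgone : A 0)) => //.
by rewrite (gcompE e _ _ e' (addr0 i) e') gofE.
Qed.
End Coinduced.

(** * One step of the resolution *)

Section TransportClosed.
Variables (C : cpx) (i j : int) (e : i = j).

Lemma ctr_closed (x : C i) : closed x -> closed (ctr e x).
Proof. by subst j; rewrite ctr_id. Qed.

Lemma ctr_bounding (x : C i) : bounding (ctr e x) <-> bounding x.
Proof. by subst j; rewrite ctr_id. Qed.
End TransportClosed.

Section FiberLift.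
Variables (A : dgring) (X J : dgmod A) (t : dghom X J).

Lemma fib_lift_closed : K_injective J ->
  forall N : dgmod A, acyclic N -> forall (n : int) (f : ghom N (fib t) n)
    (h : ghom N X (n - 1)), closed (f : homC N (fib t) n) ->
  ghomd (subrK 1 n) h = gcomp (addr0 n) (gof (fib_proj t)) f ->
  exists2 h' : ghom N (fib t) (n - 1), ghomd (subrK 1 n) h' = f &
    gcomp (addr0 (n - 1)) (gof (fib_proj t)) h' = h.
Proof.
move=> hJ N aN n f h fc dh.
have e1 : n - 1 + 0 = n - 1 by rewrite addr0.
have e2 : n + 1 - 1 = n by lia.
have [|k dk] := @boundingP (homC N J) (n - 1)
    (gcomp e1 (gof t) h - gcomp (erefl (n - 1)) (fib_prN t) f) _
    (subrK 1 (n - 1)).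
  apply: Kinj_bounding => //; apply: (closedI (e := subrK 1 n)).
  rewrite [LHS]ghomdB.
  rewrite (ghomd_comp e1 (subrK 1 n) (add0r 1) _ (subrK 1 n) (addr0 n)).
  rewrite gof_closed (mor0 (gcompBl _ _)) add0r dh mulr1z.
  rewrite (ghomd_comp _ erefl (addNr 1) _ (addr0 n) e2).
  rewrite [ghomd erefl f]fc (mor0 (gcompBr _ _)) mul0rz addr0.
  rewrite (fib_d_prN _ _ (addr0 0)) -(gcompA (addr0 n) (addr0 n)).
  by rewrite subrr.
have e3 : n - 1 - 1 + 1 = n - 1 by lia.
exists (gcomp e3 (fib_inN t) k + gcomp e1 (fib_inM t) h); last first.
  rewrite (morD (gcompBr _ _)) (gcompA e3 _ (addr0 1) e3) fib_proj_inN.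
  rewrite (mor0 (gcompBl _ _)) add0r (gcompA e1 _ (addr0 0) e1) fib_proj_inM.
  exact: gcomp_idl.
rewrite (morD (ghomdB _)).
have e4 : n - 1 - 1 + (1 + 1) = n by lia.
rewrite (ghomd_comp e3 (subrK 1 (n - 1)) erefl _ e4 (subrK 1 n)).
rewrite fib_d_inN (mor0 (gcompBl _ _)) add0r [ghomd _ k]dk.
rewrite (ghomd_comp e1 (subrK 1 n) (add0r 1) _ (subrK 1 n) (addr0 n)).
rewrite dh (fib_d_inM _ _ (add0r 1)) mulr1z mulrN1z gcompBr opprB addrA.
rewrite (gcompA e1 (subrK 1 n) (add0r 1) (subrK 1 n)) subrK.
rewrite (gcompA _ (subrK 1 n) (addNr 1) (addr0 n)).
rewrite (gcompA _ (addr0 n) (addr0 0) (addr0 n)) -(morD (gcompBl _ _)).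
by rewrite fib_decomp gcomp_idl.
Qed.

Lemma fib_lift_graded : graded_injective J ->
  forall (N' N : dgmod A) (u : dghom N' N),
    (forall i, injective (cmapf u (n := i))) ->
  forall (n : int) (e : 0 + n = n) (f : ghom N' (fib t) n) (h : ghom N X n),
  gcomp e h (gof u) = gcomp (addr0 n) (gof (fib_proj t)) f ->
  exists2 h' : ghom N (fib t) n, gcomp e h' (gof u) = f &
    gcomp (addr0 n) (gof (fib_proj t)) h' = h.
Proof.
move=> gJ N' N u ui n e f h hu.
have e1 : 0 + (n - 1) = n - 1 by lia.
have [k ku] := gJ _ _ u ui _ e1 (gcomp (erefl (n - 1)) (fib_prN t) f).
exists (gcomp (subrK 1 n) (fib_inN t) k + gcomp (addr0 n) (fib_inM t) h).
  rewrite (morD (gcompBl _ _)) -(gcompA e1 (subrK 1 n)) ku.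
  rewrite -(gcompA e (addr0 n)) hu (gcompA _ (subrK 1 n) (addNr 1) (addr0 n)).
  rewrite (gcompA _ (addr0 n) (addr0 0) (addr0 n)) -(morD (gcompBl _ _)).
  by rewrite fib_decomp gcomp_idl.
rewrite (morD (gcompBr _ _)) (gcompA _ (addr0 n) (addr0 1) (subrK 1 n)).
rewrite fib_proj_inN (mor0 (gcompBl _ _)) add0r.
by rewrite (gcompA _ (addr0 n) (addr0 0) (addr0 n)) fib_proj_inM gcomp_idl.
Qed.
End FiberLift.

(** What the limit of a tower of modules under [M] needs to know about each
    step [p : X' -> X]. Primitives of closed maps and extensions of graded
    maps lift along [p], which makes the limit K-injective and graded
    injective; and [p] induces zero on the cohomology of the fibers over [M],
    which makes [M] quasi-isomorphic to the limit. *)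
Record tower_step (A : dgring) (M X X' : dgmod A) (g : dghom M X)
    (g' : dghom M X') (p : dghom X' X) : Prop := TowerStep {
  step_comm : forall n (x : M n), cmapf p (cmapf g' x) = cmapf g x;
  step_surj : forall n (x : X n), exists x' : X' n, cmapf p x' = x;
  step_closed : forall N : dgmod A, acyclic N ->
    forall (n : int) (f : ghom N X' n) (h : ghom N X (n - 1)),
    closed (f : homC N X' n) ->
    ghomd (subrK 1 n) h = gcomp (addr0 n) (gof p) f ->
    exists2 h' : ghom N X' (n - 1), ghomd (subrK 1 n) h' = f &
      gcomp (addr0 (n - 1)) (gof p) h' = h;
  step_graded : forall (N' N : dgmod A) (u : dghom N' N),
      (forall i, injective (cmapf u (n := i))) ->
    forall (n : int) (e : 0 + n = n) (f : ghom N' X' n) (h : ghom N X n),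
    gcomp e h (gof u) = gcomp (addr0 n) (gof p) f ->
    exists2 h' : ghom N X' n, gcomp e h' (gof u) = f &
      gcomp (addr0 n) (gof p) h' = h;
  step_coh0 : forall n (y : X' (n - 1)) (m : M n),
    closed ((y, m) : fib g' n) -> bounding ((cmapf p y, m) : fib g n) }.

Section Step.
Variables (A : dgring) (M X : dgmod A) (g : dghom M X).

(* The map [T] built below has degree -1, hence the shift. *)
Let E (i : int) : zmodType := bidual (coh (fib g) (i + 1) : zmodType).
Let J := coind A E.

Lemma step_class_e (i : int) : i = i - 1 + 1. Proof. by lia. Qed.

Definition step_class i (z : cocycle (fib g) i) : E (i - 1) :=
  to_bidual (cohcl (mkcoc (ctr_closed (step_class_e i) (cocycle_closed z)))).

Lemma step_classB i : zmod_morphism (@step_class i).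
Proof.
move=> x y; rewrite /step_class -to_bidualB -cohclB;
  congr (to_bidual (cohcl _)).
by apply: val_inj; exact: ctrB.
Qed.

Lemma step_class_eq0 i (z : cocycle (fib g) i) :
  step_class z = 0 <-> bounding (cocv z).
Proof.
split=> [/to_bidual_eq0/cohcl_eq0/ctr_bounding //|bz].
rewrite /step_class (_ : cohcl _ = 0) ?(mor0 (@to_bidualB _)) //.
exact/cohcl_eq0/ctr_bounding.
Qed.

(** [X'] is the fiber of a map [t] from [X] to a coinduced module [J]. The map
    [t] and a null-homotopy of [t g] are the components of a closed map [T]
    from the fiber of [g] to [J] that detects all cohomology classes of that
    fiber. A closed element of the fiber of [g'] contains a primitive of the
    value of [T] at its image, so this image bounds. *)
Lemma step_exists : exists (X' : dgmod A) (g' : dghom M X') (p : dghom X' X),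
  tower_step g g' p.
Proof.
have Einj i : injective_group (E i) by exact: bidual_injective.
have [T Tc Tz] := @coind_represent A E Einj (fib g) (-1) step_class step_classB
  (fun i z => (step_class_eq0 z).2).
pose t0 : ghom X J 0 := gcomp (addrN 1) T (fib_inN g).
have t0c : ghomd (add0r 1) t0 = 0.
  rewrite (ghomd_comp _ erefl (addNr 1) _ (addr0 1) (addrK 1 1)) fib_d_inN.
  rewrite [ghomd _ T](closed_cd (Tc : closed (T : homC _ _ _))).
  by rewrite (mor0 (gcompBl _ _)) (mor0 (gcompBr _ _)) mul0rz addr0.
pose t : dghom X J := dghom_of t0c.
pose j : ghom M J (-1) := - gcomp (add0r (-1)) T (fib_inM g).
have dj (e : -1 + 1 = 0 :> int) (e' : 0 + 0 = 0 :> int) :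
    ghomd e j = gcomp e' (gof t) (gof g).
  rewrite /j (morN (ghomdB _)) (ghomd_comp _ (add0r 1) e _ (addr0 0) (addrN 1)).
  rewrite [ghomd _ T](closed_cd (Tc : closed (T : homC _ _ _))).
  rewrite (mor0 (gcompBl _ _)) add0r (fib_d_inM _ _ (add0r 1)) mulrN1z opprK.
  by rewrite (gcompA _ _ (addrN 1) e') gof_dghom_of.
exists (fib t), (fib_pair dj), (fib_proj t); split=> //.
- by move=> n x; exists (0, x).
- by apply: fib_lift_closed; exact: coind_K_injective.
- by apply: fib_lift_graded; exact: coind_graded_injective.
move=> n [w y] m /fib_closedP[mc dz].
have dw : ctr (fib_cd_e2 (subrK 1 n)) (cmapf t y)
    - cd (fib_cd_e1 (subrK 1 n)) w = ghf j (erefl (n - 1)) m.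
  exact: (congr1 fst (dz (subrK 1 n))).
have dy : cd (subrK 1 n) y = cmapf g m by exact: (congr1 snd (dz (subrK 1 n))).
have zc : closed ((y, m) : fib g n).
  by apply/fib_closedP; split=> //= e; rewrite -dy; exact: cd_irr.
apply/(step_class_eq0 (mkcoc zc)); rewrite -Tz; apply: coind_ev_bounding.
rewrite [cocv _](_ : _ = ghf (fib_inN g) (subrK 1 n) y +
  ghf (fib_inM g) (addr0 n) m); last first.
  by apply: pair_eq; rewrite /= ?ctr_id ?addr0 ?add0r.
rewrite (morD (ghfB T _)).
rewrite -(gcompE (addrN 1) T _ (addr0 (n - 1)) _ (erefl (n - 1))).
rewrite -[ghf T _ (ghf _ _ m)](gcompE (add0r (-1)) T _ (erefl (n - 1))).
rewrite -[gcomp (add0r (-1)) T (fib_inM g)]opprK -/j ghomNE -dw ctr_id.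
exists (n - 1 - 1), (subrK 1 (n - 1)), w.
by rewrite opprB addrCA subrr addr0; exact: cd_irr.
Qed.
End Step.

Lemma addrD_subB (V : zmodType) (a x c : V) : a + (x - c - (a - c)) = x.
Proof. by rewrite opprB [x - c + _]addrA subrK addrCA subrr addr0. Qed.

(** * Limits of towers and K-injective resolutions *)

(** Chooses a strictly compatible family along a tower, one level at a
    time. *)
Lemma tower_choice (T : nat -> Type) (P : forall k, T k -> Prop)
    (R : forall k, T k -> T k.+1 -> Prop) :
  (exists x, P 0%N x) -> (forall k x, P k x -> exists2 y, P k.+1 y & R k x y) ->
  exists s : forall k, T k,
    (forall k, P k (s k)) /\ forall k, R k (s k) (s k.+1).
Proof.
move=> /cid[x0 Px0] step.
have next k (x : {x | P k x}) : {y : {y | P k.+1 y} | R k (sval x) (sval y)}.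
  by have /cid2[y Py Rxy] := step k (sval x) (svalP x); exists (exist _ y Py).
pose s := fix s k : {x | P k x} := match k with
  | 0 => exist _ x0 Px0 | k.+1 => sval (next k (s k)) end.
exists (fun k => sval (s k)); split=> k; first exact: svalP.
exact: svalP (next k (s k)).
Qed.

Section Limit.
Variables (A : dgring) (X : nat -> dgmod A).
Variable p : forall k, dghom (X k.+1) (X k).

Section LimitGroup.
Variable n : int.

Record lim_el := LimEl {
  lim_c :> forall k, X k n;
  limP : forall k, cmapf (p k) (lim_c k.+1) = lim_c k }.

Lemma lim_ext (x y : lim_el) : (forall k, lim_c x k = lim_c y k) -> x = y.
Proof.
case: x y => x xP [y yP] /= xy.
have {}xy : x = y by exact: functional_extensionality_dep.
by subst y; congr LimEl; exact: Prop_irrelevance.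
Qed.

HB.instance Definition _ := gen_eqMixin lim_el.
HB.instance Definition _ := gen_choiceMixin lim_el.

Program Definition lim0 := @LimEl (fun _ => 0) _.
Next Obligation. by move=> k; rewrite (mor0 (@cmapB _ _ (p k) _)). Qed.

Program Definition limN (x : lim_el) := @LimEl (fun k => - lim_c x k) _.
Next Obligation. by move=> x k; rewrite (morN (@cmapB _ _ (p k) _)) limP. Qed.

Program Definition limD (x y : lim_el) :=
  @LimEl (fun k => lim_c x k + lim_c y k) _.
Next Obligation.
by move=> x y k; rewrite (morD (@cmapB _ _ (p k) _)) !limP.
Qed.

Lemma limDA : associative limD.
Proof. by move=> x y z; apply: lim_ext => k; exact: addrA. Qed.
Lemma limDC : commutative limD.
Proof. by move=> x y; apply: lim_ext => k; exact: addrC. Qed.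
Lemma lim0D : left_id lim0 limD.
Proof. by move=> x; apply: lim_ext => k; exact: add0r. Qed.
Lemma limND : left_inverse lim0 limN limD.
Proof. by move=> x; apply: lim_ext => k; exact: addNr. Qed.

HB.instance Definition _ :=
  GRing.isZmodule.Build lim_el limDA limDC lim0D limND.

Lemma lim_cB k : zmod_morphism (fun x : lim_el => lim_c x k).
Proof. by []. Qed.
End LimitGroup.

Program Definition lim_cd i j (e : i + 1 = j) (x : lim_el i) : lim_el j :=
  @LimEl j (fun k => cd e (lim_c x k)) _.
Next Obligation. by move=> i j e x k; rewrite cmapd limP. Qed.

Program Definition lim_act i j k (e : i + j = k) (a : A i) (x : lim_el j) :
  lim_el k := @LimEl k (fun l => act e a (lim_c x l)) _.
Next Obligation. by move=> i j k e a x l; rewrite dghL limP. Qed.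

Definition lim_cpx : cpx.
Proof.
refine (@Cpx (fun n => lim_el n : zmodType) lim_cd _ _).
- by move=> i j e x y; apply: lim_ext => k; exact: cdB.
- by move=> i j k e e' x; apply: lim_ext => l; exact: cdd.
Defined.

Definition dglim : dgmod A.
Proof.
refine (@DGMod A lim_cpx lim_act _ _ _ _ _).
- by move=> i j k e m a b; apply: lim_ext => l; exact: actBl.
- by move=> i j k e m a b; apply: lim_ext => l; exact: actBr.
- by move=> *; apply: lim_ext => l; exact: actA.
- by move=> *; apply: lim_ext => l; exact: act1.
- move=> i j k i' j' k' e ei ej ek el er a m; apply: lim_ext => l.
  rewrite [LHS](actd _ ei ej _ el er); congr (_ + _).
  by rewrite (morMz (@lim_cB _ l)).
Defined.

Definition lim_pr k : dghom dglim (X k) :=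
  @DGHom A dglim (X k) (@CMap dglim (X k) (fun n x => lim_c x k)
    (fun n => @lim_cB n k) (fun _ _ _ _ => erefl)) (fun _ _ _ _ _ _ => erefl).

Section IntoLimit.
Variables (N : dgmod A) (n : int) (h : forall k, ghom N (X k) n).
Hypothesis hp : forall k, gcomp (addr0 n) (gof (p k)) (h k.+1) = h k.

Program Definition into_lim : ghom N dglim n :=
  @GHom A N dglim n (fun i j e m => @LimEl j (fun k => ghf (h k) e m) _) _ _.
Next Obligation.
move=> i j e m k; have := congr1 (fun g => ghf g e m) (hp k).
by rewrite (gcompE _ _ _ e e (addr0 j)) gofE.
Qed.
Next Obligation. by move=> i j e x y; apply: lim_ext => k; exact: ghfB. Qed.
Next Obligation.
move=> q i j k l e1 e2 e3 e4 a m; apply: lim_ext => r.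
by rewrite (morMz (@lim_cB _ r)); exact: ghfL.
Qed.
End IntoLimit.

Lemma ghom_lim_ext N n (f g : ghom N dglim n) :
  (forall k,
     gcomp (addr0 n) (gof (lim_pr k)) f = gcomp (addr0 n) (gof (lim_pr k)) g) ->
  f = g.
Proof.
move=> fg; apply: ghomP => i j e m; apply: lim_ext => k.
have := congr1 (fun g => ghf g e m) (fg k).
by rewrite !(gcompE _ _ _ e e (addr0 j)) !gofE.
Qed.

Lemma into_limE N n h hp k :
  gcomp (addr0 n) (gof (lim_pr k)) (@into_lim N n h hp) = h k.
Proof.
by apply: ghomP => i j e m; rewrite (gcompE _ _ _ e e (addr0 j)) gofE.
Qed.

Lemma lim_pr_step N n (f : ghom N dglim n) k :
  gcomp (addr0 n) (gof (p k)) (gcomp (addr0 n) (gof (lim_pr k.+1)) f)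
  = gcomp (addr0 n) (gof (lim_pr k)) f.
Proof.
apply: ghomP => i j e m; rewrite !(gcompE _ _ _ e e (addr0 j)) !gofE.
exact: limP.
Qed.

Lemma ghomd_pr N n n' (en : n + 1 = n') (f : ghom N dglim n) k :
  ghomd en (gcomp (addr0 n) (gof (lim_pr k)) f)
  = gcomp (addr0 n') (gof (lim_pr k)) (ghomd en f).
Proof.
rewrite (ghomd_comp _ en (add0r 1) _ en (addr0 n')) gof_closed.
by rewrite (mor0 (gcompBl _ _)) add0r mulr1z.
Qed.

Variables (M : dgmod A) (g : forall k, dghom M (X k)).
Hypothesis Xstep : forall k, tower_step (g k) (g k.+1) (p k).
Hypothesis X0 : forall n (x : X 0 n), x = 0.

(** Primitives are chosen level by level, each one lifting the previous
    one. *)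
Lemma lim_K_injective : K_injective dglim.
Proof.
move=> N aN; apply/acyclicP => n f fc.
pose P k (h : ghom N (X k) (n - 1)) :=
  ghomd (subrK 1 n) h = gcomp (addr0 n) (gof (lim_pr k)) f.
pose R k (h : ghom N (X k) (n - 1)) (h' : ghom N (X k.+1) (n - 1)) :=
  gcomp (addr0 (n - 1)) (gof (p k)) h' = h.
have [||h [hP hR]] := @tower_choice _ P R.
- by exists 0; rewrite /P; apply: ghomP => i j e m; rewrite [LHS]X0 [RHS]X0.
- move=> k h hk; rewrite /P /R; apply: (step_closed (Xstep k)) => //.
    rewrite /closed [LHS]ghomd_pr [ghomd _ f]fc; exact: (mor0 (gcompBr _ _)).
  by rewrite lim_pr_step.
exists (n - 1), (subrK 1 n), (into_lim hR); apply: ghom_lim_ext => k.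
by rewrite -ghomd_pr into_limE hP.
Qed.

Lemma lim_graded_injective : graded_injective dglim.
Proof.
move=> N' N u ui n e f.
pose P k (h : ghom N (X k) n) :=
  gcomp e h (gof u) = gcomp (addr0 n) (gof (lim_pr k)) f.
pose R k (h : ghom N (X k) n) (h' : ghom N (X k.+1) n) :=
  gcomp (addr0 n) (gof (p k)) h' = h.
have [||h [hP hR]] := @tower_choice _ P R.
- by exists 0; rewrite /P; apply: ghomP => i j e' m; rewrite [LHS]X0 [RHS]X0.
- move=> k h hk; rewrite /P /R; apply: (step_graded (Xstep k)) => //.
  by rewrite lim_pr_step.
exists (into_lim hR); apply: ghom_lim_ext => k.
by rewrite (gcompA _ _ (addr0 n) e) into_limE hP.
Qed.

Program Definition lim_map : dghom M dglim :=
  @DGHom A M dglim (@CMap M dglim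
    (fun n x => @LimEl n (fun k => cmapf (g k) x) _) _ _) _.
Next Obligation. by move=> n x k; exact: (step_comm (Xstep k)). Qed.
Next Obligation. by move=> n x y; apply: lim_ext => k; exact: cmapB. Qed.
Next Obligation. by move=> i j e x; apply: lim_ext => k; exact: cmapd. Qed.
Next Obligation. by move=> i j k e a x; apply: lim_ext => l; exact: dghL. Qed.

Program Definition fib_step k : dghom (fib (g k.+1)) (fib (g k)) :=
  @DGHom A (fib (g k.+1)) (fib (g k)) (@CMap (fib (g k.+1)) (fib (g k))
    (fun n z => (cmapf (p k) z.1, z.2)) _ _) _.
Next Obligation. by move=> k n x y; apply: pair_eq; rewrite /= ?cmapB. Qed.
Next Obligation.
move=> k i j e x; apply: pair_eq => //=.
by rewrite cmapB cmapd cmapf_ctr (step_comm (Xstep k)).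
Qed.
Next Obligation.
move=> k i j l e a x; apply: pair_eq => //=.
by rewrite (morMz (@cmapB _ _ (p k) _)) dghL.
Qed.

(** Milnor's argument: the maps [fib_step] are surjective, and zero on
    cohomology, so the limit of the fibers is acyclic. Let [b k] be a
    primitive of the given element at level [k], and [c k] the image of
    [b k.+1]. The images of the [c k.+1] agree with the [c k] up to
    boundaries, and lifting these boundaries along the surjections turns the
    [c k] into a compatible family. *)
Lemma lim_fib_acyclic : acyclic (fib lim_map).
Proof.
apply/acyclicP => n [y m] /fib_closedP[mc dy].
pose Z k : fib (g k) n := (lim_c y k, m).
have ZE k : cmapf (fib_step k) (Z k.+1) = Z k.
  by apply: pair_eq => //=; exact: limP.
have Zc k : closed (Z k).
  apply/fib_closedP; split=> // e.
  exact: (congr1 (fun x => lim_c x k) (dy e)).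
have step0 k i (z : fib (g k.+1) i) : closed z ->
  bounding (cmapf (fib_step k) z).
  by case: z => z1 z2; exact: (step_coh0 (Xstep k)).
have bZ k : exists b : fib (g k) (n - 1), cd (subrK 1 n) b = Z k.
  by apply: boundingP; rewrite -ZE; exact: step0.
pose b k := projT1 (cid (bZ k)).
have db k : cd (subrK 1 n) (b k) = Z k := projT2 (cid (bZ k)).
pose c k := cmapf (fib_step k) (b k.+1).
have dc k : cd (subrK 1 n) (c k) = Z k by rewrite -cmapd db ZE.
have cc k : bounding (cmapf (fib_step k) (c k.+1) - c k).
  rewrite -(@cmapB _ _ (fib_step k)).
  by apply: step0; apply: (closedI (e := subrK 1 n)); rewrite cdB dc db subrr.
pose P k (x : fib (g k) (n - 1)) :=
  cd (subrK 1 n) x = Z k /\ bounding (x - c k).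
pose R k (x : fib (g k) (n - 1)) (x' : fib (g k.+1) (n - 1)) :=
  cmapf (fib_step k) x' = x.
have [||s [sP sR]] := @tower_choice _ P R.
- by exists (c 0%N); split; rewrite ?subrr //; exact: bounding0.
- move=> k x [dx /(boundingP (subrK 1 (n - 1)))[e de]].
  have [e1 de1] := boundingP (subrK 1 (n - 1)) (cc k).
  have [e' e'E] : exists e', cmapf (fib_step k) e' = e - e1.
    have [y' y'E] := step_surj (Xstep k) (e - e1).1.
    by exists (y', (e - e1).2); apply: pair_eq.
  (* The correction [e'] is chosen so that the new element lies over [x]. *)
  exists (c k.+1 + cd (subrK 1 (n - 1)) e').
    split; first by rewrite (morD (cdB _)) cdd addr0.
    by rewrite addrAC subrr add0r; exists (n - 1 - 1), (subrK 1 (n - 1)), e'.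
  rewrite /R (morD (@cmapB _ _ (fib_step k) _)) cmapd e'E cdB de de1.
  exact: addrD_subB.
have s2 k : (s k).2 = (s 0%N).2 by elim: k => // k <-; rewrite -[in RHS](sR k).
have sp k : cmapf (p k) (s k.+1).1 = (s k).1 by rewrite -[in RHS](sR k).
exists (n - 1), (subrK 1 n), (LimEl sp, (s 0%N).2).
apply: pair_eq; last exact: (congr1 snd (sP 0%N).1).
apply: lim_ext => k; rewrite -[RHS]/(Z k).1 -(sP k).1 /= s2; congr (_ - _).
exact: (cmapf_ctr (lim_pr k)).
Qed.
End Limit.

Lemma acyclic_fib_quasi_iso (A : dgring) (M N : dgmod A) (u : dghom M N) :
  acyclic (fib u) -> quasi_iso u.
Proof.
move=> /acyclicP aF; apply/quasi_isoP; split=> n.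
  move=> x xc /(boundingP (subrK 1 n))[y dy].
  have [|v [w [_ dw]]] := (fib_boundingP (y, x)).1 (aF n (y, x) _).
    by apply/fib_closedP; split=> // e; rewrite -dy; exact: cd_irr.
  by exists (n - 1), (subrK 1 n), w.
move=> y yc; have e : n = n + 1 - 1 by rewrite addrK.
have [|v [w [wy dw]]] :=
  (fib_boundingP ((ctr e y, 0) : fib u (n + 1))).1 (aF _ _ _).
  apply/fib_closedP; split=> [|e']; first exact: closed0.
  by rewrite (cd_ctr _ _ erefl) (mor0 (@cmapB _ _ u _)).
exists (ctr (esym e) w).
  by apply: ctr_closed; exact: closedI dw.
rewrite cmapf_ctr -[y](ctr_id erefl) -(ctr_ctr e (esym e)).
rewrite -ctrB; apply/ctr_bounding; rewrite -[ctr e y]wy subKr.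
by exists (n + 1 - 1 - 1), (subrK 1 (n + 1 - 1)), v.
Qed.

Program Definition zero_map (A : dgring) (M N : dgmod A) : dghom M N :=
  @DGHom A M N (@CMap M N (fun _ _ => 0) (fun _ => @zmod_morphism0 _ _) _) _.
Next Obligation. by move=> *; rewrite (mor0 (cdB _)). Qed.
Next Obligation. by move=> *; rewrite /= (mor0 (actBr _ _)). Qed.

(** The tower starts at the zero module, and each step corrects the cohomology
    of the fiber with a coinduced module. Besides being K-injective, the limit
    is graded injective; resolutions in general are not. *)
Theorem K_injective_resolution_exists (A : dgring) (M : dgmod A) :
  exists (X : dgmod A) (r : dghom M X),
    [/\ K_injective X, graded_injective X & quasi_iso r].
Proof.
pose stage := {X : dgmod A & dghom M X}.
have next (s : stage) : {s' : stage & {p : dghom (projT1 s') (projT1 s) |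
    tower_step (projT2 s) (projT2 s') p}}.
  have /cid[X' /cid[g' /cid[p pP]]] := step_exists (projT2 s).
  by exists (existT _ X' g'), p.
pose s := fix s k : stage := match k with
  | 0 => existT _ (dgzero A) (zero_map M (dgzero A)) | k.+1 =>
    projT1 (next (s k)) end.
pose p k := sval (projT2 (next (s k))) : dghom (projT1 (s k.+1)) (projT1 (s k)).
have pP k : tower_step (projT2 (s k)) (projT2 (s k.+1)) (p k) :=
  svalP (projT2 (next (s k))).
have s0 n (x : projT1 (s 0%N) n) : x = 0 by exact: ord1 (x : 'I_1).
exists (dglim p), (lim_map pP); split.
- exact: lim_K_injective pP s0.
- exact: lim_graded_injective pP s0.
- exact/acyclic_fib_quasi_iso/lim_fib_acyclic.
Qed.

Lemma Kinj_resP (A : dgring) (M : dgmod A) : Kinj_resolution (Kinj_res M).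
Proof.
rewrite /Kinj_res; case: pselect => [h|noh]; first exact: (projT2 (cid h)).
have [X [r [hX _ hr]]] := K_injective_resolution_exists M.
by case: noh; exists (existT _ X r).
Qed.

Definition Kinj_map (A : dgring) (M : dgmod A) : dghom M (Kinj M) :=
  projT2 (Kinj_res M).

Lemma Kinj_K_injective (A : dgring) (M : dgmod A) : K_injective (Kinj M).
Proof. by have [] := Kinj_resP M. Qed.

Lemma Kinj_map_quasi_iso (A : dgring) (M : dgmod A) : quasi_iso (Kinj_map M).
Proof. by have [] := Kinj_resP M. Qed.

(** * Morphisms of the derived category *)

Section ClosedComposition.
Variables (A : dgring) (M N P : dgmod A) (p q r : int) (e : p + q = r).

Lemma gcomp_closed (g : ghom N P q) (f : ghom M N p) :
  closed (g : homC N P q) -> closed (f : homC M N p) ->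
  closed (gcomp e g f : homC M P r).
Proof.
move=> gc fc; have e1 : p + (q + 1) = r + 1 by lia.
have e2 : p + 1 + q = r + 1 by lia.
rewrite /closed [LHS](ghomd_comp e erefl erefl _ e1 e2) [ghomd _ g]gc.
by rewrite [ghomd _ f]fc (mor0 (gcompBl _ _)) (mor0 (gcompBr _ _)) mul0rz addr0.
Qed.

Lemma gcomp_boundingr (g : ghom N P q) (f : ghom M N p) :
  closed (g : homC N P q) -> bounding (f : homC M N p) ->
  bounding (gcomp e g f : homC M P r).
Proof.
move=> gc /(boundingP (subrK 1 p))[h dh].
have e0 : p - 1 + q = r - 1 by lia.
have e1 : p - 1 + (q + 1) = r by lia.
exists (r - 1), (subrK 1 r), (gcomp e0 g h *~ ksign q).
rewrite [LHS](morMz (ghomdB _)) (ghomd_comp e0 (subrK 1 p) erefl _ e1 e).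
rewrite [ghomd _ g]gc (mor0 (gcompBl _ _)) add0r [ghomd _ h]dh.
by rewrite -mulrzA ksignM mulr1z.
Qed.

Lemma gcomp_boundingl (g : ghom N P q) (f : ghom M N p) :
  bounding (g : homC N P q) -> closed (f : homC M N p) ->
  bounding (gcomp e g f : homC M P r).
Proof.
move=> /(boundingP (subrK 1 q))[h dh] fc.
have e0 : p + (q - 1) = r - 1 by lia.
have e1 : p + 1 + (q - 1) = r by lia.
exists (r - 1), (subrK 1 r), (gcomp e0 h f).
rewrite [LHS](ghomd_comp e0 erefl (subrK 1 q) _ e e1).
by rewrite [ghomd _ f]fc (mor0 (gcompBr _ _)) mul0rz addr0 [ghomd _ h]dh.
Qed.
End ClosedComposition.

Lemma dghomP (A : dgring) (M N : dgmod A) (f g : dghom M N) :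
  (forall n (x : M n), cmapf f x = cmapf g x) -> f = g.
Proof.
case: f => [[f fB fd] fL]; case: g => [[g gB gd] gL] /= fg.
have {}fg : f = g by do 2! (apply: functional_extensionality_dep => ?);
  exact: fg.
subst g; rewrite (Prop_irrelevance fB gB) in fd fL *.
rewrite (Prop_irrelevance fd gd) in fL *.
by rewrite (Prop_irrelevance fL gL).
Qed.

Section Product.
Variables (A : dgring) (M N : dgmod A).

Definition prod_cpx : cpx.
Proof.
refine (@Cpx (fun n => prod (M n) (N n) : zmodType)
  (fun i j e z => (cd e z.1, cd e z.2)) _ _).
- by move=> i j e x y; apply: pair_eq; exact: cdB.
- by move=> i j k e e' x; apply: pair_eq; exact: cdd.
Defined.

Definition dgprod : dgmod A.
Proof.
refine (@DGMod A prod_cpx (fun i j k e a z => (act e a z.1, act e a z.2))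
  _ _ _ _ _).
- by move=> i j k e m a b; apply: pair_eq; exact: actBl.
- by move=> i j k e m a b; apply: pair_eq; exact: actBr.
- by move=> *; apply: pair_eq; exact: actA.
- by move=> *; apply: pair_eq; exact: act1.
- move=> i j k i' j' k' e ei ej ek el er a m.
  by apply: pair_eq; rewrite /= ?fstMz ?sndMz; exact: actd.
Defined.

Definition prod_fst : dghom dgprod M :=
  @DGHom A dgprod M (@CMap dgprod M (fun n z => z.1)
    (fun _ _ _ => erefl) (fun _ _ _ _ => erefl)) (fun _ _ _ _ _ _ => erefl).

Section IntoProduct.
Variables (P : dgmod A) (f : dghom P M) (g : dghom P N).

Program Definition into_prod : dghom P dgprod :=
  @DGHom A P dgprod (@CMap P dgprod (fun n x => (cmapf f x, cmapf g x)) _ _) _.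
Next Obligation. by move=> n x y; apply: pair_eq; exact: cmapB. Qed.
Next Obligation. by move=> i j e x; apply: pair_eq; exact: cmapd. Qed.
Next Obligation. by move=> i j k e a x; apply: pair_eq; exact: dghL. Qed.
End IntoProduct.

Section FromProduct.
Variables (P : dgmod A) (f : dghom M P) (g : dghom N P).

Program Definition from_prod : dghom dgprod P :=
  @DGHom A dgprod P
    (@CMap dgprod P (fun n z => cmapf f z.1 + cmapf g z.2) _ _) _.
Next Obligation. by move=> n x y; rewrite /= !cmapB opprD addrACA. Qed.
Next Obligation. by move=> i j e x; rewrite /= !cmapd (morD (cdB _)). Qed.
Next Obligation. by move=> i j k e a x;
  rewrite /= !dghL (morD (actBr _ _)). Qed.
End FromProduct.

Lemma prod_fst_quasi_iso : acyclic N -> quasi_iso prod_fst.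
Proof.
move=> /acyclicP aN; apply/quasi_isoP; split=> n.
  move=> [x y] [xc yc] [k [e [v /= dv]]].
  have [w dw] := boundingP e (aN _ _ yc).
  by exists k, e, (v, w); apply: pair_eq.
move=> x xc; exists (x, 0); last by rewrite subrr; exact: bounding0.
by apply: pair_eq => //; exact: closed0.
Qed.
End Product.

Lemma quasi_iso_id (A : dgring) (M : dgmod A) : quasi_iso (dgid M).
Proof.
apply/quasi_isoP; split=> n x xc //.
by exists x => //; rewrite subrr; exact: bounding0.
Qed.

Section DerivedCategory.
Variable A : dgring.
Implicit Types M N P : dgmod A.

Lemma Deq_of_comp M N P (f : dghom M N) (g : dghom N P) (h : dghom M P) :
  (forall n (x : M n), cmapf h x = cmapf g (cmapf f x)) ->
  Deq (Dof h) (Dcomp (Dof g) (Dof f)).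
Proof.
move=> hE; rewrite (dghomP (f := h) (g := dgcomp g f)) //.
exact/Deq_sym/Deq_of.
Qed.

Lemma Deq_compl M N P (f : Dhom M N) (g g' : Dhom N P) :
  Deq g g' -> Deq (Dcomp g f) (Dcomp g' f).
Proof. by move=> gg'; apply: Deq_comp => //; exact: Deq_refl. Qed.

Lemma Deq_compr M N P (f f' : Dhom M N) (g : Dhom N P) :
  Deq f f' -> Deq (Dcomp g f) (Dcomp g f').
Proof. by move=> ff'; apply: Deq_comp => //; exact: Deq_refl. Qed.

Lemma Deq_cancell M N P (s : dghom N P) (hs : quasi_iso s) (f g : Dhom M N) :
  Deq (Dcomp (Dof s) f) (Dcomp (Dof s) g) -> Deq f g.
Proof.
have E (h : Dhom M N) : Deq (Dcomp (Dinv hs) (Dcomp (Dof s) h)) h.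
  apply: Deq_trans (Deq_assoc _ _ _) _.
  by apply: Deq_trans (Deq_compl h (Deq_invl hs)) _; exact: Deq_idl.
move=> sfg.
exact: (Deq_trans (Deq_sym (E f)) (Deq_trans (Deq_compr (Dinv hs) sfg) (E g))).
Qed.

Lemma Deq_cancelr M N P (s : dghom M N) (hs : quasi_iso s) (f g : Dhom N P) :
  Deq (Dcomp f (Dof s)) (Dcomp g (Dof s)) -> Deq f g.
Proof.
have E (h : Dhom N P) : Deq (Dcomp (Dcomp h (Dof s)) (Dinv hs)) h.
  apply: Deq_trans (Deq_sym (Deq_assoc _ _ _)) _.
  by apply: Deq_trans (Deq_compr h (Deq_invr hs)) _; exact: Deq_idr.
move=> fgs.
exact: (Deq_trans (Deq_sym (E f)) (Deq_trans (Deq_compl (Dinv hs) fgs) (E g))).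
Qed.

(** Let [C] be the fiber of the identity of [N], which is acyclic. A homotopy
    from [g] to [f] is a map [t] from [M] to [N + C] whose composites with the
    maps [q0 (x, c) = x] and [q1 (x, c) = x + c] to [N] are [g] and [f]. Both
    [q0] and [q1] are inverse, in the derived category, to the inclusion of
    [N]. *)
Lemma Deq_homotopic M N (f g : dghom M N) :
  bounding (gof f - gof g : homC M N 0) -> Deq (Dof f) (Dof g).
Proof.
move=> /(boundingP (addNr 1))[h dh].
have dc : ghomd (add0r 1) (gof f - gof g) = 0.
  by rewrite ghomdB !gof_closed subrr.
pose d := dghom_of dc.
have dd (e : -1 + 1 = 0 :> int) (e' : 0 + 0 = 0 :> int) :
    ghomd e h = gcomp e' (gof (dgid N)) (gof d).
  by rewrite gcomp_idl gof_dghom_of -dh; congr ghomd; exact: eq_irrelevance.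
pose C := fib (dgid N).
pose t := into_prod g (fib_pair dd : dghom M C).
pose q0 := @prod_fst A N C.
pose q1 := from_prod (dgid N) (fib_proj (dgid N) : dghom C N).
have q01 : Deq (Dof q0) (Dof q1).
  pose i := into_prod (dgid N) (zero_map N C).
  have hq : quasi_iso q0 by apply/prod_fst_quasi_iso/fib_acyclic/quasi_iso_id.
  have iq : Deq (Dcomp (Dof i) (Dof q0)) (Did _).
    apply: (Deq_cancell hq); apply: Deq_trans (Deq_assoc _ _ _) _.
    apply: Deq_trans _ (Deq_sym (Deq_idr _)).
    apply: Deq_trans _ (Deq_idl _); apply: Deq_compl; apply: Deq_sym.
    exact: Deq_of_comp.
  apply: Deq_sym; apply: Deq_trans (Deq_sym (Deq_idr _)) _.
  apply: Deq_trans (Deq_compr _ (Deq_sym iq)) _.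
  apply: Deq_trans (Deq_assoc _ _ _) _.
  apply: Deq_trans _ (Deq_idl _); apply: Deq_compl; apply: Deq_sym.
  by apply: Deq_of_comp => n x; rewrite /= addr0.
have fE : Deq (Dof f) (Dcomp (Dof q1) (Dof t)).
  apply: Deq_of_comp => n x; apply/esym.
  transitivity (cmapf g x + ghf (gof f - gof g) (addr0 n) x) => //.
  by rewrite ghomBE !gofE addrC subrK.
apply: Deq_trans fE _; apply: Deq_trans (Deq_compl _ (Deq_sym q01)) _.
by apply: Deq_sym; exact: Deq_of_comp.
Qed.

(** The inverse of a quasi-isomorphism [s], followed by a map [g] into [K], is
    represented by an extension of [g] along [s], which exists up to
    homotopy. *)
Lemma Deq_of_Kinj M N (K : dgmod A) (w : Dhom M N) (g : dghom N K) :
  K_injective K -> exists h : dghom M K, Deq (Dcomp (Dof g) w) (Dof h).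
Proof.
move=> hK; elim: w g => {M N} [M N f g|M N s hs g|M N P w1 IH1 w2 IH2 g].
- by exists (dgcomp g f); exact: Deq_of.
- have [h hc hb] := Kinj_lift hK hs (add0r 0) (gof_closed g erefl).
  pose h' := dghom_of (closed_cd hc (add0r 1)).
  exists h'; apply: (Deq_cancelr hs).
  apply: Deq_trans (Deq_sym (Deq_assoc _ _ _)) _.
  apply: Deq_trans (Deq_compr _ (Deq_invl hs)) _.
  apply: Deq_trans (Deq_idr _) _.
  apply: Deq_trans (Deq_homotopic _) (Deq_sym (Deq_of _ _)).
  by rewrite (gof_comp (add0r 0)) gof_dghom_of.
- have [h gh] := IH1 g; have [h' hh'] := IH2 h; exists h'.
  apply: Deq_trans (Deq_assoc _ _ _) _.
  by apply: Deq_trans (Deq_compl _ gh) hh'.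
Qed.

Lemma Dhom_Kinj M (K : dgmod A) (w : Dhom M K) : K_injective K ->
  exists h : dghom M K, Deq w (Dof h).
Proof.
move=> hK; have [h wh] := Deq_of_Kinj w (dgid K) hK; exists h.
exact: Deq_trans (Deq_sym (Deq_idl w)) wh.
Qed.
End DerivedCategory.

Section CohomologyFunctors.
Variable A : dgring.
Implicit Types M N P : dgmod A.

Lemma xget_inv (T : choiceType) (U : Type) (f : T -> U) (x0 : T) (y : U) :
  bijective f -> f (xget x0 [set x | f x = y]) = y.
Proof.
move=> [g _ gK]; apply: (xgetPex x0 (P := [set x | f x = y])).
by exists (g y).
Qed.

Lemma xget_invK (T : choiceType) (U : Type) (f : T -> U) (x0 : T) (x : T) :
  bijective f -> xget x0 [set x' | f x' = f x] = x.
Proof. by move=> fb; apply: (bij_inj fb); exact: xget_inv. Qed.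

Lemma DH_comp M N P (f : dghom M N) (g : dghom N P) n (x : Hm M n) :
  cohmap (dgcomp g f) x = cohmap g (cohmap f x).
Proof.
by elim/coh_ind: x => x xc; rewrite !cohmap_cl; congr cohcl; exact: val_inj.
Qed.

Lemma cohmap_id M n (x : Hm M n) : cohmap (dgid M) x = x.
Proof.
by elim/coh_ind: x => x xc; rewrite cohmap_cl; congr cohcl; exact: val_inj.
Qed.

Lemma DH_Deq n M N (f g : Dhom M N) : Deq f g ->
  forall x : Hm M n, DH f x = DH g x.
Proof.
elim=> {M N f g} //=.
- by move=> M N f g h _ fg _ gh x; rewrite fg gh.
- by move=> M N P f f' g g' _ gg' _ ff' x; rewrite ff' gg'.
- by move=> M N f x; exact: cohmap_id.
- by move=> M N f x; rewrite cohmap_id.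
- by move=> M N P f g x; rewrite DH_comp.
- by move=> M N s hs x; rewrite xget_invK ?cohmap_id.
- by move=> M N s hs x; rewrite xget_inv ?cohmap_id.
Qed.

Variable I : dgmod A.
Let K := Kinj I.

Lemma precomp_bij M N (s : dghom M N) i : quasi_iso s ->
  bijective (@cohmap _ _ (precomp K s) i).
Proof.
by move=> hs; apply: precomp_quasi_iso => //; exact: Kinj_K_injective.
Qed.

Lemma precomp_cohmap_comp M N P (f : dghom M N) (g : dghom N P) n
    (x : coh (homC P K) n) :
  cohmap (precomp K (dgcomp g f)) x
  = cohmap (precomp K f) (cohmap (precomp K g) x).
Proof.
elim/coh_ind: x => x xc; rewrite !cohmap_cl; congr cohcl; apply: val_inj.
exact: ghomP.
Qed.

Lemma precomp_cohmap_id M n (x : coh (homC M K) n) :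
  cohmap (precomp K (dgid M)) x = x.
Proof.
elim/coh_ind: x => x xc; rewrite cohmap_cl; congr cohcl; apply: val_inj.
exact: ghomP.
Qed.

Lemma DExt_Deq i M N (f g : Dhom M N) : Deq f g ->
  forall x : Ext i N I, DExt f x = DExt g x.
Proof.
elim=> {M N f g} //=.
- by move=> M N f g h _ fg _ gh x; rewrite fg gh.
- by move=> M N P f f' g g' _ gg' _ ff' x; rewrite ff' gg'.
- by move=> M N f x; rewrite precomp_cohmap_id.
- by move=> M N f x; exact: precomp_cohmap_id.
- by move=> M N P f g x; rewrite precomp_cohmap_comp.
- move=> M N s hs x; rewrite precomp_cohmap_id.
  by apply: xget_inv; exact: precomp_bij.
- move=> M N s hs x; rewrite precomp_cohmap_id.
  by apply: xget_invK; exact: precomp_bij.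
Qed.
End CohomologyFunctors.

(** Equal morphisms act equally on Ext. Evaluated at the class of the
    resolution [K -> Kinj K], this says that [f] and [g] become homotopic
    after composition with it; and it has a left homotopy inverse, because [K]
    is K-injective. *)
Lemma Deq_homotopic_Kinj (A : dgring) (M K : dgmod A) (f g : dghom M K) :
  K_injective K -> Deq (Dof f) (Dof g) ->
  bounding (gof f - gof g : homC M K 0).
Proof.
move=> hK fg; pose r := Kinj_map K.
have [t tc tr] := Kinj_lift hK (Kinj_map_quasi_iso K) (add0r 0)
  (gof_closed (dgid K) erefl).
have rc : closed (gof r : homC K (Kinj K) 0) := gof_closed r erefl.
have := DExt_Deq (I := K) fg (cohcl (mkcoc rc) : Ext 0 K K).
rewrite /= !cohmap_cl => /cohcl_eq.
rewrite -[cocv (coc_map (precomp _ f) _)]/(cmapf (precomp (Kinj K) f) (gof r)).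
rewrite -[cocv (coc_map (precomp _ g) _)]/(cmapf (precomp (Kinj K) g) (gof r)).
rewrite !(precompE _ (addr0 0)) -(gcompBr (addr0 0) (gof r)) => rfg.
have fgc : closed (gof f - gof g : homC M K 0).
  by apply: closedB; exact: gof_closed.
have := gcomp_boundingl (addr0 0) tr fgc.
have := gcomp_boundingr (addr0 0) tc rfg.
rewrite (gcompBl (addr0 0)) gcomp_idl (gcompA _ _ (add0r 0) (addr0 0)) => b1 b2.
by have := boundingD b2 b1; rewrite subrK.
Qed.

(** * Truncations *)

Lemma ghomd_gofr (A : dgring) (M N P : dgmod A) (n n' : int) (en : n + 1 = n')
    (f : ghom N P n) (u : dghom M N) :
  ghomd en (gcomp (add0r n) f (gof u)) = gcomp (add0r n') (ghomd en f) (gof u).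
Proof.
have e : 1 + n = n' by rewrite addrC.
rewrite (ghomd_comp _ (add0r 1) en _ (add0r n') e) gof_closed.
by rewrite (mor0 (gcompBr _ _)) mul0rz addr0.
Qed.

Section Truncation.
Variables (A : dgring) (hA : nonpositive A) (M : dgmod A) (k : int).

Definition in_trunc n (x : M n) : bool :=
  ((k <= n) ==> (cd (erefl (n + 1)) x == 0)) && ((k < n) ==> (x == 0)).

Lemma in_trunc_zmod_closed n : zmod_closed (@in_trunc n).
Proof.
split=> [|x y]; rewrite !unfold_in /in_trunc.
  by rewrite (mor0 (cdB _)) !eqxx !implybT.
move=> /andP[/implyP x1 /implyP x2] /andP[/implyP y1 /implyP y2].
apply/andP; split; apply/implyP => kn.
  by rewrite cdB (eqP (x1 kn)) (eqP (y1 kn)) subrr.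
by rewrite (eqP (x2 kn)) (eqP (y2 kn)) subrr.
Qed.
HB.instance Definition _ n :=
  GRing.isZmodClosed.Build (M n) (@in_trunc n) (in_trunc_zmod_closed n).

Record trunc_el n := TruncEl { trv :> M n; trP : in_trunc trv }.
HB.instance Definition _ n := [isSub for @trv n].
HB.instance Definition _ n := [Choice of trunc_el n by <:].
HB.instance Definition _ n := [SubChoice_isSubZmodule of trunc_el n by <:].

Lemma in_truncP n (x : M n) :
  reflect ((k <= n -> closed x) /\ (k < n -> x = 0)) (in_trunc x).
Proof.
apply: (iffP andP) => -[x1 x2]; split.
- by move=> kn; apply/eqP; move/implyP: x1; apply.
- by move=> kn; apply/eqP; move/implyP: x2; apply.
- by apply/implyP => kn; apply/eqP/x1.
- by apply/implyP => kn; apply/eqP/x2.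
Qed.

Lemma in_trunc_lt n (x : M n) : n < k -> in_trunc x.
Proof. by move=> nk; apply/in_truncP; split=> kn; lia. Qed.

Lemma in_trunc_closed n (x : M n) : n <= k -> closed x -> in_trunc x.
Proof. by move=> nk xc; apply/in_truncP; split=> // kn; lia. Qed.

Lemma in_trunc_cd i j (e : i + 1 = j) (x : trunc_el i) :
  in_trunc (cd e (trv x)).
Proof.
have /in_truncP[x1 x2] := trP x; apply/in_truncP; split=> kj.
  exact: cdd.
by rewrite (closed_cd (x1 _)) //; lia.
Qed.

Lemma in_trunc_act i j l (e : i + j = l) (a : A i) (x : trunc_el j) :
  in_trunc (act e a (trv x)).
Proof.
have /in_truncP[x1 x2] := trP x; have [i0|i0] := ltP 0 i.
  by rewrite (hA i0 a) (mor0 (actBl _ _)); exact: (in_trunc_zmod_closed l).1.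
have e1 : i + 1 + j = l + 1 by lia.
have e2 : i + (j + 1) = l + 1 by lia.
apply/in_truncP; split=> kl; last by rewrite x2 ?(mor0 (actBr _ _)) //; lia.
have dx : cd (erefl (j + 1)) (trv x) = 0 by apply: x1; lia.
rewrite /closed (actd e erefl erefl _ e1 e2) dx.
rewrite (mor0 (actBr _ _)) mul0rz addr0.
have [il|il] := ltP i 0; last first.
  have i1 : 0 < i + 1 by lia.
  by rewrite (hA i1 (cd _ a)) (mor0 (actBl _ _)).
by rewrite x2 ?(mor0 (actBr _ _)) //; lia.
Qed.

Lemma trunc_eq n (x y : trunc_el n) : trv x = trv y -> x = y.
Proof. exact: val_inj. Qed.

Lemma trvB n : zmod_morphism (@trv n). Proof. by []. Qed.

Definition trunc_cpx : cpx.
Proof.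
refine (@Cpx (fun n => trunc_el n : zmodType)
  (fun i j e x => TruncEl (in_trunc_cd e x)) _ _).
- by move=> i j e x y; apply: trunc_eq; exact: cdB.
- by move=> i j l e e' x; apply: trunc_eq; exact: cdd.
Defined.

(** The smart truncation in degrees at most [k]. It is a submodule because [A]
    has no elements of positive degree. *)
Definition trunc : dgmod A.
Proof.
refine (@DGMod A trunc_cpx (fun i j l e a x => TruncEl (in_trunc_act e a x))
  _ _ _ _ _).
- by move=> i j l e m a b; apply: trunc_eq; exact: actBl.
- by move=> i j l e m a b; apply: trunc_eq; exact: actBr.
- by move=> *; apply: trunc_eq; exact: actA.
- by move=> *; apply: trunc_eq; exact: act1.
- move=> i j l i' j' l' e ei ej el' el er a m; apply: trunc_eq.
  rewrite [LHS](actd _ ei ej _ el er) [RHS](morD (@trvB _)).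
  by rewrite (morMz (@trvB _)).
Defined.

Definition trunc_incl : dghom trunc M :=
  @DGHom A trunc M (@CMap trunc M (fun n x => trv x)
    (fun n => @trvB n) (fun _ _ _ _ => erefl)) (fun _ _ _ _ _ _ => erefl).

Lemma trunc_closedP n (x : trunc n) : closed x <-> closed (trv x).
Proof. by split=> [xc|xc]; [exact: (congr1 (@trv _) xc)|exact: trunc_eq]. Qed.

Lemma trunc_gt n (x : trunc n) : k < n -> x = 0.
Proof. by move=> kn; apply: trunc_eq; have /in_truncP[_] := trP x; exact. Qed.

Lemma trunc_bounding n (x : trunc n) : bounding (trv x) -> bounding x.
Proof.
have [kn|nk] := ltP k n.
  by rewrite (trunc_gt x kn) => _; exact: bounding0.
move=> [j [e [y dy]]]; have jk : j < k by lia.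
by exists j, e, (TruncEl (in_trunc_lt y jk)); exact: trunc_eq.
Qed.

Lemma trunc_incl_quasi_iso :
  (forall n, k < n -> forall x : M n, closed x -> bounding x) ->
  quasi_iso trunc_incl.
Proof.
move=> Mk; apply/quasi_isoP; split=> n x xc; first exact: trunc_bounding.
have [kn|nk] := ltP k n.
  exists 0; first exact: closed0.
  by rewrite sub0r; apply/boundingN/Mk.
exists (TruncEl (in_trunc_closed nk xc) : trunc n); first exact/trunc_closedP.
by rewrite subrr; exact: bounding0.
Qed.
End Truncation.

Section TruncationMap.
Variables (A : dgring) (hA : nonpositive A) (M : dgmod A) (k l : int).
Hypothesis kl : k <= l.

Lemma in_trunc_le n (x : trunc_el M k n) : in_trunc l (trv x).
Proof.
have /in_truncP[x1 x2] := trP x.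
by apply/in_truncP; split=> ln; [apply: x1|apply: x2]; lia.
Qed.

Program Definition trunc_map : dghom (trunc hA M k) (trunc hA M l) :=
  @DGHom A (trunc hA M k) (trunc hA M l) (@CMap (trunc hA M k) (trunc hA M l)
    (fun n x => TruncEl (in_trunc_le x)) _ _) _.
Next Obligation. by move=> n x y; exact: trunc_eq. Qed.
Next Obligation. by move=> i j e x; exact: trunc_eq. Qed.
Next Obligation. by move=> i j m e a x; exact: trunc_eq. Qed.

Lemma trunc_map_inj n : injective (cmapf trunc_map (n := n)).
Proof.
by move=> x y xy; apply: trunc_eq; exact: (congr1 (@trv _ _ _ _) xy).
Qed.
End TruncationMap.

Definition coh_only (C : cpx) (j : int) :=
  forall i, i <> j -> forall x : C i, closed x -> bounding x.

Section VanishingOnPositive.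
Variables (A : dgring) (hA : nonpositive A) (X : dgmod A).
Hypotheses (hX : K_injective X) (gX : graded_injective X).
Hypothesis vX : forall (Q : dgmod A) (j m : int), coh_only Q j -> 1 <= m + j ->
  forall f : homC Q X m, closed f -> bounding f.
Variable N : dgmod A.
Hypothesis N0 :
  forall i : int, i <= 0 -> forall x : N i, closed x -> bounding x.

Let tr (k : nat) := trunc hA N k%:Z.
Lemma succ_le (k : nat) : k%:Z <= k.+1%:Z. Proof. by lia. Qed.
Let up k : dghom (tr k) (tr k.+1) := trunc_map hA N (succ_le k).

(** The cohomology of the fiber is [H^(k+1) N], in degree [k + 2] because of
    the shift. *)
Lemma fib_up_coh_only k : coh_only (fib (up k)) (k%:Z + 2).
Proof.
move=> n nk; apply: fib_coh0.
  move=> y yc; have [kn|nk'] := ltP (k.+1%:Z) (n - 1).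
    exists 0; first exact: closed0.
    by rewrite (trunc_gt y kn) subr0 (mor0 (@cmapB _ _ (up k) _));
      exact: bounding0.
  have yt : in_trunc k%:Z (trv y).
    apply: in_trunc_closed; first by lia.
    exact: (trunc_closedP y).1.
  exists (TruncEl yt : tr k (n - 1)).
    by apply/trunc_closedP; exact: (trunc_closedP y).1.
  have -> : cmapf (up k) (TruncEl yt : tr k (n - 1)) = y by exact: trunc_eq.
  by rewrite subrr; exact: bounding0.
move=> x xc bx; apply: trunc_bounding.
by have := cmap_bounding (trunc_incl hA N k.+1%:Z) bx.
Qed.

(** A primitive of [f] is built on the truncations [tr k] of [N], starting
    from the acyclic [tr 0]. By [fib_extend], the step from [tr k] to
    [tr k.+1] is possible up to a boundary on [tr k], since the fiber of the
    inclusion has one cohomology group; as [X] is graded injective, the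
    boundary extends to [tr k.+1] and can be subtracted. The primitives being
    strictly compatible, they glue, because an element of degree [i] lies in
    [tr k] as soon as [i < k]. *)
Lemma null_on_positive (f : ghom N X 0) :
  closed (f : homC N X 0) -> bounding (f : homC N X 0).
Proof.
move=> fc.
pose P k (h : ghom (tr k) X (-1)) :=
  ghomd (addNr 1) h = gcomp (addr0 0) f (gof (trunc_incl hA N k%:Z)).
pose R k (h : ghom (tr k) X (-1)) (h' : ghom (tr k.+1) X (-1)) :=
  gcomp (add0r (-1)) h' (gof (up k)) = h.
have fic k : closed (gcomp (addr0 0) f (gof (trunc_incl hA N k)) : homC _ X 0).
  by apply: gcomp_closed => //; exact: gof_closed.
have [||h [hP hR]] := @tower_choice _ P R.
- have [|h dh] := boundingP (addNr 1) (Kinj_bounding hX _ (fic 0)).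
    apply/acyclicP => n x xc; have [n0|n0] := ltP 0 n.
      by rewrite (trunc_gt x n0); exact: bounding0.
    by apply: trunc_bounding; apply: N0 => //; exact/trunc_closedP.
  by exists h.
- move=> k h dh.
  have ui i := @trunc_map_inj A hA N _ _ (succ_le k) i.
  have up_incl : gcomp (addr0 0) (gof (trunc_incl hA N k.+1%:Z)) (gof (up k))
      = gof (trunc_incl hA N k%:Z).
    by rewrite -gof_comp; congr gof; exact: dghomP.
  have [||h1 [h2 [dh1 h1u]]] := fib_extend (u := up k) (n := -1) (n' := 0)
      (en := addNr 1) (e0 := addr0 0) (add0r (-1)) _ (fic k.+1) (h' := h).
  + by move=> T Tc; apply: (vX (@fib_up_coh_only k)) => //; lia.
  + by rewrite -(gcompA (addr0 0) (addr0 0)) up_incl.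
  have [h3 h3u] := gX ui (add0r (-1 - 1)) h2.
  exists (h1 + ghomd (subrK 1 (-1)) h3).
    by rewrite /P (morD (ghomdB _)) ghomdd addr0.
  rewrite /R (morD (gcompBl _ _)) h1u.
  by rewrite -ghomd_gofr h3u subrK.
have hS k i (x : tr k i) j (e : i - 1 = j) :
    ghf (h k.+1) e (cmapf (up k) x) = ghf (h k) e x.
  by rewrite -[in RHS](hR k) (gcompE _ _ _ e (addr0 i) e) gofE.
(* The value at [x] of the homotopy on any truncation that contains [x]. *)
pose H i (x : N i) (k : nat) (ik : i < k%:Z) : X (i - 1) :=
  ghf (h k) (erefl (i - 1)) (TruncEl (in_trunc_lt x ik) : tr k i).
have HS i x k (ik : i < k%:Z) l (il : i < l%:Z) : (k <= l)%N ->
  @H i x l il = H i x k ik.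
  elim: l il => [|l IHl] il kl.
    by have k0 : k = 0%N by [lia]; subst k; rewrite (bool_irrelevance il ik).
  have [kl'|lk] := leqP k l; last first.
    have k0 : k = l.+1 by lia.
    by subst k; rewrite (bool_irrelevance il ik).
  have il' : i < l%:Z by lia.
  rewrite -(IHl il' kl') /H -[RHS]hS.
  by rewrite (_ : cmapf (up l) _ = TruncEl (in_trunc_lt x il)) //;
    exact: trunc_eq.
have HE i x k (ik : i < k%:Z) l (il : i < l%:Z) : @H i x k ik = H i x l il.
  by have [kl|lk] := leqP k l;
    [rewrite (HS _ _ _ ik)|rewrite (HS _ _ _ il) // ltnW].
(* Any natural number greater than [i] would do. *)
pose K (i : int) := absz (i + 1).
have iK i : i < (K i)%:Z by rewrite /K; lia.
pose G i j (e : i - 1 = j) (x : N i) : X j := ctr e (H i x (K i) (iK i)).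
have GE i j (e : i - 1 = j) (x : N i) k (ik : i < k%:Z) :
    G i j e x = ghf (h k) e (TruncEl (in_trunc_lt x ik) : tr k i).
  by rewrite /G (HE _ _ _ _ _ ik) /H; exact: ctr_ghf.
have GB i j (e : i - 1 = j) : zmod_morphism (G i j e).
  move=> x y; rewrite !(GE _ _ _ _ _ (iK i)) -ghfB.
  rewrite (_ : _ - _ = (TruncEl (in_trunc_lt (x - y) (iK i)) : tr (K i) i)) //.
  exact: trunc_eq.
have GL p i j k l (e1 : p + i = k) (e2 : k - 1 = l) (e3 : i - 1 = j)
    (e4 : p + j = l) a m :
  G k l e2 (act e1 a m) = act e4 a (G i j e3 m) *~ ksign (-1 * p).
  have [p0|p0] := ltP 0 p.
    by rewrite (hA p0 a) !(mor0 (actBl _ _)) mul0rz (mor0 (@GB _ _ _)).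
  have kK : k < (K i)%:Z by have := iK i; lia.
  rewrite (GE _ _ e2 _ _ kK) (GE _ _ e3 _ _ (iK i)).
  rewrite -(ghfL (h (K i)) (e1 : p + i = k) e2 e3 e4).
  rewrite (_ : act e1 a (TruncEl (in_trunc_lt m (iK i)) : tr (K i) i)
    = (TruncEl (in_trunc_lt (act e1 a m) kK) : tr (K i) k)) //.
  exact: trunc_eq.
exists (-1), (addNr 1), (GHom GB GL); apply: ghomP => i j e x.
have f1 : i - 1 = j - 1 by lia.
have f2 : i + 1 - 1 = j by lia.
rewrite [LHS](ghomdE _ _ e erefl (subrK 1 j) f1 f2) /=.
have iK' : i < (K (i + 1))%:Z by have := iK (i + 1); lia.
rewrite (GE _ _ f1 _ _ iK') (GE _ _ f2 _ _ (iK (i + 1))).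
have := congr1 (fun g => ghf g e (TruncEl (in_trunc_lt x iK') : tr _ i))
  (hP (K (i + 1))).
rewrite (ghomdE _ _ e erefl (subrK 1 j) f1 f2).
rewrite (gcompE _ _ _ e (addr0 i) e) gofE /= => <-.
by rewrite (bool_irrelevance (in_trunc_cd (erefl (i + 1))
  (TruncEl (in_trunc_lt x iK'))) (in_trunc_lt _ (iK (i + 1)))).
Qed.
End VanishingOnPositive.

(** * Cofree modules and their retracts *)

Section ConcentratedGroup.
Variable D : zmodType.

Lemma conc_eq0 (i : int) (x : conc D i) : i <> 0 -> x = 0.
Proof. by case: i x => [[|i]|i] x // _; exact: ord1 x. Qed.

Lemma conc_injective : injective_group D ->
  forall i, injective_group (conc D i).
Proof.
move=> ID i; have [->|/eqP i0] := eqVneq i 0; first exact: ID.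
move=> U V u g _ _ _; exists (fun _ => 0); first exact: zmod_morphism0.
by move=> x; rewrite [g x]conc_eq0.
Qed.

(** An element of a concentrated group, given as a value under the assumption
    that the degree is 0. *)
Definition conc_at (i : int) : (i = 0 -> D) -> conc D i :=
  match i return (i = 0 -> D) -> conc D i with
  | Posz 0 => fun v => v erefl
  | _ => fun _ => 0
  end.

Lemma conc_atB i (v w : i = 0 -> D) :
  conc_at (fun e => v e - w e) = conc_at v - conc_at w.
Proof. by case: i v w => [[|i]|i] v w //=; rewrite subrr. Qed.

Lemma conc_at_eq0 i (v : i = 0 -> D) : (forall e, v e = 0) -> conc_at v = 0.
Proof. by case: i v => [[|i]|i] v //= ->. Qed.

Lemma conc_atE i (v : i = 0 -> D) (e : i = 0) :
  @ctr (gr_cpx (conc D)) _ _ e (conc_at v) = v e.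
Proof. by subst i; rewrite ctr_id /=; congr v; exact: eq_irrelevance. Qed.
End ConcentratedGroup.

Section Cofree.
Variables (A : dgring) (hA : nonpositive A) (D : zmodType).
Hypothesis ID : injective_group D.

(** The module [Hom_Z(A, D)], which represents the functor [Hom(H^0 M, D)] of
    [M] in the derived category. *)
Definition cofree : dgmod A := coind A (conc D).

Definition cofree_ev (v : cofree 0) : D := coind_ev v.

Lemma cofree_evB : zmod_morphism cofree_ev.
Proof. exact: coind_evB. Qed.

Lemma cofree_lt0 n (v : cofree n) : n < 0 -> v = 0.
Proof.
move=> n0; apply: ghomP => i j e b; have [j0|/eqP j0] := eqVneq j 0.
  have i0 : 0 < i by lia.
  by rewrite (hA i0 b) !(mor0 (ghfB _ _)).
by rewrite [LHS]conc_eq0 // [RHS]conc_eq0.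
Qed.

Lemma coind_ev_ctr (E : int -> zmodType) i j (e : i = j) (v : coind A E i) :
  coind_ev (ctr e v) = @ctr (gr_cpx E) _ _ e (coind_ev v).
Proof. by subst j; rewrite !ctr_id. Qed.

Lemma cofree_bounding (M : dgmod A) n (f : ghom M cofree n) :
  (forall z : M (- n), closed z -> cofree_ev (ghf f (addNr n) z) = 0) ->
  bounding (f : homC M cofree n).
Proof.
move=> fz; apply: coind_bounding => [|i z zc]; first exact: conc_injective.
have [e|/eqP in0] := eqVneq (i + n) 0; last exact: conc_eq0.
have e' : i = - n by lia.
have := fz (ctr e' z) (ctr_closed e' zc).
rewrite (ghf_ctr f e' (addNr n) e) -(ctr_ghf f e (erefl (i + n)) e).
rewrite /cofree_ev coind_ev_ctr.
by move: (coind_ev _) => v /(congr1 (@ctr (gr_cpx (conc D)) _ _ (esym e)));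
  rewrite (ctr_ctr _ _ erefl) ctr_id (mor0 (@ctrB (gr_cpx (conc D)) _ _ _)).
Qed.

Lemma cofree_represent (M : dgmod A) n (phi : cocycle M (- n) -> D) :
  zmod_morphism phi -> (forall z, bounding (cocv z) -> phi z = 0) ->
  exists2 f : ghom M cofree n, closed (f : homC M cofree n) &
    forall z : cocycle M (- n), cofree_ev (ghf f (addNr n) (cocv z)) = phi z.
Proof.
move=> phiB phi0.
have ei i : i + n = 0 -> i = - n by lia.
(* The family of maps required by [coind_represent] is [phi] in degree
   [- n]. *)
pose at_n i (z : cocycle M i) (e : i + n = 0) : cocycle M (- n) :=
  mkcoc (ctr_closed (ei i e) (cocycle_closed z)).
pose psi i (z : cocycle M i) : conc D (i + n) :=
  conc_at (fun e => phi (at_n i z e)).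
have psiB i : zmod_morphism (@psi i).
  move=> x y; rewrite /psi -conc_atB; congr conc_at; apply/funext => e.
  by rewrite -phiB; congr phi; apply: val_inj; exact: ctrB.
have psi0 i (z : cocycle M i) : bounding (cocv z) -> psi i z = 0.
  by move=> bz; apply: conc_at_eq0 => e; apply: phi0; exact/ctr_bounding.
have [f fc fz] := coind_represent (conc_injective ID) psiB psi0.
exists f => // z.
rewrite -(ctr_ghf f (addNr n) (erefl (- n + n))) /cofree_ev coind_ev_ctr fz.
rewrite /psi conc_atE; congr phi; apply: val_inj; exact: ctr_id.
Qed.
End Cofree.

Definition homotopy_retract (A : dgring) (K X : dgmod A) :=
  exists (f : dghom K X) (g : dghom X K),
    bounding (gof (dgid K) - gcomp (addr0 0) (gof g) (gof f) : homC K K 0).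

Lemma retract_reflects_bounding (A : dgring) (K X M : dgmod A) (f : dghom K X)
    (g : dghom X K) (n : int) (F : ghom M K n) :
  bounding (gof (dgid K) - gcomp (addr0 0) (gof g) (gof f) : homC K K 0) ->
  closed (F : homC M K n) ->
  bounding (gcomp (addr0 n) (gof f) F : homC M X n) ->
  bounding (F : homC M K n).
Proof.
move=> gf Fc fF; have b1 := gcomp_boundingl (addr0 n) gf Fc.
have b2 := gcomp_boundingr (addr0 n)
  (gof_closed g erefl : closed (gof g : homC _ _ 0)) fF.
have := boundingD b1 b2; rewrite gcompBl gcomp_idl.
by rewrite (gcompA _ _ (addr0 0) (addr0 n)) subrK.
Qed.

(** The property of a K-injective resolution of [I] to which all six
    conditions are reduced. *)
Definition cofree_retract (A : dgring) (K : dgmod A) :=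
  exists2 D : zmodType, injective_group D & homotopy_retract K (cofree A D).

(** The projection of the cocycles of degree 0 to [H^0 K], followed by an
    embedding of [H^0 K] into an injective group [D], is represented by a map
    to [cofree A D]. *)
Lemma cofree_embedding (A : dgring) (K : dgmod A) :
  exists (D : zmodType) (f : dghom K (cofree A D)), injective_group D /\
    forall z : K 0, closed z -> bounding (cmapf f z) -> bounding z.
Proof.
pose D : zmodType := bidual (coh K 0 : zmodType).
pose phi (z : cocycle K (- 0)) : D := to_bidual (cohcl (z : cocycle K 0)).
have ID : injective_group D by exact: bidual_injective.
have [||f fc fz] := @cofree_represent A D ID K 0 phi.
- by move=> x y; rewrite /phi cohclB to_bidualB.
- by move=> z bz; rewrite /phi (_ : cohcl _ = 0) ?(mor0 (@to_bidualB _)) //;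
  exact/cohcl_eq0.
exists D, (dghom_of (closed_cd fc (add0r 1))); split=> // z zc bz.
apply/(cohcl_eq0 (mkcoc zc))/to_bidual_eq0.
rewrite -[LHS]/(phi (mkcoc zc)) -fz.
have E : ghf f (addNr 0 : 0 + 0 = 0 :> int) z = ghf f (addr0 0) z.
  exact: ghf_eq.
by apply: coind_ev_bounding; move: bz; rewrite /= -E.
Qed.

Section RetractCriterion.
Variables (A : dgring) (hA : nonpositive A) (K : dgmod A) (hK : K_injective K).
Hypothesis K0 : forall n : int, n < 0 -> forall x : K n, closed x -> bounding x.
Hypothesis vK : forall (Q : dgmod A) (j m : int), coh_only Q j -> 1 <= m + j ->
  forall f : homC Q K m, closed f -> bounding f.

(** Let [j] be a map to a cofree module, injective on [H^0]. As [K] and the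
    cofree module have no cohomology in negative degrees, the fiber of [j] has
    cohomology in positive degrees only; hence its projection to [K] is
    null-homotopic, and [fib_factor] turns the null-homotopy into a retraction
    of [j]. The argument is carried out for a resolution [X] of [K] that is
    also graded injective. *)
Lemma cofree_retract_of_vanishing : cofree_retract K.
Proof.
have [X [r [hX gX hr]]] := K_injective_resolution_exists K.
have [t tc tr] := Kinj_lift hK hr (addr0 0) (gof_closed (dgid K) erefl).
have rt : bounding (gof (dgid X) - gcomp (addr0 0) (gof r) t : homC X X 0).
  apply: (Kinj_lift_bounding hX hr (e := addr0 0)).
    by apply: closedB; [|apply: gcomp_closed]; rewrite //; exact: gof_closed.
  have := gcomp_boundingr (addr0 0)
    (gof_closed r erefl : closed (gof r : homC _ _ 0)) tr.
  rewrite gcompBr gcompBl gcomp_idl gcomp_idr.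
  by rewrite (gcompA _ _ (addr0 0) (addr0 0)).
have vX (Q : dgmod A) (j m : int) : coh_only Q j -> 1 <= m + j ->
    forall f : homC Q X m, closed f -> bounding f.
  move=> Qj mj f fc.
  have b1 := gcomp_boundingl (addr0 m) rt fc.
  have tf : bounding (gcomp (addr0 m) t f : homC Q K m).
    by apply: (vK Qj mj); exact: gcomp_closed.
  have b2 := gcomp_boundingr (addr0 m)
    (gof_closed r erefl : closed (gof r : homC _ _ 0)) tf.
  have := boundingD b1 b2; rewrite gcompBl gcomp_idl.
  by rewrite (gcompA _ _ (addr0 0) (addr0 m)) subrK.
have [D [j [ID jz]]] := cofree_embedding X.
have X0 n : n < 0 -> forall x : X n, closed x -> bounding x.
  move=> n0 x xc; have /quasi_isoP[_ /(_ n x xc)[y yc yx]] := hr.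
  have := cmap_bounding r (K0 n0 yc) => /boundingB/(_ yx).
  by rewrite subKr.
have F0 i : i <= 0 -> forall z : fib j i, closed z -> bounding z.
  move=> i0; apply: fib_coh0 => [y yc|x xc bx].
    have y0 : y = 0 by apply: cofree_lt0 => //; lia.
    exists 0; first exact: closed0.
    by rewrite y0 subr0 (mor0 (@cmapB _ _ j _)); exact: bounding0.
  have [i1|i1] := ltP i 0; first exact: X0.
  have e : i = 0 by lia.
  by subst i; exact: jz.
have pb := null_on_positive hA hX gX vX F0 (gof_closed (fib_proj j) erefl).
have [|h hc hj] := @fib_factor A X (cofree A D) X j 0 (addr0 0) (gof (dgid X)).
  by rewrite gcomp_idl.
exists D => //.
have gc : closed (gcomp (addr0 0) t h : homC _ _ 0) by exact: gcomp_closed.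
exists (dgcomp j r), (dghom_of (closed_cd gc (add0r 1))).
rewrite gof_dghom_of (gof_comp (addr0 0)).
have rc : closed (gof r : homC _ _ 0) := gof_closed r erefl.
have b := gcomp_boundingr (addr0 0) tc (gcomp_boundingl (addr0 0) hj rc).
have := boundingD tr b; rewrite gcompBl gcompBr gcomp_idl addrA subrK.
by rewrite !(gcompA _ _ (addr0 0) (addr0 0)).
Qed.
End RetractCriterion.

(** * The canonical map to cohomology *)

Section Evaluation.
Variables (A : dgring) (M N : dgmod A) (n : int).

Lemma ghf_closed (F : ghom M N n) i j (e : i + n = j) (x : M i) :
  closed (F : homC M N n) -> closed x -> closed (ghf F e x).
Proof.
move=> Fc xc; have f1 : i + (n + 1) = j + 1 by lia.
have f2 : i + 1 + n = j + 1 by lia.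
have := congr1 (fun g : ghom M N _ => ghf g f1 x) Fc.
rewrite [LHS](ghomdE erefl F f1 erefl erefl e f2) xc (mor0 (ghfB _ _)).
by rewrite mul0rz subr0.
Qed.

Lemma ghf_boundingl (F : ghom M N n) i j (e : i + n = j) (x : M i) :
  bounding (F : homC M N n) -> closed x -> bounding (ghf F e x).
Proof.
move=> /(boundingP (subrK 1 n))[h dh] xc.
have f1 : i + (n - 1) = j - 1 by lia.
have f2 : i + 1 + (n - 1) = j by lia.
exists (j - 1), (subrK 1 j), (ghf h f1 x).
rewrite -dh [RHS](ghomdE _ h e erefl (subrK 1 j) f1 f2) xc.
by rewrite (mor0 (ghfB _ _)) mul0rz subr0.
Qed.

Lemma ghf_boundingr (F : ghom M N n) i j (e : i + n = j) (x : M i) :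
  closed (F : homC M N n) -> bounding x -> bounding (ghf F e x).
Proof.
move=> Fc /(boundingP (subrK 1 i))[y dy].
have f1 : i - 1 + (n + 1) = j by lia.
have f2 : i - 1 + n = j - 1 by lia.
have := congr1 (fun g : ghom M N _ => ghf g f1 y) Fc.
rewrite [LHS](ghomdE erefl F f1 (subrK 1 i) (subrK 1 j) f2 e) dy.
move=> /eqP; rewrite subr_eq0 => /eqP Fy.
exists (j - 1), (subrK 1 j), (ghf F f2 y *~ ksign n).
by rewrite (morMz (cdB _)) Fy -mulrzA ksignM mulr1z.
Qed.

Definition ev_coc (F : cocycle (homC M N) n) (z : cocycle M (- n)) :
  cocycle N 0 :=
  mkcoc (ghf_closed (addNr n) (cocycle_closed F) (cocycle_closed z)).

(** The canonical map from [Ext^n(M, N)] to [Hom(H^(-n) M, H^0 N)]. *)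
Definition ev_coh (x : coh (homC M N) n) (h : coh M (- n)) : coh N 0 :=
  cohcl (ev_coc (cohrep x) (cohrep h)).

Lemma ev_coh_cl F z : ev_coh (cohcl F) (cohcl z) = cohcl (ev_coc F z).
Proof.
have /cohcl_eq bF : cohcl (cohrep (cohcl F)) = cohcl F by exact: cohrepK.
have /cohcl_eq bz : cohcl (cohrep (cohcl z)) = cohcl z by exact: cohrepK.
apply/cohcl_eq; rewrite /= -[_ - _]
  (subrKA (ghf (cocv F) (addNr n) (cocv (cohrep (cohcl z))))).
apply: boundingD.
  exact: (ghf_boundingl (addNr n) bF (cocycle_closed _)).
by rewrite -ghfB; exact: (ghf_boundingr (addNr n) (cocycle_closed F) bz).
Qed.

Lemma ev_cohDl h : {morph ev_coh^~ h : x y / x + y}.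
Proof.
elim/coh_ind: h => z zc; elim/coh_ind => F Fc; elim/coh_ind => G Gc.
rewrite -(morD (@cohclB _ _)) !ev_coh_cl -(morD (@cohclB _ _)).
by congr cohcl; exact: val_inj.
Qed.

Lemma ev_cohZr (x : coh (homC M N) n) (a : H0 A) (h h' : Hm M (- n)) :
  ev_coh x (a *: h + h') = a *: (ev_coh x h : Hm N 0) + ev_coh x h'.
Proof.
move: x a h h'; elim/coh_ind => F Fc; elim/coh_ind => a ac.
elim/coh_ind => z zc; elim/coh_ind => w wc.
rewrite [_ *: _]H0act_cl -(morD (@cohclB _ _)) !ev_coh_cl.
rewrite [_ *: _]H0act_cl -(morD (@cohclB _ _)); congr cohcl; apply: val_inj.
rewrite /= (morD (ghfB F _)); congr (_ + _).
by rewrite (ghfL F _ _ (addNr n) (add0r 0)) mulr0.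
Qed.
End Evaluation.

Lemma ev_cohZl (A : dgring) (M N : dgmod A) n (a : H0 (center A))
    (x : Hm (homZ M N) n) (h : Hm M (- n)) :
  ev_coh (a *: x : Hm (homZ M N) n) h = H0center a *: (ev_coh x h : Hm N 0).
Proof.
move: a x h; elim/coh_ind => a ac; elim/coh_ind => F Fc; elim/coh_ind => z zc.
rewrite [_ *: _]H0act_cl /H0center cohmap_cl !ev_coh_cl [RHS]H0act_cl.
congr cohcl; apply: val_inj.
exact: (cact_funE (add0r n) _ _ (addNr n) (addNr n) (add0r 0)).
Qed.

Lemma cohmapZ (A : dgring) (M N : dgmod A) (f : dghom M N) n (a : H0 A)
    (x : Hm M n) : cohmap f (a *: x) = a *: (cohmap f x : Hm N n).
Proof.
move: a x; elim/coh_ind => a ac; elim/coh_ind => x xc.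
rewrite [_ *: _]H0act_cl !cohmap_cl [RHS]H0act_cl; congr cohcl; apply: val_inj.
exact: dghL.
Qed.

Lemma ev_coh_precomp (A : dgring) (M N K : dgmod A) (f : dghom M N) n
    (x : coh (homC N K) n) (h : Hm M (- n)) :
  ev_coh (cohmap (precomp K f) x) h = ev_coh x (cohmap f h).
Proof.
move: x h; elim/coh_ind => F Fc; elim/coh_ind => z zc.
by rewrite !cohmap_cl !ev_coh_cl; congr cohcl; exact: val_inj.
Qed.

Section RetractProperties.
Variables (A : dgring) (hA : nonpositive A) (D : zmodType).
Hypothesis ID : injective_group D.
Variables (K : dgmod A) (f : dghom K (cofree A D)) (g : dghom (cofree A D) K).
Hypothesis gf :
  bounding (gof (dgid K) - gcomp (addr0 0) (gof g) (gof f) : homC K K 0).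

Lemma retract_bounding n (x : K n) : closed x ->
  bounding (x - cmapf g (cmapf f x)).
Proof.
move=> xc; have := ghf_boundingl (addr0 n) gf xc.
by rewrite ghomBE (gcompE _ _ _ (addr0 n) (addr0 n) (addr0 n)) !gofE.
Qed.

Lemma retract_cohmap n (x : coh K n) : cohmap g (cohmap f x) = x.
Proof.
elim/coh_ind: x => x xc; rewrite !cohmap_cl; apply/cohcl_eq/bounding_sym.
exact: retract_bounding.
Qed.

Lemma retract_lt0 n : n < 0 -> forall x : K n, closed x -> bounding x.
Proof.
move=> n0 x xc; have := retract_bounding xc.
by rewrite (cofree_lt0 hA (cmapf f x)) // (mor0 (@cmapB _ _ g _)) subr0.
Qed.

(** The canonical map [ev_coh] is injective for cofree modules, by
    [cofree_bounding], and therefore for their retracts. *)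
Lemma retract_null (M : dgmod A) n (F : ghom M K n) :
  closed (F : homC M K n) ->
  (forall z : M (- n), closed z -> bounding (ghf F (addNr n) z)) ->
  bounding (F : homC M K n).
Proof.
move=> Fc Fz.
apply: (retract_reflects_bounding gf Fc); apply: cofree_bounding => // z zc.
rewrite (gcompE _ _ _ (addNr n) (addNr n) (addr0 0)) gofE.
by apply: coind_ev_bounding; apply: cmap_bounding; exact: Fz.
Qed.

(** The value of [v] at [b] is the value of [b v] at 1. *)
Lemma cofree_ext (v : cofree A D 0) :
  (forall b : A 0, cofree_ev (act (add0r 0) b v) = 0) -> v = 0.
Proof.
move=> bv; apply: ghomP => i j e b; have [j0|/eqP j0] := eqVneq j 0; last first.
  by rewrite [LHS]conc_eq0 // [RHS]conc_eq0.
have i0 : i = 0 by lia.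
move: i0 j0 e b => -> -> e b; rewrite -[RHS](bv b) /cofree_ev /coind_ev /=.
rewrite (bact_funE (add0r 0) b v (add0r 0) (add0r 0) e) dmul1l.
by rewrite mul0r mulr1z.
Qed.

(** The canonical map is also surjective. The additive map [phi] to [D],
    obtained from [theta] by applying [f] and evaluating at 1, is represented
    by some [G]. On cohomology, [G] and [f theta] agree after evaluation at 1;
    as [theta] is linear, they agree after multiplication with any [b] and
    evaluation at 1, so they are equal, and [g G] represents [theta]. *)
Lemma retract_represent (M : dgmod A) n (theta : Hm M (- n) -> Hm K 0) :
  linear theta -> exists x : coh (homC M K) n, forall h, ev_coh x h = theta h.
Proof.
move=> thetaL.
pose evH (x : Hm (cofree A D) 0) : D := cofree_ev (cocv (cohrep x)).
have evH_cl z : evH (cohcl z) = cofree_ev (cocv z).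
  have : bounding (cocv (cohrep (cohcl z)) - cocv z) by apply/cohcl_eq/cohrepK.
  by move/coind_ev_bounding => /eqP; rewrite coind_evB subr_eq0 => /eqP.
have evHB : zmod_morphism evH.
  by elim/coh_ind => x xc; elim/coh_ind => y yc; rewrite -cohclB !evH_cl.
have thetaB : zmod_morphism theta.
  by move=> x y; rewrite -[x - y]addrC -scaleN1r thetaL scaleN1r addrC.
pose phi (z : cocycle M (- n)) : D := evH (cohmap f (theta (cohcl z))).
have [||G Gc Gz] := @cofree_represent A D ID M n phi.
- by move=> x y; rewrite /phi cohclB thetaB cohmapB evHB.
- by move=> z /cohcl_eq0 z0; rewrite /phi z0 (mor0 thetaB)
    (mor0 (@cohmapB _ _ f 0)) (mor0 evHB).
have key z : cohcl (ev_coc (mkcoc Gc) z) = cohmap f (theta (cohcl z)).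
  rewrite -[RHS]cohrepK; set u := cohrep _; congr cohcl; apply: cocycle_eq.
  apply/eqP; rewrite -subr_eq0; apply/eqP/cofree_ext => b.
  have bc : closed b by apply: hA.
  rewrite actBr cofree_evB; apply/eqP; rewrite subr_eq0; apply/eqP.
  have := @ghfL A M (cofree A D) n G 0 (- n) 0 (- n) 0 (add0r (- n)) (addNr n)
    (addNr n) (add0r 0) b (cocv z).
  rewrite mulr0 ksign0 mulr1z => E.
  rewrite -[cocv (ev_coc _ _)]/(ghf G (addNr n) (cocv z)) -E.
  rewrite -[act _ b _]/(cocv (coc_act (mkcoc bc) z)) Gz.
  rewrite /phi -[cohcl (coc_act _ _)]H0act_cl.
  have thetaZ a h : theta (a *: h) = a *: theta h.
    by have := thetaL a h 0; rewrite addr0 (mor0 thetaB) addr0.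
  rewrite -[H0act _ _]/((cohcl (mkcoc bc) : H0 A) *: (cohcl z : Hm M (- n))).
  rewrite thetaZ cohmapZ -(cohrepK (cohmap f (theta (cohcl z)))) -/u.
  by rewrite [_ *: _]H0act_cl evH_cl.
have gGc : closed (gcomp (addr0 n) (gof g) G : homC M K n).
  by apply: gcomp_closed => //; exact: gof_closed.
exists (cohcl (mkcoc gGc)); elim/coh_ind => z zc.
rewrite ev_coh_cl -[RHS]retract_cohmap -key cohmap_cl; congr cohcl.
apply: cocycle_eq.
rewrite -[LHS]/(ghf (gcomp (addr0 n) (gof g) G) (addNr n) z).
by rewrite (gcompE _ _ _ (addNr n) (addNr n) (addr0 0)) gofE.
Qed.
End RetractProperties.

(** * Infima and injective dimension *)

Section Infimum.
Implicit Types (S : set int) (m n : int).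

Lemma infZ_lower S (y : \bar int) : (forall n, S n -> (y <= n%:E)%E) ->
  (y <= infZ S)%E.
Proof.
move=> yS; rewrite /infZ /infimum; case: ifPn => [_|_]; first exact: leey.
case: xgetP => [x _ [_ xub]|]; last by move=> _; exact: leey.
by apply: xub => _ [n Sn <-]; exact: yS.
Qed.

Lemma infZ_min S m : S m -> (forall n, S n -> m <= n) -> infZ S = m%:E.
Proof.
move=> Sm mS; apply: le_anti; apply/andP; split; last first.
  by apply: infZ_lower => n Sn; rewrite lee_fin; exact: mS.
rewrite /infZ /infimum ifN; last by apply/set0P; exists m%:E, m.
case: xgetP => [x _ [xlb _]|noinf]; first by apply: xlb; exists m.
exfalso; apply: (noinf m%:E); split=> [_ [n Sn <-]|y ylb].
  by rewrite lee_fin; exact: mS.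
by apply: ylb; exists m.
Qed.

(** A set of integers that is bounded below has a minimum; otherwise the
    infimum is [-oo]. *)
Lemma infZ_upper S n : S n -> (infZ S <= n%:E)%E.
Proof.
move=> Sn; have [[b bS]|unb] := pselect (exists b, forall k, S k -> b <= k).
  have [k0 [k0P kmin]] : exists k : nat, S (b + k%:Z) /\
      forall l : nat, S (b + l%:Z) -> (k <= l)%N.
    have ex : exists k : nat, `[< S (b + k%:Z) >].
      exists `|n - b|%N; apply/asboolP; have := bS n Sn => bn.
      by have -> : b + `|n - b|%N = n by lia.
    case: (ex_minnP ex) => k /asboolP Sk kmin; exists k; split=> // l Sl.
    by apply: kmin; exact/asboolP.
  rewrite (@infZ_min S (b + k0)) // => [|m Sm].
    rewrite lee_fin; have := bS n Sn => bn.
    have := kmin `|n - b|%N; have -> : b + `|n - b|%N = n by lia.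
    by move=> /(_ Sn); lia.
  have := bS m Sm => bm.
  have := kmin `|m - b|%N; have -> : b + `|m - b|%N = m by lia.
  by move=> /(_ Sm); lia.
rewrite /infZ /infimum ifN; last by apply/set0P; exists n%:E, n.
case: xgetP => [x _ [xlb _]|noinf]; first by apply: xlb; exists n.
exfalso; apply: (noinf -oo%E); split=> [y _|y ylb]; first exact: leNye.
case: y ylb => [b bS| |] //.
- exfalso; apply: unb; exists b => k Sk.
  by have := bS k%:E (ex_intro2 _ _ k Sk erefl); rewrite lee_fin.
- by move=> /(_ n%:E (ex_intro2 _ _ n Sn erefl)).
Qed.

Lemma infZ_eq0 S : infZ S = 0%:E -> S 0 /\ forall n, S n -> 0 <= n.
Proof.
move=> S0; have lb n : S n -> 0 <= n.
  by move=> /infZ_upper; rewrite S0 lee_fin.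
split=> //; apply: contrapT => nS0.
have : ((1 : int)%:E <= infZ S)%E.
  apply: infZ_lower => n Sn; rewrite lee_fin; have := lb n Sn.
  by rewrite le_eqVlt => /orP[/eqP n0|//]; rewrite n0 in nS0.
by rewrite S0 lee_fin.
Qed.
End Infimum.

Lemma ereal_subl_lt (n j m : int) (y : \bar int) : (j%:E <= y)%E -> n - j < m ->
  (n%:E - y < m%:E)%E.
Proof.
case: y => [q| |] //; last by move=> _ _; rewrite /= addeNy ltNyr.
by rewrite lee_fin -EFinB lte_fin => jq njm; lia.
Qed.

Lemma ereal_subl_ltP (i : int) (y : \bar int) : (0%:E - y < i%:E)%E ->
  ((- i)%:E < y)%E.
Proof.
case: y => [q| |] //; last by move=> _; exact: ltry.
by rewrite -EFinB !lte_fin; lia.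
Qed.

Section Dimension.
Variable A : dgring.
Implicit Types M N : dgmod A.

Lemma infH_ge M (j : int) :
  (forall n, n < j -> forall x : M n, closed x -> bounding x) ->
  (j%:E <= infH M)%E.
Proof.
move=> Mj; apply: infZ_lower => n [x x0]; rewrite lee_fin leNgt.
by apply/negP => nj; apply: x0; move: x; apply/coh_zeroP; exact: Mj.
Qed.

Lemma infH_lt M (n : int) : (n%:E < infH M)%E ->
  forall x : M n, closed x -> bounding x.
Proof.
move=> nM; apply/coh_zeroP => x; apply: contrapT => x0.
have := @infZ_upper [set n | exists x : Hm M n, x <> 0] n (ex_intro _ x x0).
by rewrite leNgt -/(infH M) nM.
Qed.
End Dimension.

Section TheoremDim.
Variables (A : dgring) (hA : nonpositive A) (I : dgmod A).
Let K := Kinj I.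
Let r : dghom I K := Kinj_map I.
Let hK : K_injective K := @Kinj_K_injective A I.
Let hr : quasi_iso r := @Kinj_map_quasi_iso A I.

Lemma Kinj_coh0 n : (forall x : I n, closed x -> bounding x) <->
  (forall x : K n, closed x -> bounding x).
Proof.
have [ri rs] := (quasi_isoP r).1 hr; split=> H x xc.
  have [y yc yx] := rs n x xc.
  by have := boundingB (cmap_bounding r (H y yc)) yx; rewrite subKr.
by apply: ri => //; apply: H; exact: cmap_closed.
Qed.

Lemma dgzero_coh n (x : Hm (dgzero A) n) : x = 0.
Proof.
elim/coh_ind: x => x xc; apply/cohcl_eq0.
by have -> : x = 0 by [exact: (ord1 (x : 'I_1))]; exact: bounding0.
Qed.

Lemma Diso_zero_acyclic (M : dgmod A) : Diso M (dgzero A) <-> acyclic M.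
Proof.
split=> [[f [g [gf _]]] n x|aM].
  have E y : y = DH g (DH f y).
    by rewrite -[LHS](cohmap_id y); exact/esym/(DH_Deq gf).
  by rewrite [LHS]E [RHS]E !(dgzero_coh (DH f _)).
have hs : quasi_iso (zero_map M (dgzero A)).
  apply/quasi_isoP; split=> n x xc.
    by move=> _; move: x xc; exact/coh_zeroP.
  by exists 0; [exact: closed0|move: xc => _; rewrite (_ : _ - _ = 0);
    [exact: bounding0|exact: (ord1 (_ : 'I_1))]].
exists (Dof (zero_map M (dgzero A))), (Dinv hs); split.
  exact: Deq_invl.
exact: Deq_invr.
Qed.

Variable P : dgmod A -> Prop.
Hypothesis bP : forall M, bounded M -> P M.

(** Modules with one cohomology group, in degree [j], are bounded, and their
    infimum is at least [j]; so the bound on the dimension contains the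
    vanishing of Ext that [cofree_retract_of_vanishing] asks for. *)
Lemma retract_of_dim :
  Diso I (dgzero A) \/ infH I = 0%:E /\ inj_dim_bound P I = 0%:E ->
  cofree_retract K.
Proof.
case=> [/Diso_zero_acyclic aI|[I0 dI]].
  have aK : acyclic K.
    apply/acyclicP => n; apply/Kinj_coh0; exact/coh_zeroP/aI.
  apply: cofree_retract_of_vanishing => //.
    by move=> n _; exact: ((acyclicP K).1 aK n).
  move=> Q j m _ _ f fc.
  have := Kinj_bounding hK aK (gof_closed (dgid K) erefl).
  by move=> /(gcomp_boundingl (addr0 m))/(_ fc); rewrite gcomp_idl.
have [d0 _] := infZ_eq0 dI.
apply: cofree_retract_of_vanishing => //.
  move=> n n0; apply/Kinj_coh0/infH_lt.
  by rewrite I0 lte_fin.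
move=> Q j m Qj mj.
apply/coh_zeroP => x; apply: (d0 Q) => [|].
  apply: bP; exists j, j => n nj; apply/coh_zeroP/Qj; lia.
have Qinf : (j%:E <= infH Q)%E by apply: infH_ge => n nj; apply: Qj; lia.
by apply: ereal_subl_lt Qinf _; lia.
Qed.

(** No bound below 0 is possible: the truncation of [K] in degrees at most 0
    is a bounded module, and its inclusion into [K] is a class in [Ext^0] that
    induces an isomorphism on [H^0]. *)
Lemma dim_of_retract : cofree_retract K ->
  Diso I (dgzero A) \/ infH I = 0%:E /\ inj_dim_bound P I = 0%:E.
Proof.
move=> [D ID [f [g gf]]].
have [I0|nI0] := pselect (forall x : Hm I 0, x = 0); [left|right].
  have /Kinj_coh0 K0 := (coh_zeroP I 0).1 I0.
  have b1 : bounding (gof (dgid K) : homC K K 0).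
    apply: (retract_null ID gf); first exact: gof_closed.
    by move=> z zc; rewrite (ghf_eq _ _ (addr0 0)) gofE; exact: K0.
  apply/Diso_zero_acyclic/acyclicP => n; apply/Kinj_coh0 => x xc.
  by have := ghf_boundingl (addr0 n) b1 xc; rewrite gofE.
have I_lt0 n : n < 0 -> forall x : I n, closed x -> bounding x.
  by move=> n0; apply/Kinj_coh0; exact: (retract_lt0 hA gf).
split.
  apply: infZ_min => [|n [x x0]].
    by apply: contrapT => nx; apply: nI0 => x; apply: contrapT => x0;
      apply: nx; exists x.
  rewrite leNgt; apply/negP => n0; apply: x0.
  by move: x; apply/coh_zeroP; exact: I_lt0.
apply: infZ_min => [N PN i iN|n nS].
  apply/coh_zeroP => F Fc; apply: (retract_null ID gf) => // z zc.
  apply: ghf_boundingr => //; move: z zc; apply: infH_lt.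
  exact: ereal_subl_ltP.
rewrite leNgt; apply/negP => n0; apply: nI0.
(* The bounded module that forbids a negative dimension bound. *)
pose N := trunc hA K 0.
have N0 i : i <> 0 -> forall x : N i, closed x -> bounding x.
  move=> i0 x xc; have [i_gt0|i_le0] := ltP 0 i.
    by rewrite (trunc_gt x i_gt0); exact: bounding0.
  apply: trunc_bounding; apply: (retract_lt0 hA gf); first by lia.
  exact/trunc_closedP.
apply/coh_zeroP/Kinj_coh0 => z zc.
have zt : in_trunc 0 z by exact: in_trunc_closed.
have : bounding (gof (trunc_incl hA K 0) : homC N K 0).
  have := nS N _ 0; move=> /(_ _ _)/coh_zeroP; apply; last exact: gof_closed.
    by apply: bP; exists 0, 0 => i i0; apply/coh_zeroP/N0; lia.
  have N_ge0 : ((0 : int)%:E <= infH N)%E.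
    by apply: infH_ge => i i0; apply: N0; lia.
  by apply: ereal_subl_lt N_ge0 _; lia.
move=> b; have := ghf_boundingl (addr0 0) b
  ((trunc_closedP (TruncEl zt : N 0)).2 zc).
by rewrite gofE.
Qed.
End TheoremDim.

(** * Duality, extension and splitting *)

Section Duality.
Variables (A : dgring) (hA : nonpositive A) (I : dgmod A).
Let K := Kinj I.
Let r : dghom I K := Kinj_map I.
Let hK : K_injective K := @Kinj_K_injective A I.
Let hr : quasi_iso r := @Kinj_map_quasi_iso A I.

(** The inverses in [DExt] and [DH] belong to bijections, so naturality for a
    quasi-isomorphism implies naturality for its formal inverse. *)
Lemma ev_coh_natural n M N (f : Dhom M N) (x : Ext n N I) (h : Hm M (- n)) :
  ev_coh (DExt f x) h = ev_coh x (DH f h).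
Proof.
elim: f x h => {M N} [M N f|M N s hs|M N Q g IHg f IHf] x h /=.
- exact: ev_coh_precomp.
- have hx : cohmap (precomp K s) (xget 0 [set y | cohmap (precomp K s) y = x])
    = x.
    exact/xget_inv/precomp_bij.
  have hh : cohmap s (xget 0 [set w | cohmap s w = h]) = h by exact: xget_inv.
  by rewrite -{1}hh -ev_coh_precomp hx.
- by rewrite IHf IHg.
Qed.

Lemma cohmap_r_bij : bijective (@cohmap I K r 0).
Proof. exact: hr. Qed.

Definition r_inv (y : Hm K 0) : Hm I 0 := xget 0 [set x | cohmap r x = y].

Lemma r_invK y : cohmap r (r_inv y) = y.
Proof. exact/xget_inv/cohmap_r_bij. Qed.

Lemma r_inv_linear : linear r_inv.
Proof.
move=> a x y; apply: (bij_inj cohmap_r_bij).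
by rewrite (morD (@cohmapB _ _ r 0)) cohmapZ !r_invK.
Qed.

Section DualityMap.
Variables (n : int) (M : dgmod A).

Lemma duality_subproof (x : Ext n M I) :
  linear (fun h : Hm M (- n) => r_inv (ev_coh x h)).
Proof. by move=> a h h'; rewrite ev_cohZr r_inv_linear. Qed.

Definition duality_fun (x : Ext n M I) : H0Hom (Hm M (- n)) (Hm I 0) :=
  MkH0Hom (duality_subproof x).

Lemma duality_linear : linear duality_fun.
Proof.
move=> a x y; apply: H0HomP => h /=.
by rewrite ev_cohDl ev_cohZl r_inv_linear.
Qed.

Definition duality : {linear Ext n M I -> H0Hom (Hm M (- n)) (Hm I 0)} :=
  HB.pack duality_fun (GRing.isLinear.Build _ _ _ _ duality_fun duality_linear).

Lemma duality_bijective : cofree_retract K -> bijective duality.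
Proof.
move=> [D ID [f [g gf]]]; apply: bijectiveP => [x y xy|theta].
  apply/eqP; rewrite -subr_eq0; apply/eqP.
  have ev0 (h : Hm M (- n)) : ev_coh (x - y) h = 0.
    have := congr1 (fun phi : H0Hom (Hm M (- n)) (Hm I 0) =>
      cohmap r (h0f phi h)) xy; rewrite /= !r_invK => E.
    by apply: (addIr (ev_coh y h)); rewrite add0r -ev_cohDl subrK.
  move: (x - y : coh (homC M K) n) ev0; elim/coh_ind => F Fc ev0.
  apply/cohcl_eq0; apply: (retract_null ID gf) => // z zc.
  by have := ev0 (cohcl (mkcoc zc)); rewrite ev_coh_cl => /cohcl_eq0.
have [|x xE] := retract_represent hA ID gf
    (theta := fun h : Hm M (- n) => cohmap r (h0f theta h)).
  by move=> a h h'; rewrite h0fL (morD (@cohmapB _ _ r 0)) cohmapZ.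
exists x; apply: H0HomP => h /=; apply: (bij_inj cohmap_r_bij).
by rewrite r_invK xE.
Qed.
End DualityMap.

Definition dual_in_H0 :=
  forall n : int, exists Phi : forall M : dgmod A,
    {linear Ext n M I -> H0Hom (Hm M (- n)) (Hm I 0)},
    (forall M : dgmod A, bijective (Phi M)) /\
    (forall (M N : dgmod A) (f : Dhom M N) (x : Ext n N I) (h : Hm M (- n)),
      Phi M (DExt f x) h = Phi N x (DH f h)).

Lemma duality_of_retract : cofree_retract K -> dual_in_H0.
Proof.
move=> cK n; exists (@duality n); split=> [M|M N f x h].
  exact: duality_bijective.
by rewrite /= ev_coh_natural.
Qed.

Definition extends_along_H0 :=
  forall (M N : dgmod A) (f : Dhom M N),
    injective (DH f : Hm M 0 -> Hm N 0) ->
    forall g : Dhom M I, exists h : Dhom N I, Deq (Dcomp h f) g.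

(** Represent [f] by a map [f'] and let [w] be the projection from its fiber
    to [M]. Since [H^0 f'] is injective, [H^0 w] is zero, so by naturality and
    injectivity of [Phi] every map from [M] to the resolution of [I] becomes
    null-homotopic on the fiber; [fib_factor] gives the extension. *)
Lemma extends_of_duality : dual_in_H0 -> extends_along_H0.
Proof.
move=> /(_ 0)[Phi [PhiB PhiN]] M N f fi g.
have [f' ff'] := Dhom_Kinj (Dcomp (Dof (Kinj_map N)) f) (@Kinj_K_injective A N).
have [g' gg'] := Dhom_Kinj (Dcomp (Dof r) g) hK.
have f'i : injective (@cohmap M (Kinj N) f' 0).
  move=> x y xy; apply: fi; apply: (bij_inj (@Kinj_map_quasi_iso A N 0)).
  have E z : cohmap (Kinj_map N) (DH f z) = cohmap f' z
    by exact: (DH_Deq ff' z).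
  by rewrite !E.
pose w := fib_proj f'.
have w0 (h : Hm (fib f') 0) : cohmap w h = 0.
  apply: f'i; rewrite (mor0 (@cohmapB _ _ f' 0)).
  elim/coh_ind: h => -[y x] zc; rewrite !cohmap_cl; apply/cohcl_eq0.
  have /fib_closedP[_ /(_ (subrK 1 0)) dy] := zc.
  by exists (0 - 1), (subrK 1 0), y.
have g'c : closed (gof g' : homC M K 0) := gof_closed g' erefl.
pose x : Ext 0 M I := cohcl (mkcoc g'c).
have x0 : DExt (Dof w) x = 0 :> Ext 0 (fib f') I.
  apply: (bij_inj (PhiB (fib f'))); apply: H0HomP => h.
  rewrite PhiN [DH _ h]w0 linear0 /=.
  have PxB : zmod_morphism (h0f (Phi M x)).
    by move=> u v; rewrite addrC -scaleN1r h0fL scaleN1r addrC.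
  exact: mor0 PxB.
have [|h hc hg] := @fib_factor A M (Kinj N) K f' 0 (addr0 0) (gof g').
  move: x0; rewrite [LHS]cohmap_cl => /cohcl_eq0.
  rewrite -[cocv _]/(cmapf (precomp K w) (gof g')) (precompE _ (addr0 0)) //.
pose h' := dghom_of (closed_cd hc (add0r 1)).
exists (Dcomp (Dinv hr) (Dcomp (Dof h') (Dof (Kinj_map N)))).
apply: (Deq_cancell hr).
have rX : Deq
    (Dcomp (Dof r) (Dcomp (Dinv hr) (Dcomp (Dof h') (Dof (Kinj_map N)))))
    (Dcomp (Dof h') (Dof (Kinj_map N))).
  apply: Deq_trans (Deq_assoc _ _ _) _.
  exact: Deq_trans (Deq_compl _ (Deq_invr hr)) (Deq_idl _).
apply: Deq_trans (Deq_assoc _ _ _) _; apply: Deq_trans (Deq_compl _ rX) _.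
apply: Deq_trans (Deq_sym (Deq_assoc _ _ _)) _.
apply: Deq_trans (Deq_compr _ ff') _; apply: Deq_trans (Deq_of _ _) _.
apply: Deq_trans _ (Deq_sym gg'); apply: Deq_homotopic; apply: bounding_sym.
by rewrite (gof_comp (addr0 0)) gof_dghom_of.
Qed.

Definition splits_along_H0 :=
  forall (M : dgmod A) (f : Dhom I M),
    injective (DH f : Hm I 0 -> Hm M 0) -> split_mono f.

Lemma splits_of_extends : extends_along_H0 -> splits_along_H0.
Proof. by move=> ext M f fi; exact: ext f fi (Did I). Qed.

(** A retraction in the derived category of a map into a cofree module lifts
    to a homotopy retraction, since its target can be replaced with [K]. *)
Lemma retract_of_splits : splits_along_H0 -> cofree_retract K.
Proof.
move=> spl; have [D [j [ID jz]]] := cofree_embedding K.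
have [|g gf] := spl _ (Dcomp (Dof j) (Dof r)).
  apply: inj_comp; last exact: bij_inj cohmap_r_bij.
  exact/cohmap_injP.
have [g' gg'] := Dhom_Kinj (Dcomp (Dof r) g) hK.
exists D => //; exists j, g'; apply: bounding_sym; rewrite -gof_comp.
apply: Deq_homotopic_Kinj => //; apply: (Deq_cancelr hr).
apply: Deq_trans _ (Deq_sym (Deq_idl _)).
apply: Deq_trans (Deq_compl _ (Deq_sym (Deq_of _ _))) _.
apply: Deq_trans (Deq_sym (Deq_assoc _ _ _)) _.
apply: Deq_trans (Deq_compl _ (Deq_sym gg')) _.
apply: Deq_trans (Deq_sym (Deq_assoc _ _ _)) _.
exact: Deq_trans (Deq_compr _ gf) (Deq_idr _).
Qed.
End Duality.

(** * Projection of a truncation to its cohomology *)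

Section Shift.
Variables (A : dgring) (s : int) (M : dgmod A).

Lemma shift_cd_e (i j : int) : i + 1 = j -> i + s + 1 = j + s.
Proof. by lia. Qed.
Lemma shift_act_e (i j k : int) : i + j = k -> i + (j + s) = k + s.
Proof. by lia. Qed.

Definition shift_cpx : cpx.
Proof.
refine (@Cpx (fun n => M (n + s))
  (fun i j e x => cd (shift_cd_e e) x *~ ksign s) _ _).
- by move=> i j e x y; rewrite cdB mulrzBl.
- by move=> i j k e e' x; rewrite (morMz (cdB _)) cdd !mul0rz.
Defined.

Definition shift : dgmod A.
Proof.
refine (@DGMod A shift_cpx
  (fun i j k e a x => act (shift_act_e e) a x *~ ksign (s * i)) _ _ _ _ _).
- by move=> i j k e m x y; rewrite actBl mulrzBl.
- by move=> i j k e m x y; rewrite actBr mulrzBl.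
- move=> i j k ij jk ijk e1 e2 e3 e4 a b m.
  rewrite (morMz (actBr _ _)) -mulrzA mulrC -ksignD -mulrDr e3.
  by congr (_ *~ _); exact: actA.
- by move=> i e m; rewrite act1 mulr0.
- move=> i j k i' j' k' e ei ej ek el er a m /=.
  rewrite (morMz (cdB _)) (morMz (actBr _ _)).
  rewrite (actd _ ei (shift_cd_e ej) _ (shift_act_e el) (shift_act_e er)).
  rewrite !mulrzDl -!mulrzA; congr (_ *~ _ + _ *~ _).
    by rewrite -ei mulrDr mulr1 ksignD.
  by ring.
Defined.
End Shift.

Lemma closed_deg0 (A : dgring) (hA : nonpositive A) (a : A 0) : closed a.
Proof. exact: hA. Qed.

Section TruncationCohomology.
Variables (A : dgring) (hA : nonpositive A) (Q : dgmod A) (j : int).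
Variable P : dgmod A.
Hypothesis Pj : forall n, n <> j -> forall y : P n, y = 0.
Variable iota : Hm Q j -> P j.
Hypothesis iotaB : zmod_morphism iota.
Hypothesis iotaL : forall (a : A 0) (x : Hm Q j),
  iota ((cohcl (mkcoc (closed_deg0 hA a)) : H0 A) *: x)
  = act (add0r j) a (iota x).

Lemma trunc_closed_at n (e : n = j) (x : trunc hA Q j n) :
  closed (ctr e (trv x)).
Proof.
apply: ctr_closed; have /in_truncP[xc _] := trP x.
by apply: xc; rewrite e.
Qed.

(** The projection of the truncation of [Q] onto its top cohomology, seen in a
    module [P] that is concentrated in degree [j] and contains [H^j Q]
    there. *)
Definition to_coh_fun n (x : trunc hA Q j n) : P n :=
  match n =P j with
  | ReflectT e => ctr (esym e) (iota (cohcl (mkcoc (trunc_closed_at e x))))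
  | _ => 0
  end.

Lemma to_coh_funE n (e : n = j) (x : trunc hA Q j n) :
  to_coh_fun x = ctr (esym e) (iota (cohcl (mkcoc (trunc_closed_at e x)))).
Proof.
rewrite /to_coh_fun; case: eqP => // e'.
by rewrite (eq_irrelevance e e').
Qed.

Lemma to_coh_funB n : zmod_morphism (@to_coh_fun n).
Proof.
move=> x y; have [e|/eqP nj] := eqVneq n j; last by rewrite [LHS]Pj // [RHS]Pj.
rewrite !(to_coh_funE e) -ctrB -iotaB -cohclB; congr (ctr _ (iota (cohcl _))).
by apply: val_inj; exact: ctrB.
Qed.

Program Definition to_coh : dghom (trunc hA Q j) P :=
  @DGHom A (trunc hA Q j) P (@CMap (trunc hA Q j) P to_coh_fun to_coh_funB _) _.
Next Obligation.
move=> i k e x; have [kj|/eqP kj] := eqVneq k j; last first.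
  by rewrite [LHS]Pj // [RHS]Pj.
have ij : i <> j by lia.
rewrite (Pj ij (to_coh_fun x)) (mor0 (cdB _)) (to_coh_funE kj).
rewrite (_ : cohcl _ = 0) ?(mor0 iotaB) ?(mor0 (ctrB _)) //.
apply/cohcl_eq0/ctr_bounding; exists i, e, (trv x) => //.
Qed.
Next Obligation.
move=> p i k e a x; rewrite -[LHS]/(to_coh_fun (act e a x)).
rewrite -[cmapf _ x]/(to_coh_fun x).
have [kj|/eqP kj] := eqVneq k j; last first.
  by rewrite [LHS]Pj // [RHS]Pj.
have [p0|/eqP p0] := eqVneq p 0.
  have ij : i = j by lia.
  rewrite (to_coh_funE kj) (to_coh_funE ij).
  move: p0 ij kj e a x => -> ij kj e a x.
  have e1 : 0 + j = k by lia.
  rewrite (act_ctr (esym ij) e e1) -(ctr_act (esym kj) (add0r j) e1) -iotaL.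
  rewrite [_ *: _]H0act_cl; congr (ctr _ (iota (cohcl _)));
    apply: val_inj => /=.
  have e2 : 0 + i = j by lia.
  by rewrite (ctr_act kj e e2) (act_ctr ij (add0r j) e2).
have [p_gt0|p_le0] := ltP 0 p.
  by rewrite (hA p_gt0 a) !(mor0 (actBl _ _)) (mor0 (@to_coh_funB _)).
have ij : j < i by lia.
rewrite (trunc_gt x ij) (mor0 (actBr _ _)) (mor0 (@to_coh_funB _)).
by rewrite (mor0 (@to_coh_funB _)) (mor0 (actBr _ _)).
Qed.

Lemma to_coh_quasi_iso : bijective iota ->
  (forall n, n < j -> forall x : Q n, closed x -> bounding x) ->
  quasi_iso to_coh.
Proof.
move=> [iota' iotaK iotaK'] Qj.
have P_bounding (y : P j) : bounding y -> y = 0.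
  move=> [k [e [w <-]]]; have kj : k <> j by lia.
  by rewrite (Pj kj w) (mor0 (cdB _)).
apply/quasi_isoP; split=> n.
  move=> x xc bx; have [nj|/eqP nj] := eqVneq n j.
    subst n; apply: trunc_bounding; have := P_bounding _ bx.
    rewrite /= (to_coh_funE erefl) => /(congr1 iota') /=.
    rewrite iotaK -[in RHS](mor0 iotaB) iotaK => /cohcl_eq0 //=.
  have [jn|jn] := ltP j n; first by rewrite (trunc_gt x jn); exact: bounding0.
  by apply: trunc_bounding; apply: Qj; [lia|exact/trunc_closedP].
move=> y yc; have [nj|/eqP nj] := eqVneq n j; last first.
  by exists 0; [exact: closed0|rewrite (Pj nj (_ - _)); exact: bounding0].
subst n; pose z := cohrep (iota' y).
have zt : in_trunc j (cocv z) by apply: in_trunc_closed => //;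
  exact: cocycle_closed.
exists (TruncEl zt : trunc hA Q j j).
  by apply/trunc_closedP/cocycle_closed.
rewrite /= (to_coh_funE erefl) /= (_ : cohcl _ = iota' y); last first.
  by rewrite -[RHS]cohrepK; congr cohcl; exact: val_inj.
by rewrite iotaK' subrr; exact: bounding0.
Qed.
End TruncationCohomology.

(** * Modules over rings *)

Lemma dgring_of_ring_nonpositive (B : pzRingType) :
  nonpositive (dgring_of_ring B).
Proof. by move=> i i0 a; apply: conc_eq0; lia. Qed.

Section ModulesInDegree.
Variables (B : pzRingType) (N : dgmod (dgring_of_ring B)) (n : int).

(** Over a ring, the components, the cocycles and the cohomology of a
    DG-module are modules; the aliases [deg_mod], [coc_mod] and [coh_mod]
    carry these structures. *)
Definition deg_mod : Type := N n.
HB.instance Definition _ := GRing.Zmodule.on deg_mod.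

Definition deg_scale (b : B) (x : deg_mod) : deg_mod :=
  act (add0r n) (b : dgring_of_ring B 0) (x : N n).

Lemma deg_scaleA (a b : B) (x : deg_mod) :
  deg_scale a (deg_scale b x) = deg_scale (a * b) x.
Proof. exact: (actA (add0r n) (add0r n) (add0r 0) (add0r n)). Qed.
Lemma deg_scale1 : left_id 1 deg_scale.
Proof. by move=> x; exact: act1. Qed.
Lemma deg_scaleDr : right_distributive deg_scale +%R.
Proof. by move=> b x y; exact: (morD (actBr _ _)). Qed.
Lemma deg_scaleDl x : {morph deg_scale^~ x : a b / a + b}.
Proof. by move=> a b; exact: (morD (actBl _ _)). Qed.

HB.instance Definition _ := GRing.Zmodule_isLmodule.Build B deg_mod
  deg_scaleA deg_scale1 deg_scaleDr deg_scaleDl.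

Let closedB (b : B) : closed (b : dgring_of_ring B 0) :=
  closed_deg0 (@dgring_of_ring_nonpositive B) b.

Definition coc_mod : Type := cocycle N n.
HB.instance Definition _ := GRing.Zmodule.on coc_mod.

Definition coc_scale (b : B) (x : coc_mod) : coc_mod :=
  coc_act (mkcoc (closedB b)) (x : cocycle N n).

Lemma coc_scaleA (a b : B) (x : coc_mod) :
  coc_scale a (coc_scale b x) = coc_scale (a * b) x.
Proof. by apply: cocycle_eq; exact: deg_scaleA. Qed.
Lemma coc_scale1 : left_id 1 coc_scale.
Proof. by move=> x; apply: cocycle_eq; exact: deg_scale1. Qed.
Lemma coc_scaleDr : right_distributive coc_scale +%R.
Proof. by move=> b x y; apply: cocycle_eq; exact: deg_scaleDr. Qed.
Lemma coc_scaleDl x : {morph coc_scale^~ x : a b / a + b}.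
Proof. by move=> a b; apply: cocycle_eq; exact: deg_scaleDl. Qed.

HB.instance Definition _ := GRing.Zmodule_isLmodule.Build B coc_mod
  coc_scaleA coc_scale1 coc_scaleDr coc_scaleDl.

Definition coh_mod : Type := coh N n.
HB.instance Definition _ := GRing.Zmodule.on coh_mod.

Definition coh_scale (b : B) (x : coh_mod) : coh_mod :=
  H0act (cohcl (mkcoc (closedB b))) (x : Hm N n).

Lemma coh_scale_cl b z : coh_scale b (cohcl z) = cohcl (coc_scale b z).
Proof. exact: H0act_cl. Qed.

Lemma coh_scaleA (a b : B) (x : coh_mod) :
  coh_scale a (coh_scale b x) = coh_scale (a * b) x.
Proof. by rewrite -(cohrepK x) !coh_scale_cl coc_scaleA. Qed.
Lemma coh_scale1 : left_id 1 coh_scale.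
Proof. by move=> x; rewrite -(cohrepK x) coh_scale_cl coc_scale1. Qed.
Lemma coh_scaleDr : right_distributive coh_scale +%R.
Proof. by move=> b x y; exact: H0actDr. Qed.
Lemma coh_scaleDl x : {morph coh_scale^~ x : a b / a + b}.
Proof.
move=> a b; rewrite -(cohrepK x) !coh_scale_cl coc_scaleDl.
exact: (morD (@cohclB _ _)).
Qed.

HB.instance Definition _ := GRing.Zmodule_isLmodule.Build B coh_mod
  coh_scaleA coh_scale1 coh_scaleDr coh_scaleDl.
End ModulesInDegree.

Lemma conc_act_neq0 (B : pzRingType) (N : dgmod (dgring_of_ring B))
    (i j k : int) (e : i + j = k) (b : dgring_of_ring B i) (m : N j) :
  i <> 0 -> act e b m = 0.
Proof.
by move=> i0; rewrite (conc_eq0 (b : conc B i) i0) (mor0 (actBl _ _)).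
Qed.

(** A closed map from [N] to [J] kills boundaries, hence is induced by a map
    defined on the boundaries of the next degree. As [N] is acyclic these are
    the cocycles, a submodule, and the map extends from it because [J] is
    injective. *)
Lemma dgmod_of_mod_K_injective (B : pzRingType) (J : lmodType B) :
  injective_module J -> K_injective (dgmod_of_mod J).
Proof.
move=> IJ N aN; apply/acyclicP => n F Fc.
pose F0 (y : N (- n)) : J := ghf F (addNr n) y.
have F0B : zmod_morphism F0 by exact (ghfB F (addNr n)).
have F0b y : bounding y -> F0 y = 0.
  move=> [k [e [w <-]]].
  have f1 : k + (n + 1) = 0 by lia.
  have f2 : k + n = 0 - 1 by lia.
  have := congr1 (fun g : ghom N _ _ => ghf g f1 w) Fc.
  rewrite [LHS](ghomdE erefl F f1 e (subrK 1 0) f2 (addNr n)) sub0r.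
  move=> /(congr1 (fun x : J => x *~ ksign n)).
  rewrite mulNrz -mulrzA ksignM mulr1z.
  move=> /(congr1 (fun x : J => - x)); rewrite opprK => E.
  by rewrite /F0 E [ghf 0 _ _]/= mul0rz oppr0.
have en : - n + 1 = - (n - 1) by lia.
pose U : lmodType B := coc_mod N (- (n - 1)).
pose V : lmodType B := deg_mod N (- (n - 1)).
have lift (z : U) : exists y : N (- n), cd en y = cocv z.
  apply: boundingP; move: (cocycle_closed z); exact: ((acyclicP N).1 aN).
pose s z := projT1 (cid (lift z)).
have sE z : cd en (s z) = cocv z := projT2 (cid (lift z)).
have F0_eq y y' : cd en y = cd en y' -> F0 y = F0 y'.
  move=> E; apply/eqP; rewrite -subr_eq0 -F0B; apply/eqP/F0b.
  apply: ((acyclicP N).1 aN); apply: (closedI (e := en)).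
  by rewrite cdB E subrr.
(* Well defined because [F0] only depends on the boundary of its argument. *)
pose g0 (z : U) : J := F0 (s z).
have g0L : linear g0.
  move=> b x y; rewrite -[RHS]/(b *: F0 (s x) + F0 (s y)).
  have -> : b *: F0 (s x)
      = F0 (act (add0r (- n)) (b : dgring_of_ring B 0) (s x)).
    rewrite /F0 (ghfL F _ _ (addNr n) (add0r 0)) mulr0 ksign0 mulr1z //.
  rewrite -(morD F0B); apply: F0_eq; rewrite sE (morD (cdB _)) sE.
  have e1 : 0 + 1 - n = - (n - 1) by lia.
  rewrite (actd (add0r (- n)) (add0r 1) en en e1 (add0r _)).
  by rewrite (mor0 (actBl _ _)) add0r sE.
pose u : {linear U -> V} := HB.pack (fun z : U => cocv z : V)
  (GRing.isLinear.Build B U V *:%R (fun z : U => cocv z : V)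
    (fun _ _ _ => erefl)).
pose g : {linear U -> J} := HB.pack g0 (GRing.isLinear.Build B U J *:%R g0 g0L).
have [|h hu] := IJ U V u g; first by move=> x y; exact: cocycle_eq.
have hi (i j : int) (e : i + (n - 1) = j) : j = 0 -> i = - (n - 1) by lia.
pose H0fun i j (e : i + (n - 1) = j) (x : N i) : conc J j :=
  conc_at (fun j0 : j = 0 => h (ctr (hi i j e j0) x)).
have HB i j e : zmod_morphism (@H0fun i j e).
  move=> x y; rewrite /H0fun -conc_atB; congr conc_at; apply/funext => j0.
  by rewrite ctrB linearB.
have HL p i j k l (e1 : p + i = k) (e2 : k + (n - 1) = l) (e3 : i + (n - 1) = j)
    (e4 : p + j = l) (a : dgring_of_ring B p) m :
  H0fun k l e2 (act e1 a m) = act e4 a (H0fun i j e3 m : dgmod_of_mod J j)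
    *~ ksign ((n - 1) * p).
  have [p0|/eqP p0] := eqVneq p 0; last first.
    by rewrite !conc_act_neq0 // mul0rz (mor0 (@HB _ _ _)).
  have [l0|/eqP l0] := eqVneq l 0;
    last by rewrite [LHS]conc_eq0 // [RHS]conc_eq0.
  have j0 : j = 0 by lia.
  move: p0 j0 l0 e1 e2 e3 e4 a => -> -> -> e1 e2 e3 e4 a.
  rewrite mulr0 ksign0 mulr1z /H0fun /= -linearZ; congr (h _).
  rewrite -[RHS]/(act (add0r _) a (ctr (hi i 0 e3 erefl) m)).
  have f1 : 0 + i = - (n - 1) by rewrite add0r; lia.
  by rewrite (ctr_act _ _ f1) (act_ctr _ _ f1).
exists (n - 1), (subrK 1 n), (@GHom _ N (dgmod_of_mod J) (n - 1) H0fun HB HL *~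
  ksign n).
rewrite [LHS](morMz (ghomdB _)); apply: ghomP => i j e x.
have [j0|/eqP j0] := eqVneq j 0; last by rewrite [LHS]conc_eq0 // [RHS]conc_eq0.
have f1 : i + (n - 1) = j - 1 by lia.
have f2 : i + 1 + (n - 1) = j by lia.
rewrite ghomMzE (ghomdE _ _ e erefl (subrK 1 j) f1 f2) /= sub0r.
rewrite (ksignS (subrK 1 n)) mulNrz mulrNz opprK -mulrzA ksignM mulr1z.
move: j0 e f1 f2 => -> e f1 f2; rewrite /H0fun /=.
set dx := ctr _ _; have dxc : closed dx by apply: ctr_closed; exact: cdd.
have := hu (mkcoc dxc); rewrite /= => ->.
have xi : i = - n by lia.
rewrite -[RHS](ghf_ctr F xi (addNr n)) -[RHS]/(F0 (ctr xi x)).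
have xi1 : i + 1 = - (n - 1) by lia.
by apply: F0_eq; rewrite sE /dx /= (ctr_cd _ _ xi1) (cd_ctr _ _ xi1).
Qed.

Section ToH0.
Variables (A : dgring) (hA : nonpositive A).

Definition to_H0_fun (i : int) : A i -> dgring_of_ring (H0 A) i :=
  match i return A i -> conc (H0 A) i with
  | Posz 0 => fun a => cohcl (mkcoc (closed_deg0 hA a))
  | _ => fun _ => 0
  end.

Lemma to_H0_funB i : zmod_morphism (@to_H0_fun i).
Proof.
case: i => [[|i]|i] x y; rewrite /= ?subrr // -cohclB.
by congr cohcl; exact: val_inj.
Qed.

Program Definition to_H0 : dgring_map A (dgring_of_ring (H0 A)) :=
  @DGRingMap A (dgring_of_ring (H0 A)) (@CMap A (dgring_of_ring (H0 A))
    to_H0_fun to_H0_funB _) _ _.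
Next Obligation.
move=> i j e x; have [j0|/eqP j0] := eqVneq j 0; last first.
  by rewrite [LHS]conc_eq0 // [RHS]conc_eq0.
by move: j0 e => -> e; apply/cohcl_eq0; exists i, e, x.
Qed.
Next Obligation.
move=> i j k e a b; rewrite /=; have [i0|/eqP i0] := eqVneq i 0; last first.
  rewrite conc_map2_0; last by apply/orP; left; apply/eqP.
  have [k0|/eqP k0] := eqVneq k 0; last by rewrite [LHS]conc_eq0.
  suff -> : dmul e a b = 0 by exact: (mor0 (@to_H0_funB k)).
  have [i1|i1] := ltP 0 i; first by rewrite (hA i1 a) (mor0 (dmulBl _ _)).
  have j1 : 0 < j by lia.
  by rewrite (hA j1 b) (mor0 (dmulBr _ _)).
have [j0|/eqP j0] := eqVneq j 0; last first.
  rewrite conc_map2_0; last by apply/orP; right; apply/eqP.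
  by rewrite [LHS]conc_eq0 //; lia.
have k0 : k = 0 by lia.
move: i0 j0 k0 e a b => -> -> -> e a b /=; rewrite H0mul_cl; congr cohcl.
by apply: cocycle_eq; rewrite /= (eq_irrelevance e (add0r 0)).
Qed.
Next Obligation. by congr cohcl; exact: cocycle_eq. Qed.
End ToH0.

Lemma shift_conc_coh0 (B : pzRingType) (V W : lmodType B) (j m : int) :
  m + j <> 0 ->
  forall F : homC (shift (- j) (dgmod_of_mod V)) (dgmod_of_mod W) m,
  bounding F.
Proof.
move=> mj F; rewrite (_ : F = 0); first exact: bounding0.
apply: ghomP => i k e x; have [ij|/eqP ij] := eqVneq (i - j) 0.
  by rewrite [LHS]conc_eq0 ?[RHS]conc_eq0 //; lia.
by rewrite (conc_eq0 (x : conc V (i - j)) ij) (mor0 (ghfB _ _)).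
Qed.

Section RingDuality.
Variables (A : dgring) (hA : nonpositive A) (I : dgmod A).
Let K := Kinj I.
Let hK : K_injective K := @Kinj_K_injective A I.

Lemma Diso_homotopy_retract (B : dgring) (L J : dgmod B) :
  K_injective L -> K_injective J -> Diso L J -> homotopy_retract L J.
Proof.
move=> hL hJ [w [w' [w'w _]]].
have [a wa] := Dhom_Kinj w hJ; have [b w'b] := Dhom_Kinj w' hL.
exists a, b; apply: bounding_sym; rewrite -gof_comp.
apply: Deq_homotopic_Kinj => //; apply: Deq_trans (Deq_sym (Deq_of _ _)) _.
apply: Deq_trans _ w'w; apply: Deq_comp; exact: Deq_sym.
Qed.

Lemma homotopy_retract_coh0 (B : dgring) (L J M : dgmod B) m :
  homotopy_retract L J ->
  (forall F : homC M J m, closed F -> bounding F) ->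
  forall F : homC M L m, closed F -> bounding F.
Proof.
move=> [a [b ba]] MJ F Fc; apply: (retract_reflects_bounding ba Fc).
by apply: MJ; apply: gcomp_closed => //; exact: gof_closed.
Qed.

(** If [Q] has cohomology [V] in degree [j] only, then maps from [Q] to [K]
    are, up to homotopy, maps over [H^0 A] from [V] in degree [j] to the dual
    of [H^0 A], hence to [J] in degree 0; their classes vanish in all degrees
    but [- j]. Taking for [Q] the truncation of [K] at its lowest cohomology,
    and for the map the inclusion, shows that [K] has no cohomology in
    negative degrees. *)
Lemma retract_of_H0_dual (J : lmodType (H0 A)) :
  bounded_below I -> injective_module J ->
  Diso (RHom_ring (to_H0 hA) I) (dgmod_of_mod J) -> cofree_retract K.
Proof.
move=> [c Ic] IJ LJ.
have {}LJ := Diso_homotopy_retract (@homB_K_injective _ _ (to_H0 hA) K hK)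
  (dgmod_of_mod_K_injective IJ) LJ.
have vK (Q : dgmod A) (j m : int) : coh_only Q j -> m + j <> 0 ->
    forall F : homC Q K m, closed F -> bounding F.
  move=> Qj mj F Fc.
  pose S := shift (- j) (dgmod_of_mod (Hm Q j : lmodType (H0 A))).
  pose P := restr (to_H0 hA) S.
  have PK : forall G : homC P K m, closed G -> bounding G.
    apply/adj_coh0; apply: homotopy_retract_coh0 LJ _ => G _.
    exact: shift_conc_coh0.
  have Pj n : n <> j -> forall y : P n, y = 0.
    by move=> nj y; apply: (conc_eq0 (y : conc _ (n - j))); lia.
  pose iota (x : Hm Q j) : P j :=
    @ctr (conc_cpx (Hm Q j)) 0 (j - j) (esym (subrr j)) x.
  have iotaB : zmod_morphism iota.
    exact (@ctrB (conc_cpx (Hm Q j)) 0 (j - j) (esym (subrr j))).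
  have iotaL (a : A 0) (x : Hm Q j) :
      iota ((cohcl (mkcoc (closed_deg0 hA a)) : H0 A) *: x)
      = act (add0r j) a (iota x).
    rewrite /= mulr0 ksign0 mulr1z.
    have e1 : 0 + 0 = j - j by lia.
    rewrite -[RHS]/(act (shift_act_e (- j) (add0r j)) (to_H0_fun hA a)
      (iota x : dgmod_of_mod _ (j - j))).
    rewrite /iota (act_ctr (M := dgmod_of_mod _) _ _ e1).
    by rewrite -(ctr_act (esym (subrr j)) (add0r 0) e1).
  have iota_bij : bijective iota.
    exists (@ctr (conc_cpx (Hm Q j)) (j - j) 0 (subrr j)) => x.
      by rewrite /iota (ctr_ctr _ _ erefl) ctr_id.
    by rewrite /iota (ctr_ctr _ _ erefl) ctr_id.
  have psi_qis : quasi_iso (to_coh Pj iotaB iotaL).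
    by apply: to_coh_quasi_iso => // n nj; apply: Qj; lia.
  have incl_qis : quasi_iso (trunc_incl hA Q j).
    by apply: trunc_incl_quasi_iso => n nj; apply: Qj; lia.
  apply: (Kinj_lift_bounding hK incl_qis (e := add0r m)) => //.
  have Fi : closed (gcomp (add0r m) F (gof (trunc_incl hA Q j)) : homC _ K m).
    by apply: gcomp_closed => //; exact: gof_closed.
  have [G Gc FG] := Kinj_lift hK psi_qis (add0r m) Fi.
  rewrite -[gcomp _ F _]
    (subrK (gcomp (add0r m) G (gof (to_coh Pj iotaB iotaL)))).
  apply: boundingD => //; apply: gcomp_boundingl; last exact: gof_closed.
  exact: PK.
(* Induction upwards from the lower bound [c] of the cohomology of [I]. *)
have K0 (l : nat) n : n < c + l%:Z -> n < 0 ->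
    forall x : K n, closed x -> bounding x.
  elim: l n => [|l IHl] n nl n0.
    have nc : n < c by lia.
    exact: ((@Kinj_coh0 A I n).1 ((coh_zeroP I n).1 (Ic n nc))).
  have [nl'|nl'] := ltP n (c + l%:Z); first exact: IHl.
  have nE : n = c + l%:Z by lia.
  pose N := trunc hA K n.
  have Nn : coh_only N n.
    move=> i ni x xc; have [n_lt|n_ge] := ltP n i.
      by rewrite (trunc_gt x n_lt); exact: bounding0.
    by apply: trunc_bounding; apply: IHl; [lia|lia|exact/trunc_closedP].
  have n_neq0 : 0 + n <> 0 by lia.
  have b := vK N n 0 Nn n_neq0 _ (gof_closed (trunc_incl hA K n) erefl).
  move=> z zc; pose zt : N n := TruncEl (in_trunc_closed (lexx n) zc).
  have := ghf_boundingl (addr0 n) b ((trunc_closedP zt).2 zc).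
  by rewrite gofE.
apply: cofree_retract_of_vanishing => // [n n0|Q j m Qj mj].
  by apply: (K0 (absz (n - c + 1))) => //; lia.
by apply: vK Qj _; lia.
Qed.
End RingDuality.

(** * Coinduction to a ring *)

Lemma Diso_span (B : dgring) (M N P : dgmod B) (s : dghom P M) (t : dghom P N) :
  quasi_iso s -> quasi_iso t -> Diso M N.
Proof.
have cancel (X Y Z : dgmod B) (a : dghom X Y) (b : dghom X Z)
    (ha : quasi_iso a) (hb : quasi_iso b) :
    Deq (Dcomp (Dcomp (Dof a) (Dinv hb)) (Dcomp (Dof b) (Dinv ha))) (Did Y).
  apply: Deq_trans (Deq_assoc _ _ _) _.
  apply: Deq_trans _ (Deq_invr ha); apply: Deq_compl.
  apply: Deq_trans (Deq_sym (Deq_assoc _ _ _)) _.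
  exact: Deq_trans (Deq_compr _ (Deq_invl hb)) (Deq_idr _).
move=> hs ht; exists (Dcomp (Dof t) (Dinv hs)), (Dcomp (Dof s) (Dinv ht)).
by split; exact: cancel.
Qed.

Section DualRing.
Variables (A : dgring) (hA : nonpositive A) (K : dgmod A).
Variables (D : zmodType) (f : dghom K (cofree A D)) (g : dghom (cofree A D) K).
Hypothesis ID : injective_group D.
Hypothesis gf :
  bounding (gof (dgid K) - gcomp (addr0 0) (gof g) (gof f) : homC K K 0).
Variables (B : pzRingType) (phi : dgring_map A (dgring_of_ring B)).
Let L := homB phi K.
Let BA := dgrestr phi.
Let hB := @dgring_of_ring_nonpositive B.

Lemma homB_coh_only0 : coh_only L 0.
Proof.
move=> n n0 F Fc; apply: (retract_null ID gf) => // z _.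
have z0 : z = 0 by apply: (conc_eq0 (z : conc B (- n))); lia.
by rewrite z0 (mor0 (ghfB _ _)); exact: bounding0.
Qed.

(** A module with cohomology in degree 0 only is isomorphic to this
    cohomology, through its truncation. *)
Lemma homB_Diso : Diso L (dgmod_of_mod (coh_mod L 0 : lmodType B)).
Proof.
have Pj n : n <> 0 ->
    forall y : dgmod_of_mod (coh_mod L 0 : lmodType B) n, y = 0.
  by move=> n0 y; exact: (conc_eq0 (y : conc _ n)).
have iotaB : zmod_morphism
    (fun x : Hm L 0 => x : dgmod_of_mod (coh_mod L 0 : lmodType B) 0) by [].
have iotaL (a : dgring_of_ring B 0) (x : Hm L 0) :
    ((cohcl (mkcoc (closed_deg0 hB a)) : H0 (dgring_of_ring B)) *: x :
      dgmod_of_mod (coh_mod L 0 : lmodType B) 0)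
    = act (add0r 0) a (x : dgmod_of_mod (coh_mod L 0 : lmodType B) 0).
  by [].
apply: (@Diso_span _ _ _ _ (trunc_incl hB L 0) (to_coh Pj iotaB iotaL)).
  by apply: trunc_incl_quasi_iso => n n0; apply: homB_coh_only0; lia.
apply: to_coh_quasi_iso; first by exists id.
by move=> n n0; apply: homB_coh_only0; lia.
Qed.

Let at_one (X : dgmod A) (F : ghom BA X 0) (b : B) : X 0 :=
  ghf F (addr0 0) (b : BA 0).

Lemma bact0E (X : dgmod A) (F : homB phi X 0) (b c : B) :
  at_one (act (add0r 0) (b : dgring_of_ring B 0) F : homB phi X 0) c
  = at_one F (c * b).
Proof.
rewrite /at_one [act _ _ _]/=.
rewrite [LHS](bact_funE (add0r 0) _ _ (addr0 0) (add0r 0) (addr0 0)).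
by rewrite mul0r mulr1z.
Qed.

Lemma bact0_gcomp (X Y : dgmod A) (t : dghom X Y) (F : homB phi X 0) (b : B) :
  act (add0r 0) (b : dgring_of_ring B 0)
    (gcomp (addr0 0) (gof t) F : homB phi Y 0)
  = gcomp (addr0 0) (gof t)
      (act (add0r 0) (b : dgring_of_ring B 0) F : homB phi X 0) :> homB phi Y 0.
Proof.
apply: ghomP => i j e x.
rewrite [RHS](gcompE (addr0 0) (gof t) _ e e (addr0 j)) gofE.
rewrite -[LHS]/(bact_fun _ _ _ _ _) -[ghf (act _ _ F) _ _]/(bact_fun _ _ _ _ _).
rewrite /bact_fun (morMz (@cmapB _ _ t j)); congr (_ *~ _).
by rewrite (gcompE (addr0 0) (gof t) F _ (bact_e (add0r 0) e) (addr0 j)) gofE.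
Qed.

Lemma cofree_unique (G G' : ghom BA (cofree A D) 0) :
  (forall b, cofree_ev (at_one G b) = cofree_ev (at_one G' b)) ->
  bounding (G - G' : homC BA (cofree A D) 0).
Proof.
move=> GG'; apply: cofree_bounding => // z _.
rewrite ghomBE cofree_evB; apply/eqP; rewrite subr_eq0; apply/eqP.
have := GG' (z : B); rewrite /at_one.
by rewrite (ghf_eq _ _ (addNr 0)) (ghf_eq G' _ (addNr 0)).
Qed.

Let eps (x : coh L 0) : D :=
  cofree_ev (cmapf f (at_one (cocv (cohrep x) : ghom BA K 0) 1)).

Lemma eps_cl (F : cocycle L 0) :
  eps (cohcl F) = cofree_ev (cmapf f (at_one (cocv F : ghom BA K 0) 1)).
Proof.
have : bounding (cocv (cohrep (cohcl F)) - cocv F) by apply/cohcl_eq/cohrepK.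
have onec : closed ((1 : B) : BA 0) by [].
move=> /(ghf_boundingl (addr0 0))/(_ onec)/(cmap_bounding f)/coind_ev_bounding.
move=> /eqP; rewrite ghomBE cmapB coind_evB subr_eq0 => /eqP.
by [].
Qed.

Lemma epsB : zmod_morphism eps.
Proof.
elim/coh_ind => x xc; elim/coh_ind => y yc; rewrite -cohclB !eps_cl.
by rewrite -cofree_evB -cmapB.
Qed.

Lemma eps_scale (b : B) (F : L 0) (Fc : closed F) :
  eps (b *: (cohcl (mkcoc Fc) : coh_mod L 0))
  = cofree_ev (cmapf f (at_one (F : ghom BA K 0) b)).
Proof.
by rewrite [b *: _]coh_scale_cl eps_cl [cocv _]/= bact0E mul1r.
Qed.

(** Write [eps x] for the value of [f x] at the unit of [B] and of [A]. A map
    [h0] from [U] to this module gives an additive map [eps h0], which extends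
    along [u] to some [eta] on [V]. The extension of [h0] sends [v] to the
    class of [g G], where [G] is the map to the cofree module that represents
    [b |-> eta (b v)]. On [U] the maps [G] and [f h0] agree up to homotopy, so
    the retraction [g] returns [h0]. *)
Lemma coh_homB_injective : injective_module (coh_mod L 0 : lmodType B).
Proof.
move=> U V u h0 ui.
have [|||eta etaB etaU] := ID (u := u) (g := fun x => eps (h0 x)).
- by move=> x y; rewrite linearB.
- by move=> x y; rewrite linearB epsB.
- move=> x ux; have -> : x = 0 by apply: ui; rewrite ux linear0.
  by rewrite linear0 (mor0 epsB).
have rep (v : V) : exists G : ghom BA (cofree A D) 0,
    closed (G : homC BA (cofree A D) 0) /\
    forall b, cofree_ev (at_one G b) = eta (b *: v).
  have [||G Gc GE] := @cofree_represent A D ID BA 0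
      (fun z => eta ((cocv z : B) *: v)).
  - by move=> x y; rewrite -etaB -scalerBl.
  - by move=> z [k [e [y <-]]]; rewrite scale0r (mor0 etaB).
  exists G; split=> // b; have bc : closed (b : BA 0) by [].
  by rewrite -(GE (mkcoc bc)) /at_one; congr cofree_ev; exact: ghf_eq.
pose G v := projT1 (cid (rep v)).
have Gc v : closed (G v : homC BA (cofree A D) 0) := (projT2 (cid (rep v))).1.
have GE v b : cofree_ev (at_one (G v) b) = eta (b *: v) :=
  (projT2 (cid (rep v))).2 b.
have gGc v : closed (gcomp (addr0 0) (gof g) (G v) : homC BA K 0).
  by apply: gcomp_closed => //; exact: gof_closed.
pose h v : coh_mod L 0 := cohcl (mkcoc (gGc v : closed (gcomp _ _ _ : L 0))).
have gc : closed (gof g : homC _ K 0) := gof_closed g erefl.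
have hL : linear h.
  move=> b v w; rewrite -[RHS]/(coh_scale b (h v) + h w) /h coh_scale_cl.
  rewrite -(morD (@cohclB L 0)); apply/cohcl_eq.
  rewrite -[cocv (_ + _)]/((act (add0r 0) (b : dgring_of_ring B 0)
    (gcomp (addr0 0) (gof g) (G v) : L 0) : ghom BA K 0)
    + gcomp (addr0 0) (gof g) (G w)) bact0_gcomp.
  rewrite -[cocv _]/(gcomp (addr0 0) (gof g) (G (b *: v + w))).
  rewrite -(morD (gcompBr (addr0 0) (gof g))) -(gcompBr (addr0 0) (gof g)).
  apply: gcomp_boundingr => //; apply: cofree_unique => c.
  rewrite GE -[at_one _ c]/(at_one (act (add0r 0) (b : dgring_of_ring B 0)
    (G v : homB phi (cofree A D) 0) :
      homB phi (cofree A D) 0) c + at_one (G w) c).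
  rewrite (morD (@cofree_evB A D)) bact0E !GE scalerDr (morD etaB) scalerA //.
pose hl : {linear V -> coh_mod L 0} := HB.pack h
  (GRing.isLinear.Build B V (coh_mod L 0) *:%R h hL).
exists hl => x; rewrite -[hl _]/(h (u x)).
have geq : forall b, eta (b *: u x) = eps (b *: h0 x).
  by move=> b; rewrite -linearZ etaU linearZ.
move: (h0 x) geq; elim/coh_ind => F Fc geq; apply/cohcl_eq.
rewrite -[cocv _]/(gcomp (addr0 0) (gof g) (G (u x))) -[cocv (mkcoc Fc)]/F.
have fFc : closed (gcomp (addr0 0) (gof f) F : homC BA _ 0).
  by apply: gcomp_closed => //; exact: gof_closed.
have b1 : bounding (G (u x) - gcomp (addr0 0) (gof f) F : homC BA _ 0).
  apply: cofree_unique => b; rewrite GE geq eps_scale; congr cofree_ev.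
  by rewrite /at_one (gcompE _ _ _ (addr0 0) (addr0 0) (addr0 0)) gofE.
have b2 := gcomp_boundingr (addr0 0) gc b1.
have b3 := gcomp_boundingl (addr0 0) gf (Fc : closed (F : homC BA K 0)).
have := boundingB b2 b3; rewrite gcompBr gcompBl gcomp_idl.
rewrite (gcompA _ _ (addr0 0) (addr0 0)) opprB addrA subrK //.
Qed.
End DualRing.

Lemma ring_dual_of_retract (A : dgring) (hA : nonpositive A) (I : dgmod A) :
  cofree_retract (Kinj I) ->
  bounded_below I /\
  forall (B : pzRingType) (phi : dgring_map A (dgring_of_ring B)),
    exists J : lmodType B,
      injective_module J /\ Diso (RHom_ring phi I) (dgmod_of_mod J).
Proof.
move=> [D ID [f [g gf]]]; split.
  exists 0 => n n0; apply/coh_zeroP/Kinj_coh0.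
  exact: (retract_lt0 hA gf).
move=> B phi; exists (coh_mod (homB phi (Kinj I)) 0).
split; first exact: coh_homB_injective ID gf _ _.
exact: homB_Diso ID gf _ _.
Qed.

(** * Equivalence of the six conditions *)

Theorem theorem1p1 (A : dgring) (hA : nonpositive A) (I : dgmod A) :
  [<-> Diso I (dgzero A) \/
         infH I = 0%:E /\ inj_dim_bound (@bounded A) I = 0%:E;
       Diso I (dgzero A) \/
         infH I = 0%:E /\ inj_dim_bound (@bounded_below A) I = 0%:E;
       bounded_below I /\
         forall (B : pzRingType) (phi : dgring_map A (dgring_of_ring B)),
           exists J : lmodType B,
             injective_module J /\ Diso (RHom_ring phi I) (dgmod_of_mod J);
       forall n : int,
         exists Phi : forall M : dgmod A,
             {linear Ext n M I -> H0Hom (Hm M (- n)) (Hm I 0)},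
           (forall M : dgmod A, bijective (Phi M)) /\
           (forall (M N : dgmod A) (f : Dhom M N) (x : Ext n N I)
                   (h : Hm M (- n)),
              Phi M (DExt f x) h = Phi N x (DH f h));
       forall (M N : dgmod A) (f : Dhom M N),
         injective (DH f : Hm M 0 -> Hm N 0) ->
         forall g : Dhom M I, exists h : Dhom N I, Deq (Dcomp h f) g;
       forall (M : dgmod A) (f : Dhom I M),
         injective (DH f : Hm I 0 -> Hm M 0) -> split_mono f].
Proof.
have bP : forall M : dgmod A, bounded M -> bounded M by [].
have bbP (M : dgmod A) : bounded M -> bounded_below M.
  by move=> [a [b ab]]; exists a => n na; apply: ab; left.
tfae.
- by move=> /(retract_of_dim hA bP)/(dim_of_retract hA bbP).
- by move=> /(retract_of_dim hA bbP)/(ring_dual_of_retract hA).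
- move=> [Ib /(_ _ (to_H0 hA))[J [IJ LJ]]].
  exact/duality_of_retract/(retract_of_H0_dual Ib IJ LJ).
- exact: extends_of_duality.
- exact: splits_of_extends.
- by move=> /retract_of_splits/(dim_of_retract hA bP).
Qed.
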